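(* Let the tree $\mathcal{A}$, the function $h$, the weights $u,w$, the numbers $1<p\le\infty$, $1\le q<\infty$ and the weighted summation operator $S_{u,w,\mathcal{A}}$ be as in the context, and let $\theta>0$. All relations $\asymp$ below hold for all sufficiently large $n\in\mathbb{N}$, with constants depending only on $\mathfrak{Z}=(p,q,u,w,h,m_*,c_* )$. 1. Suppose that $\kappa>\theta\left(\frac1q-\frac1p\right)_+$. Set $\alpha_0=\alpha$ if $\kappa_w>\frac\theta q$ and $\alpha_0=\alpha-\frac1q$ if $\kappa_w=\frac\theta q$. Then $$e_n(S_{u,w,\mathcal{A}}:l_p(\mathcal{A})\to l_q(\mathcal{A}))\asymp n^{-\frac\kappa\theta+\frac1q-\frac1p}(\log n)^{-\alpha_0-\frac{\kappa\gamma}{\theta}}\rho(\log n)\,\tau^{-\frac\kappa\theta}(\log n).$$ 2. Suppose that $\kappa=\theta\left(\frac1q-\frac1p\right)_+$. (a) Let $p\ge q$, and let $\alpha_0:=\alpha-(1-\gamma)\left(\frac1q-\frac1p\right)>0$ if $\kappa_w>\frac\theta q$, $\alpha_0:=\alpha-1-(1-\gamma)\left(\frac1q-\frac1p\right)>0$ if $\kappa_w=\frac\theta q$. Then $$e_n(S_{u,w,\mathcal{A}}:l_p(\mathcal{A})\to l_q(\mathcal{A}))\asymp(\log n)^{-\alpha_0}\rho(\log n)\,\tau^{-\frac1q+\frac1p}(\log n).$$ (b) Let $p<q$, and let $\alpha_0:=\alpha>0$ if $\kappa_w>\frac\theta q$, $\alpha_0:=\alpha-\frac1q>0$ if $\kappa_w=\frac\theta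 q$. Suppose in addition that $\alpha_0\ne\frac1p-\frac1q$. Then $$e_n(S_{u,w,\mathcal{A}}:l_p(\mathcal{A})\to l_q(\mathcal{A}))\asymp n^{\frac1q-\frac1p}(\log n)^{-\alpha_0-\frac1q+\frac1p}\rho(\log n)\quad\text{if }\alpha_0>\tfrac1p-\tfrac1q,$$ $$e_n(S_{u,w,\mathcal{A}}:l_p(\mathcal{A})\to l_q(\mathcal{A}))\asymp n^{-\alpha_0}\rho(n)\quad\text{if }\alpha_0<\tfrac1p-\tfrac1q.$$
   Context: Notation: $\log=\log_2$; $x_+=\max\{x,0\}$. $f_1\asymp f_2$ with constants depending only on a tuple of parameters means $C^{-1}f_2\le f_1\le Cf_2$ with $C>0$ depending only on these parameters. Entropy numbers: for normed spaces $X,Y$ and a linear continuous $T:X\to Y$, with $B_X,B_Y$ the unit balls, $e_k(T)=\inf\{\varepsilon>0:\exists y_1,\dots,y_{2^{k-1}}\in Y:\ T(B_X)\subset\bigcup_{i=1}^{2^{k-1}}(y_i+\varepsilon B_Y)\}$, $k\in\mathbb{N}$. $\mathcal{A}$ is a rooted tree with (at most countable) vertex set $\mathbf{V}(\mathcal{A})$, partially ordered by: $\xi\le\xi'$ iff $\xi$ lies on the simple path from the root to $\xi'$ (endpoints included). For $l\in\mathbb{Z}_+$, $\mathbf{V}_l^{\mathcal{A}}(\xi)$ is the set of vertices $\xi'\ge\xi$ at graph distance $l$ from $\xi$. For $f:\mathbf{V}(\mathcal{A})\to\mathbb{R}$, $\|f\|_{l_p(\mathcal{A})}=\left(\sum_{\xi\in\mathbf{V}(\mathcal{A})}|f(\xi)|^p\right)^{1/p}$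 for $1\le p<\infty$, $\|f\|_{l_\infty(\mathcal{A})}=\sup_\xi|f(\xi)|$; $l_p(\mathcal{A})$ is the space of functions with finite norm. For weights $u,w:\mathbf{V}(\mathcal{A})\to[0,\infty)$, $$S_{u,w,\mathcal{A}}f(\xi)=w(\xi)\sum_{\xi'\le\xi}u(\xi')f(\xi'),\quad\xi\in\mathbf{V}(\mathcal{A}).$$ Standing assumptions: $\mathbf{V}(\mathcal{A})=\{\eta_{j,i}:j\in\mathbb{Z}_+,\ i\in I_j\}$, where for each $j$ the family $\{\mathbf{V}_1^{\mathcal{A}}(\eta_{j,i})\}_{i\in I_j}$ forms a partition of $\{\eta_{j+1,t}\}_{t\in I_{j+1}}$; for some $c_*\ge1$, $m_*\in\mathbb{N}$, $$c_*^{-1}\frac{h(2^{-m_*j})}{h(2^{-m_*(j+l)})}\le\mathrm{card}\,\mathbf{V}_l^{\mathcal{A}}(\eta_{j,i})\le c_*\frac{h(2^{-m_*j})}{h(2^{-m_*(j+l)})},\quad j,l\in\mathbb{Z}_+,\ i\in I_j.$$ Here $h:(0,1]\to(0,\infty)$ is nondecreasing and in some neighbourhood of zero $h(t)=t^\theta|\log t|^\gamma\tau(|\log t|)$, $\theta\ge0$, $\gamma\in\mathbb{R}$, where $\tau:(0,\infty)\to(0,\infty)$ is absolutely continuous with $t\tau'(t)/\tau(t)\to0$ as $t\to+\infty$. The weights are $u(\eta_{j,i})=u_j$, $w(\eta_{j,i})=w_j$, $$u_j=2^{-\kappa_um_*j}(m_*j+1)^{-\alpha_u}\rho_u(m_*j+1),\qquad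 w_j=2^{-\kappa_wm_*j}(m_*j+1)^{-\alpha_w}\rho_w(m_*j+1),$$ where $\rho_u,\rho_w:(0,\infty)\to(0,\infty)$ are absolutely continuous with $\lim_{y\to\infty}\frac{y\rho_u'(y)}{\rho_u(y)}=\lim_{y\to\infty}\frac{y\rho_w'(y)}{\rho_w(y)}=0$. Moreover, either $\kappa_w>\frac\theta q$, or $\kappa_w=\frac\theta q$ and $\alpha_w>\frac{1-\gamma}{q}$. Put $\kappa=\kappa_u+\kappa_w$, $\alpha=\alpha_u+\alpha_w$, $\rho(y)=\rho_u(y)\rho_w(y)$. *)

(* Defs.v *)
From mathcomp Require Export all_boot all_order all_algebra.
From mathcomp Require Export finmap.
From mathcomp Require Export all_classical all_reals all_analysis.

Set Implicit Arguments.
Unset Strict Implicit.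
Unset Printing Implicit Defensive.

Export Order.TTheory GRing.Theory Num.Theory.
Export numFieldNormedType.Exports.

Local Open Scope classical_set_scope.
Local Open Scope ring_scope.

Definition log2 {R : realType} (x : R) : R := ln x / ln 2.

Section SlowlyVarying.
Context {R : realType}.

Definition abs_continuous_on (f : R -> R) (a b : R) : Prop :=
  forall e : R, 0 < e -> exists2 d : R, 0 < d &
    forall (n : nat) (x y : 'I_n -> R),
      (forall k, a <= x k <= y k /\ y k <= b) ->
      trivIset [set: 'I_n] (fun k => `]x k, y k[%classic) ->
      \sum_(k < n) (y k - x k) < d ->
      \sum_(k < n) `|f (y k) - f (x k)| < e.

(* On the non-compact interval (0,oo), absolute continuity is understood on
   every compact subinterval; the derivative then exists almost everywhere, so
   that the limit of t f'(t) / f(t) at +oo is an essential limit. *)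
Definition slowly_varying (f : R -> R) : Prop :=
  [/\ forall t, 0 < t -> 0 < f t,
      forall a b, 0 < a -> a <= b -> abs_continuous_on f a b
    & forall e : R, 0 < e -> exists M : R,
        {ae (@lebesgue_measure R), forall t, M < t ->
           derivable f t 1 /\ `|t * derive1 f t / f t| < e}].

End SlowlyVarying.

Section Entropy.
Context {R : realType}.

(* A normed space is given by an extended norm N : X -> [0, +oo] on an ambient
   group of functions, the space being {x | N x < +oo}.  The value is +oo when
   no finite covering of T(B_X) exists, e.g. when T does not map the space of
   NX boundedly into the space of NY; inequalities with a finite upper bound
   thus include the boundedness of T.  Only k >= 1 is meaningful. *)
Definition entropy_number (X Y : zmodType) (NX : X -> \bar R) (NY : Y -> \bar R)
    (T : X -> Y) (k : nat) : \bar R :=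
  ereal_inf [set e%:E | e in [set e : R | 0 < e /\
    exists y : 'I_(2 ^ k.-1) -> Y,
      (forall i, (NY (y i) < +oo)%E) /\
      (forall x, (NX x <= 1)%E -> exists i, (NY (T x - y i)%R <= e%:E)%E)]].

(* Used only for 1 <= p <= +oo; the value at -oo is irrelevant. *)
Definition lp_norm (V : choiceType) (p : \bar R) (f : V -> R) : \bar R :=
  match p with
  | r%:E => ((\esum_(x in [set: V]) (`|f x| `^ r)%:E) `^ r^-1)%E
  | +oo%E => ereal_sup [set `|f x|%:E | x in [set: V]]
  | -oo%E => 0%E
  end.

End Entropy.

Section Tree.
Context {V : choiceType} (E : rel V) (root : V).

Definition simple_path (x : V) (s : seq V) (y : V) : bool :=
  [&& path E x s, uniq (x :: s) & last x s == y].

Definition is_tree : Prop :=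
  [/\ symmetric E, irreflexive E
    & forall x y, exists! s, simple_path x s y].

Definition tree_le (x y : V) : Prop :=
  exists2 s, simple_path root s y & x \in root :: s.

Definition graph_dist (x y : V) (l : nat) : Prop :=
  (exists s, [/\ path E x s, last x s = y & size s = l]) /\
  (forall s, path E x s -> last x s = y -> (l <= size s)%N).

Definition descendants (l : nat) (x : V) : set V :=
  [set y | tree_le x y /\ graph_dist x y l].

Definition summation_op {R : realType} (u w : V -> R) (f : V -> R) : V -> R :=
  fun x => w x * \sum_(y \in [set y | tree_le y x]) (u y * f y).

End Tree.

Section RegularTree.
Context {R : realType}.

(* The vertices are listed without repetition as eta j i (j : nat, i : I j).
   That eta 0 _ consists of the root alone is a consequence. *)
Definition regular_tree (h : R -> R) (m : nat) (c : R) (V : choiceType)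
    (E : rel V) (root : V) (I : nat -> Type) (eta : forall j, I j -> V) : Prop :=
  [/\ is_tree E,
      bijective (fun x : {j : nat & I j} => eta (tag x) (tagged x)),
      forall j, partition [set: I j] (fun i => descendants E root 1 (eta j i))
                  (range (eta j.+1))
    & forall j l (i : I j), finite_set (descendants E root l (eta j i)) /\
        let N : R := (#|` fset_set (descendants E root l (eta j i))|)%:R in
        let r := h (2 ^- (m * j)) / h (2 ^- (m * (j + l))) in
        c^-1 * r <= N <= c * r].

(* Two-sided estimate for all large n; the constants C and n0 are chosen
   before the tree, hence do not depend on it. *)
Definition entropy_asymp (p q : \bar R) (h : R -> R) (m : nat) (c : R)
    (u_ w_ : nat -> R) (F : nat -> R) : Prop :=
  exists2 C : R, 0 < C & exists n0 : nat,
    forall (V : countType) (E : rel V) (root : V)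
           (I : nat -> Type) (eta : forall j, I j -> V) (u w : V -> R),
      regular_tree h m c E root eta ->
      (forall j (i : I j), u (eta j i) = u_ j) ->
      (forall j (i : I j), w (eta j i) = w_ j) ->
      forall n, (n0 <= n)%N ->
        ((C^-1 * F n)%:E <=
           entropy_number (lp_norm p) (lp_norm q) (summation_op E root u w) n
         <= (C * F n)%:E)%E.

Definition weight_seq (m : nat) (kappa alpha : R) (rho : R -> R) (j : nat) : R :=
  let y : R := (m * j).+1%:R in
  2 `^ (- (kappa * (m * j)%:R)) * y `^ (- alpha) * rho y.

End RegularTree.

(* Main.v *)
Require Import Defs.
From mathcomp Require Import ring lra zify.

(** Write H_j for the reciprocal of h at 2 ^ - (m j): every vertex of level j has
    about H_l / H_j descendants on level l >= j.  Let W_j be such that the sum of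
    w_l ^ q H_l over l >= j is comparable with W_j ^ q H_j.  When kappa_w > theta / q
    the sum is geometric and W_j = w_j; when kappa_w = theta / q its terms decay
    polynomially and W_j = w_j (m j + 1) ^ (1 / q) ([tail_noncritical],
    [tail_critical]).  A unit value at a vertex of level j is thus mapped to a
    function of l_q norm about u_j W_j, and on the functions living on level j the
    operator acts like u_j W_j times the embedding of l_p into l_q in dimension
    H_j.  The entropy numbers are those of this diagonal model, except that in the
    critical cases the interaction of neighbouring levels matters.

    Upper bounds.  A function f of the unit ball is rounded towards zero, with a
    step depending only on the group of levels to which a vertex belongs
    ([entropy_upper]).  The roundings are integer vectors of bounded l_1 norm, which
    are counted by a generating function ([size_ivectors]), and the error e still
    satisfies |e| <= |f| in addition to being bounded by the steps.  Up to the level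
    J with H_J comparable to n, every level is a group, and the steps,
    compared with H_j ^ (- 1 / p), decrease geometrically away from J, so that the error is dominated by level J and the
    number of bits by H_J ([upper_assembly]).  Above J there is no rounding if
    p >= q: Hoelder's inequality bounds what remains.  If p < q, the step
    s ^ (- 1 / p) leaves at most s nonzero values; the sparsity s decreases
    geometrically in the level when kappa > 0, and from one dyadic block of levels
    to the next when kappa = 0.  The bounds of a whole block
    ([block_lt_noncritical], [block_lt_critical]) do not depend on its length; for
    p >= q they contain the power of the length that enters alpha_0
    ([block_ge_noncritical], [block_ge_critical]).

    Lower bounds.  A code of 2 ^ (k s) words of length s over an alphabet of
    4 ^ (k + 1) letters with relative distance 1 / 2 ([code_exists_pow]) gives as
    many choices of s vertices on level J; each choice carries the function which
    depends only on the level below the chosen vertices and vanishes elsewhere.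
    The images of these functions are separated ([entropy_lower_radial]).  The
    function is concentrated on level J with k = 1 and s = n in general; it is
    spread over the levels J, ..., 2 J + 1 in the critical case with p >= q; for
    p < q and kappa = 0 it is concentrated on one level again, either with k about
    log n, s about n / log n and J about log n, or with s = 1 and k, J about n.
    The comparison of alpha_0 with 1 / p - 1 / q decides which of the last two
    configurations, and which end of the range of dyadic blocks, dominates.

    All sequences are compared through their logarithms: [rate g k X] says that X
    behaves like exp (k g) up to a factor exp (e g + C) for every e > 0, which for
    slowly varying factors is Potter's bound ([slowly_varying_potter]).  Finally J
    is chosen as a function of n, and replacing H_J by n and m J + 1 by log n in
    the bounds changes them by bounded factors only ([profile_near]). *)

Set Implicit Arguments.
Unset Strict Implicit.
Unset Printing Implicit Defensive.

Local Open Scope classical_set_scope.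
Local Open Scope ring_scope.

(** * Slowly varying functions *)

Section Creeping.
Context {R : realType}.
Implicit Types (f g : R -> R) (a b t x y : R).

(** Only points on the two sides of [t] are compared: this is all that the sign of
    the derivative at the single point [t] gives. *)
Definition decreasing_at (g : R -> R) (t : R) : Prop :=
  exists2 r : R, 0 < r & forall x y, t - r < x -> x <= t -> t <= y -> y < t + r ->
    g y <= g x.

Lemma negative_derivative_decreasing g t dg :
  is_derive t 1 g dg -> dg < 0 -> decreasing_at g t.
Proof.
move=> gdg; have := @derive_val _ _ _ _ _ _ _ gdg; rewrite -derive1E => <- g'0.
have {gdg} dg' : derivable g t 1 by exact: ex_derive.
have cv : (fun h : R => h^-1 *: (g (h + t) - g t)) @ 0^' --> derive1 g t.
  rewrite derive1E; have := dg'; rewrite /derivable /derive.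
  rewrite (_ : (fun h : R => h^-1 *: (g (h *: 1 + t) - g t)) =
    (fun h : R => h^-1 *: (g (h + t) - g t))) //.
  by apply/funext => h; rewrite /GRing.scale /= mulr1.
have : \forall h \near 0^', h^-1 *: (g (h + t) - g t) < 0.
  exact: (@cvgr_lt _ _ _ _ _ _ cv).
rewrite near_withinE near_simpl => /nbhs_ballP[r r0 H].
exists r => // x y tx xt ty yt.
have key h : `|h| < r -> h != 0 -> h^-1 * (g (h + t) - g t) < 0.
  by move=> hr h0; apply: H => //; rewrite /ball /= sub0r normrN.
have h1 : g y <= g t.
  have [->//|yt0] := eqVneq y t.
  have yt1 : 0 < y - t by rewrite subr_gt0 lt_neqAle eq_sym yt0.
  have := key (y - t); rewrite gtr0_norm// subr_eq0 => /(_ _ yt0).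
  rewrite ltrBlDl => /(_ yt).
  by rewrite subrK pmulr_rlt0 ?invr_gt0// subr_lt0 => /ltW.
have h2 : g t <= g x.
  have [->//|yt0] := eqVneq x t.
  have yt1 : x - t < 0 by rewrite subr_lt0 lt_neqAle yt0.
  have := key (x - t); rewrite ltr0_norm// subr_eq0 => /(_ _ yt0).
  rewrite opprB ltrBlDr -ltrBlDl => /(_ tx).
  by rewrite subrK nmulr_rlt0 ?invr_lt0// subr_gt0 => /ltW.
exact: le_trans h1 h2.
Qed.

Let mu := @lebesgue_measure R.

(** A creeping argument.  The supremum of the points that can be reached from [a] is
    reached, and one can step beyond it: near a point outside the null set [N] the
    function [g] decreases, and near a point of [N] one stays inside an open set [U]
    of small measure, where the increase of [g] is bounded by the variation of [f].  The crossed parts of [U] are recorded in a list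
    of disjoint intervals of total length less than the measure of [U], so absolute
    continuity makes the accumulated increase arbitrarily small. *)
Lemma ae_decreasing_nonincreasing (f g : R -> R) (K a b : R) (N : set R) :
  a <= b -> 0 <= K -> abs_continuous_on f a b ->
  measurable N -> mu N = 0%E ->
  (forall t, a <= t -> t <= b -> ~ N t -> decreasing_at g t) ->
  (forall x y, a <= x -> x <= y -> y <= b -> g y <= g x + K * `|f y - f x|) ->
  g b <= g a.
Proof.
move=> ab K0 acf mN N0 gN gf.
apply/ler_addgt0Pr => eta eta0.
have K1 : 0 < K + 1 by lra.
have [d d0 dP] := acf _ (divr_gt0 eta0 K1).
have [U [oU NU muU]] : exists U : set R, [/\ open U, N `<=` U & (mu U < d%:E)%E].
  have [|U [oU NU muU]] := @lebesgue_regularity_outer R N d mN _ d0.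
    by rewrite [X in (X < _)%E]N0 ltry.
  exists U; split => //.
  have mU : measurable U by exact: measurable_realfun.open_measurable.
  rewrite (_ : U = (U `\` N) `|` N); last first.
    rewrite eqEsubset; split => x; first by move=> Ux; have [|] := pselect (N x); [right|left].
    by case=> [[]|/NU].
  apply: le_lt_trans (measureU2 _ _ _) _ => //; first exact: measurableD.
  by rewrite [X in (_ + X)%E]N0 adde0.
have mU : measurable U by exact: measurable_realfun.open_measurable.
(* the list of the parts of U crossed so far, the latest one first *)
pose chain t (s : seq (R * R)) :=
  [/\ all (fun p : R * R => (a <= p.1) && (p.1 <= p.2) && (p.2 <= t)) s,
      pairwise (fun p q : R * R => q.2 <= p.1) s,
      ((\sum_(p <- s) (p.2 - p.1))%:E <= mu (U `&` `[a, t[))%E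
    & g t <= g a + K * \sum_(p <- s) `|f p.2 - f p.1|].
pose S := [set t | a <= t <= b /\ exists s, chain t s].
have Sa : S a.
  split; first by rewrite lexx ab.
  by exists [::]; split => //; rewrite big_nil ?mulr0 ?addr0.
have mono x y : x <= y -> (mu (U `&` `[a, x[) <= mu (U `&` `[a, y[))%E.
  move=> xy; apply: le_measure; rewrite ?inE; try by apply: measurableI.
  apply: setIS; apply: subset_itvl; by rewrite bnd_simp.
have Sext x y : S x -> x <= y -> y <= b ->
    g y <= g x \/ `[x, y] `<=` U -> S y.
  move=> [/andP[ax xb] [s [s1 s2 s3 s4]]] xy yb H; split.
    by rewrite (le_trans ax xy).
  have s1' : all (fun p : R * R => (a <= p.1) && (p.1 <= p.2) && (p.2 <= y)) s.
    apply: sub_all s1 => p /andP[-> /le_trans]; exact.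
  case: H => [gyx|xyU].
    exists s; split => //; first exact: le_trans s3 (mono _ _ xy).
    exact: le_trans gyx s4.
  exists ((x, y) :: s); split => /=.
  - by rewrite ax xy lexx s1'.
  - rewrite s2 andbT; apply: sub_all s1 => p /andP[_ ->] //.
  - rewrite big_cons /= addrC EFinD.
    apply: (@le_trans _ _ (mu (U `&` `[a, x[) + mu `[x, y[)%E).
      apply: leeD => //; rewrite /mu lebesgue_measure_itv/= lte_fin.
      have [xy'|] := ltP x y; first by rewrite EFinB.
      by move=> yx; rewrite lee_fin subr_le0.
    rewrite -measureU //; first last.
    - rewrite -subset0 => z /= [[_]]; rewrite /= !in_itv/= => /andP[_ zx] /andP[xz _].
      by have := lt_le_trans zx xz; rewrite ltxx.
    - by apply: measurableI.
    apply: le_measure; rewrite ?inE.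
    - by apply: measurableU => //; apply: measurableI.
    - by apply: measurableI.
    move=> z /= [[Uz]|]; rewrite /= !in_itv/= => /andP[z1 z2].
      by split => //; rewrite z1 (lt_le_trans z2 xy).
    split; last by rewrite (le_trans ax z1) z2.
    by apply: xyU; rewrite /= in_itv/= z1 ltW.
  - rewrite big_cons /= mulrDr addrCA.
    have := gf _ _ ax xy yb; move: s4; lra.
have hS : has_sup S by split; [exists a | exists b => t [/andP[]]].
set t := sup S.
have at_ : a <= t by apply: sup_upper_bound.
have tb : t <= b by apply: sup_le_ub; [exists a|move=> z [/andP[]]].
have [r r0 rP] : exists2 r : R, 0 < r & forall x y, t - r < x -> x <= t ->
    t <= y -> y < t + r -> g y <= g x \/ `[x, y] `<=` U.
  have [Nt|/(gN _ at_ tb)[r r0 rP]] := pselect (N t).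
    have := oU; rewrite openE => /(_ _ (NU _ Nt)) /nbhs_ballP[r r0 rP].
    exists r => // x y h1 h2 h3 h4; right => z /=; rewrite in_itv/= => /andP[xz zy].
    apply: rP; rewrite /ball /= ltr_norml; apply/andP; split; lra.
  by exists r => // x y h1 h2 h3 h4; left; exact: rP.
have [x Sx xt] := sup_adherent r0 hS.
have xt' : x <= t by exact: sup_upper_bound.
set y := Num.min b (t + r / 2).
have ty : t <= y by rewrite le_min tb; lra.
have Sy : S y.
  apply: (Sext x) => //; first exact: le_trans xt' ty.
    by rewrite ge_min lexx.
  apply: rP => //; rewrite gt_min; apply/orP; right; lra.
have yt : y <= t by exact: sup_upper_bound.
have Sb : S b.
  suff <- : y = b by [].
  have bt : b <= t.
    rewrite leNgt; apply/negP => tb'.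
    have : t < y by rewrite lt_min tb' /=; lra.
    by rewrite ltNge yt.
  by apply/le_anti/andP; split; [rewrite ge_min lexx|exact: le_trans ty].
case: Sb => _ [s [s1 s2 s3 s4]].
have sd : \sum_(p <- s) (p.2 - p.1) < d.
  rewrite -lte_fin; apply: le_lt_trans s3 _; apply: le_lt_trans muU.
  by apply: le_measure; rewrite ?inE //; apply: measurableI.
pose z0 : R * R := (0, 0).
have sn (F : R * R -> R) : \sum_(p <- s) F p = \sum_(k < size s) F (nth z0 s k).
  by rewrite (big_nth z0) big_mkord.
have h1 : \sum_(p <- s) `|f p.2 - f p.1| < eta / (K + 1).
  rewrite (sn (fun p => `|f p.2 - f p.1|)).
  apply: (dP (size s) (fun k => (nth z0 s k).1) (fun k => (nth z0 s k).2)).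
  - move=> k; have /allP/(_ (nth z0 s k) (mem_nth _ (ltn_ord k))) := s1.
    by move=> /andP[/andP[-> ->] ->].
  - have disj (i j : 'I_(size s)) z : (i < j)%N ->
      `](nth z0 s i).1, (nth z0 s i).2[%classic z ->
      `](nth z0 s j).1, (nth z0 s j).2[%classic z -> False.
      move=> ij; rewrite /= !in_itv/= => /andP[z1 _] /andP[_ z2].
      have /(pairwiseP z0)/(_ i j (ltn_ord i) (ltn_ord j) ij) /= h' := s2.
      by have := lt_trans z1 (lt_le_trans z2 h'); rewrite ltxx.
    move=> i j _ _ [z [zi zj]]; apply/val_inj => /=.
    by case: (ltngtP i j) => // ij; exfalso; [apply: (disj i j z)|apply: (disj j i z)].
  - by rewrite -(sn (fun p => p.2 - p.1)).
apply: le_trans s4 _; rewrite lerD2l.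
have : K * \sum_(p <- s) `|f p.2 - f p.1| <= K * (eta / (K + 1)).
  by apply: ler_wpM2l => //; exact: ltW.
move=> /le_trans; apply.
by rewrite mulrA ler_pdivrMr// mulrC ler_pM2l//; lra.
Qed.

End Creeping.

Section Potter.
Context {R : realType}.
Implicit Types (f s : R -> R).

(** Far away, the logarithmic derivative of [s] is smaller than e / t, so that the
    product of [s] with the power - e decreases and the product with the power e
    increases. *)
Lemma slowly_varying_powR_above s e : slowly_varying s -> 0 < e ->
  exists2 M : R, 1 <= M & forall x y, M < x -> x <= y ->
    s y * y `^ (- e) <= s x * x `^ (- e) /\ s x * x `^ e <= s y * y `^ e.
Proof.
move=> [s0 acs sd] e0; have [M0 [N [mN N0 NM]]] := sd _ e0.
exists (Num.max M0 1) => [|x y Mx xy]; first by rewrite le_max lexx orbT.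
have [M0x x1] : M0 < x /\ 1 < x by move: Mx; rewrite gt_max => /andP[].
have x0 : 0 < x by lra.
have D t k : x <= t -> ~ N t ->
    is_derive t 1 (fun t => s t * t `^ k) (t `^ (k - 1) * (t * derive1 s t + k * s t))
    /\ `|t * derive1 s t| < e * s t.
  move=> xt Nt; have t0 : 0 < t by lra.
  have [ds h] : derivable s t 1 /\ `|t * derive1 s t / s t| < e.
    apply: contrapT => h; apply: Nt; apply: NM => /= H; apply: h; apply: H; lra.
  split; last first.
    by move: h; rewrite normrM normfV (gtr0_norm (s0 _ t0)) ltr_pdivrMr ?s0.
  have /derivableP d1 := ds; have d2 := is_derive1_powR k t0.
  have d3 : is_derive t 1 (fun t => s t * t `^ k) _ := is_deriveM d1 d2.
  apply: (is_derive_eq d3).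
  rewrite derive1E /GRing.scale /=.
  have -> : t `^ k = t * t `^ (k - 1).
    rewrite -{2}(powRr1 (ltW t0)) -powRD; first by congr (_ `^ _); lra.
    by rewrite (gt_eqF t0) implybT.
  ring.
have acs' : abs_continuous_on s x y by exact: acs.
split.
  apply: (@ae_decreasing_nonincreasing _ s (fun t => s t * t `^ (- e)) 1 x y N) => //.
  - move=> t xt ty Nt; have [d h] := D _ (- e) xt Nt.
    apply: negative_derivative_decreasing d _; rewrite pmulr_rlt0; last by apply: powR_gt0; lra.
    by move: h; rewrite ltr_norml => /andP[h1 h2]; lra.
  - move=> a b xa ab by_; have a0 : 0 < a by lra.
    have ba : b `^ (- e) <= a `^ (- e).
      have b0 : 0 < b by lra.
      rewrite !powRN lef_pV2 ?posrE ?powR_gt0 //.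
      by apply: ge0_ler_powR; rewrite ?nnegrE; lra.
    have b1 : b `^ (- e) <= 1.
      have b0 : 0 < b by lra.
      have p1 : 1 `^ e = 1 :> R by rewrite powR1.
      rewrite powRN invf_le1 ?powR_gt0 // -p1.
      by apply: ge0_ler_powR; rewrite ?nnegrE; lra.
    have b00 := powR_ge0 b (- e).
    have := ler_wpM2l (ltW (s0 _ a0)) ba.
    have := ler_wpM2r b00 (ler_norm (s b - s a)).
    have := ler_wpM2l (normr_ge0 (s b - s a)) b1.
    lra.
(* the second inequality is the first argument applied to the negative of the
   function; the constant y ^ e bounds the powers between x and y *)
rewrite -lerN2.
apply: (@ae_decreasing_nonincreasing _ s (fun t => - (s t * t `^ e)) (y `^ e) x y N) => //.
- exact: powR_ge0.
- move=> t xt ty Nt; have [d h] := D _ e xt Nt.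
  have := is_deriveN d => {}d.
  apply: negative_derivative_decreasing d _; rewrite oppr_lt0 mulr_gt0 //; first by apply: powR_gt0; lra.
  by move: h; rewrite ltr_norml => /andP[h1 h2]; lra.
- move=> a b xa ab by_; have a0 : 0 < a by lra.
  have ba : a `^ e <= b `^ e by apply: ge0_ler_powR; rewrite ?nnegrE; lra.
  have b1 : b `^ e <= y `^ e by apply: ge0_ler_powR; rewrite ?nnegrE; lra.
  have := ler_wpM2l (ltW (s0 _ a0)) ba.
  have := ler_wpM2r (powR_ge0 b e) (ler_norm (s a - s b)).
  have := ler_wpM2l (normr_ge0 (s b - s a)) b1.
  rewrite (distrC (s a)); lra.
Qed.

Lemma slowly_varying_continuous s : slowly_varying s ->
  forall t, 0 < t -> {for t, continuous s}.
Proof.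
move=> [_ acs _] t t0; apply/cvgrPdist_lt => e e0.
have t1 : 0 < t / 2 by lra.
have t2 : t / 2 <= 2 * t by lra.
have [d d0 dP] := acs _ _ t1 t2 e e0.
have n1 : \forall x \near t, `|t - x| < d by exact: (@nbhsx_ballx _ R^o).
have n2 : \forall x \near t, `|t - x| < t / 2 by exact: (@nbhsx_ballx _ R^o).
near=> x.
have xt : `|t - x| < d by near: x.
have xt2 : `|t - x| < t / 2.
  by near: x.
have := dP 1%N (fun=> Num.min x t) (fun=> Num.max x t).
rewrite !big_ord1.
have -> : `|s (Num.max x t) - s (Num.min x t)| = `|s t - s x|.
  by case: (ltP x t) => // _; rewrite distrC.
have -> : Num.max x t - Num.min x t = `|t - x|.
  by case: (leP x t) => h; [rewrite ger0_norm|rewrite ltr0_norm]; lra.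
apply => //.
- move=> _; move: xt2; rewrite ltr_norml => /andP[h1 h2].
  by case: (leP x t) => h; (split; [apply/andP; split|]); lra.
- by move=> i j _ _ _; rewrite (ord1 i) (ord1 j).
Unshelve. all: by end_near.
Qed.

(** Potter's bound.  It holds without constant far away; on the remaining compact
    interval [ln s] is bounded by continuity. *)
Lemma slowly_varying_potter s e : slowly_varying s -> 0 < e ->
  exists C : R, forall x y, 1 <= x -> x <= y ->
    `|ln (s y) - ln (s x)| <= C + e * (ln y - ln x).
Proof.
move=> sv e0; have [s0 _ _] := sv; have [M M1 HM] := slowly_varying_powR_above sv e0.
have far x y : M < x -> x <= y -> `|ln (s y) - ln (s x)| <= e * (ln y - ln x).
  move=> Mx xy; have x0 : 0 < x by lra.
  have y0 : 0 < y by lra.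
  have [h1 h2] := HM _ _ Mx xy; rewrite ler_norml; apply/andP; split.
    move: h2; rewrite -ler_ln ?posrE ?mulr_gt0 ?s0 ?powR_gt0// !lnM ?posrE ?s0 ?powR_gt0//.
    by rewrite !ln_powR; lra.
  move: h1; rewrite -ler_ln ?posrE ?mulr_gt0 ?s0 ?powR_gt0// !lnM ?posrE ?s0 ?powR_gt0//.
  by rewrite !ln_powR; lra.
have cts : {within `[1, M + 1], continuous (fun t => ln (s t))}.
  apply: continuous_in_subspaceT => t; rewrite inE /= in_itv/= => /andP[t1 _].
  apply: continuous_comp; first by apply: slowly_varying_continuous => //; lra.
  by apply: continuous_ln; apply: s0; lra.
have le1M : 1 <= M + 1 by lra.
have [c1 _ hc1] := EVT_max le1M cts; have [c2 _ hc2] := EVT_min le1M cts.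
pose B := ln (s c1) - ln (s c2).
have near_ x y : 1 <= x -> x <= M + 1 -> 1 <= y -> y <= M + 1 ->
    `|ln (s y) - ln (s x)| <= B.
  move=> x1 x2 y1 y2; have xI : x \in `[1, M + 1] by rewrite in_itv/= x1.
  have yI : y \in `[1, M + 1] by rewrite in_itv/= y1.
  have := (hc1 _ xI, hc1 _ yI, hc2 _ xI, hc2 _ yI) => -[[[]]].
  by rewrite ler_norml /B => h1 h2 h3 h4; apply/andP; split; lra.
have B0 : 0 <= B by have := near_ 1 1 (lexx _) le1M (lexx _) le1M; rewrite subrr normr0.
have lnle x y : 1 <= x -> x <= y -> 0 <= e * (ln y - ln x).
  move=> x1 xy; apply: mulr_ge0; first exact: ltW.
  by rewrite subr_ge0 ler_ln ?posrE//; lra.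
exists B => x y x1 xy; have := lnle _ _ x1 xy.
have [yM|My] := leP y (M + 1).
  by have := near_ x y x1 (le_trans xy yM) (le_trans x1 xy) yM; lra.
have [xM|Mx] := leP x (M + 1); last first.
  have MX : M < x by lra.
  by have := far x y MX xy; lra.
have h1 := near_ x (M + 1) x1 xM le1M (lexx _).
have MM : M < M + 1 by lra.
have h2 := far (M + 1) y MM (ltW My).
have h3 := lnle x (M + 1) x1 xM.
have := ler_normD (ln (s y) - ln (s (M + 1))) (ln (s (M + 1)) - ln (s x)).
rewrite addrA subrK; lra.
Qed.

End Potter.

(** * Sequences of exponential or polynomial growth *)

Lemma eqW (R : numDomainType) (x y : R) : x = y -> x <= y.
Proof. by move=> ->. Qed.

Section Rate.
Context {R : realType}.
Implicit Types (g X Y : nat -> R) (a e k l r : R).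

(** [X] is exp (k g) up to factors that are subexponential in [g], uniformly between
    any two indices.  Two gauges occur: [lin] for exponential growth, and [lg] for
    regular variation of order [k]. *)
Definition rate g k X : Prop :=
  (forall j, 0 < X j) /\
  forall e, 0 < e -> exists C, forall i j, (i <= j)%N ->
    `|ln (X j) - ln (X i) - k * (g j - g i)| <= C + e * (g j - g i).

Lemma rateM g k l X Y :
  rate g k X -> rate g l Y -> rate g (k + l) (fun j => X j * Y j).
Proof.
move=> [X0 HX] [Y0 HY]; split=> [j|e e0]; first exact: mulr_gt0.
have e2 : 0 < e / 2 by lra.
have [C HC] := HX _ e2; have [D HD] := HY _ e2; exists (C + D) => i j ij.
rewrite !lnM ?posrE ?X0 ?Y0//.
move: (HC _ _ ij) (HD _ _ ij); rewrite !ler_norml => /andP[? ?] /andP[? ?].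
by apply/andP; split; lra.
Qed.

Lemma rate_powR g k X r : rate g k X -> rate g (r * k) (fun j => X j `^ r).
Proof.
move=> [X0 HX]; split=> [j|e e0]; first exact: powR_gt0.
have r1 : 0 < `|r| + 1 by have := normr_ge0 r; lra.
have e2 : 0 < e / (`|r| + 1) by apply: divr_gt0.
have [C HC] := HX _ e2; exists (`|r| * C + `|C|) => i j ij.
rewrite !ln_powR -mulrA -!mulrBr normrM.
have h := HC _ _ ij.
have h1 := ler_wpM2l (normr_ge0 r) h.
have gg : 0 <= C + e / (`|r| + 1) * (g j - g i) by exact: le_trans (normr_ge0 _) h.
have := ler_norm C => hC.
have -> : e * (g j - g i) = (`|r| + 1) * (e / (`|r| + 1) * (g j - g i)).
  by field; lra.
lra.
Qed.

Lemma rateV g k X : rate g k X -> rate g (- k) (fun j => (X j)^-1).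
Proof.
move=> XR; have := rate_powR (-1) XR; rewrite mulN1r.
by congr rate; apply/funext => j; rewrite powR_inv1 // ltW //; case: XR.
Qed.

Lemma rate_equiv g k X Y B : rate g k X -> (forall j, 0 < Y j) ->
  (forall j, `|ln (Y j) - ln (X j)| <= B) -> rate g k Y.
Proof.
move=> [X0 HX] Y0 XY; split=> // e /HX[C HC]; exists (C + 2 * B) => i j ij.
move: (HC _ _ ij) (XY i) (XY j); rewrite !ler_norml => /andP[? ?] /andP[? ?] /andP[? ?].
by apply/andP; split; lra.
Qed.

Lemma rate_gauge g k : {homo g : i j / (i <= j)%N >-> i <= j} ->
  rate g k (fun j => expR (k * g j)).
Proof.
move=> gh; split=> [j|e e0]; first exact: expR_gt0.
exists 0 => i j ij; rewrite !expRK -mulrBr subrr normr0 add0r mulr_ge0 //; first exact: ltW.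
by rewrite subr_ge0 gh.
Qed.

Lemma rate_le g k X : rate g k X -> forall e, 0 < e -> exists2 C, 0 < C &
  forall i j, (i <= j)%N -> X j <= C * expR ((k + e) * (g j - g i)) * X i /\
   X i <= C * expR ((- k + e) * (g j - g i)) * X j.
Proof.
move=> [X0 HX] e /HX[C HC]; exists (expR C); first exact: expR_gt0.
move=> i j ij; move: (HC _ _ ij); rewrite ler_norml => /andP[h1 h2].
rewrite -!expRD -[X in _ <= _ * X](lnK (X0 _)) -[X in X <= _](lnK (X0 _)).
rewrite -[X in _ /\ X <= _](lnK (X0 _)) -[X in _ /\ _ <= _ * X](lnK (X0 _)).
by rewrite -!expRD !ler_expR; split; lra.
Qed.

Definition lin (j : nat) : R := j%:R.
Definition lg (j : nat) : R := ln j.+1%:R.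

Lemma lin_homo : {homo lin : i j / (i <= j)%N >-> i <= j}.
Proof. by move=> i j; rewrite /lin ler_nat. Qed.

Lemma lg_homo : {homo lg : i j / (i <= j)%N >-> i <= j}.
Proof. by move=> i j ij; rewrite /lg ler_ln ?posrE// ler_nat ltnS. Qed.

(** This makes every regularly varying sequence of exponential order 0. *)
Lemma lg_sublinear e : 0 < e -> exists C, forall i j, (i <= j)%N ->
  lg j - lg i <= C + e * (lin j - lin i).
Proof.
move=> e0; exists (- ln e + `|e|) => i j ij.
rewrite /lg /lin -ln_div ?posrE//.
have h : j.+1%:R / i.+1%:R <= 1 + (j%:R - i%:R) :> R.
  rewrite ler_pdivrMr // -!natr1.
  have : 0 <= (j%:R - i%:R) * i%:R :> R by rewrite mulr_ge0 // subr_ge0 ler_nat.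
  lra.
have ji : 0 <= j%:R - i%:R :> R by rewrite subr_ge0 ler_nat.
have p : 0 < 1 + (j%:R - i%:R) :> R by lra.
apply: (@le_trans _ _ (ln (1 + (j%:R - i%:R)))).
  by rewrite ler_ln ?posrE ?divr_gt0.
have := @ln_sublinear R (e * (1 + (j%:R - i%:R))); rewrite mulr_gt0// => /(_ isT).
by rewrite lnM ?posrE// gtr0_norm//; lra.
Qed.

Lemma rate_lg_lin k X : rate lg k X -> rate lin 0 X.
Proof.
move=> [X0 HX]; split=> // e e0.
have [C HC] := HX 1 ltr01.
have k1 : 0 < `|k| + 1 by have := normr_ge0 k; lra.
have e2 : 0 < e / (`|k| + 1) by apply: divr_gt0.
have [D HD] := lg_sublinear e2; exists (C + (`|k| + 1) * D) => i j ij.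
have h1 := HC _ _ ij; have h2 := HD _ _ ij.
rewrite mul0r subr0.
have h3 := ler_wpM2l (ltW k1) h2.
have e3 : (`|k| + 1) * (e / (`|k| + 1) * (lin j - lin i)) = e * (lin j - lin i).
  by field; lra.
have l0 : 0 <= lg j - lg i by rewrite subr_ge0 lg_homo.
have := ler_normD (ln (X j) - ln (X i) - k * (lg j - lg i)) (k * (lg j - lg i)).
rewrite subrK normrM (ger0_norm l0); lra.
Qed.

Lemma geometric_le (q : R) n : 0 <= q -> q < 1 -> \sum_(i < n) q ^+ i <= (1 - q)^-1.
Proof.
move=> q0 q1; have q1' : 0 < 1 - q by lra.
rewrite -[leRHS]mul1r ler_pdivlMr // mulrC -opprB mulNr -subrX1 opprB.
by rewrite lerBlDr lerDl exprn_ge0.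
Qed.

Lemma expR_sum_le a n : 0 < a -> \sum_(i < n) expR (- a * i%:R) <= (1 - expR (- a))^-1.
Proof.
move=> a0; under eq_bigr do rewrite expRM_natr.
by apply: geometric_le; [exact: expR_ge0|rewrite expR_lt1; lra].
Qed.

Lemma rate_sum_head k X : 0 < k -> rate lin k X -> exists2 C, 0 < C &
  forall J, \sum_(j < J.+1) X j <= C * X J.
Proof.
move=> k0 XR; have k2 : 0 < k / 2 by lra.
have [C C0 HC] := rate_le XR k2; have X0 := XR.1.
have q0 : 0 < (1 - expR (- (k / 2)))^-1 by rewrite invr_gt0 subr_gt0 expR_lt1; lra.
exists (C * (1 - expR (- (k / 2)))^-1); first exact: mulr_gt0.
move=> J; rewrite (reindex_inj rev_ord_inj) /=.
apply: (@le_trans _ _ (\sum_(j < J.+1) C * X J * expR (- (k / 2) * j%:R))).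
  apply: ler_sum => j _; rewrite subSS.
  have [_ h] := HC (J - j)%N J (leq_subr _ _).
  apply: le_trans h _; rewrite mulrAC; apply: ler_wpM2l.
    by rewrite mulr_ge0 // ltW.
  have jJ : (j <= J)%N by rewrite -ltnS.
  by rewrite ler_expR /lin natrB //; apply: eqW; field.
rewrite -mulr_sumr [leRHS]mulrAC; apply: ler_wpM2l; first by rewrite mulr_ge0 // ltW.
exact: expR_sum_le.
Qed.

Lemma rate_sum_tail k X : k < 0 -> rate lin k X -> exists2 C, 0 < C &
  forall J M, \sum_(J <= j < M) X j <= C * X J.
Proof.
move=> k0 XR; have k2 : 0 < - k / 2 by lra.
have [C C0 HC] := rate_le XR k2; have X0 := XR.1.
have q0 : 0 < (1 - expR (- (- k / 2)))^-1 by rewrite invr_gt0 subr_gt0 expR_lt1; lra.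
exists (C * (1 - expR (- (- k / 2)))^-1); first exact: mulr_gt0.
move=> J M; rewrite -{1}[J]add0n big_addn big_mkord.
apply: (@le_trans _ _ (\sum_(j < M - J) C * X J * expR (- (- k / 2) * j%:R))).
  apply: ler_sum => j _.
  have [h _] := HC J (j + J)%N (leq_addl _ _).
  apply: le_trans h _; rewrite mulrAC; apply: ler_wpM2l.
    by rewrite mulr_ge0 // ltW.
  by rewrite ler_expR /lin natrD; apply: eqW; field.
rewrite -mulr_sumr [leRHS]mulrAC; apply: ler_wpM2l; first by rewrite mulr_ge0 // ltW.
exact: expR_sum_le.
Qed.

(** The terms are dominated by the increments of the primitive of the power
    - 1 - e, which telescope. *)
Lemma lg_tail_sum e J M : 0 < e ->
  \sum_(J <= j < M) expR (- (1 + e) * lg j) <= (1 + e^-1) * expR (- e * lg J).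
Proof.
move=> e0.
have step j : e * expR (- (1 + e) * lg j.+1) <= expR (- e * lg j) - expR (- e * lg j.+1).
  have x0 : 0 < j.+1%:R :> R by [].
  have lgS : ln j.+2%:R - ln j.+1%:R >= (j.+2%:R)^-1 :> R.
    have := @expR_ge1Dx R (ln (j.+1%:R / j.+2%:R)).
    rewrite lnK ?posrE ?divr_gt0// ln_div ?posrE// => h.
    have -> : (j.+2%:R)^-1 = 1 - j.+1%:R / j.+2%:R :> R.
      by rewrite -[j.+2%:R]natr1; set y := j.+1%:R; have y0 : 0 < y by []; field; lra.
    by move: h; move: (_ / _) (ln _) (ln _) => r x z h; lra.
  have -> : - (1 + e) * lg j.+1 = - e * lg j.+1 - lg j.+1 by ring.
  rewrite expRD expRN /lg lnK ?posrE//.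
  set a := ln j.+2%:R in lgS *; set b := ln j.+1%:R in lgS *.
  have -> : - e * b = - e * a + e * (a - b) by ring.
  rewrite expRD mulrCA -[X in _ <= _ - X]mulr1 -mulrBr; apply: ler_wpM2l; first exact: expR_ge0.
  have := expR_ge1Dx (e * (a - b)); have := ler_wpM2l (ltW e0) lgS; move: (expR _) (j.+2%:R^-1) => y z; lra.
have [JM|MJ] := leqP M J.
  by rewrite big_geq // mulr_ge0 ?expR_ge0// addr_ge0 // invr_ge0 ltW.
rewrite big_ltn // mulrDl mul1r lerD //.
  rewrite ler_expR /lg; have : 0 <= ln J.+1%:R :> R by rewrite ln_ge0 // ler1n.
  nra.
rewrite mulrC ler_pdivlMr // mulrC mulr_sumr.
have : (J <= M.-1)%N by rewrite -ltnS prednK // (leq_ltn_trans _ MJ).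
move: MJ; case: M => // M _ /= JM.
rewrite big_add1 /=.
apply: (@le_trans _ _ (\sum_(J <= j < M) - (expR (- e * lg j.+1) - expR (- e * lg j)))).
  by apply: ler_sum => j _; rewrite opprB.
rewrite sumrN telescope_sumr // opprB lerBlDr lerDl; exact: expR_ge0.
Qed.

Lemma lgK j : expR (lg j) = j.+1%:R.
Proof. by rewrite /lg lnK ?posrE. Qed.

Lemma rate_poly_tail k X : k < -1 -> rate lg k X -> exists2 C, 0 < C &
  forall J M, \sum_(J <= j < M) X j <= C * J.+1%:R * X J.
Proof.
move=> k0 XR; pose e := (- 1 - k) / 2; have e0 : 0 < e by rewrite /e; lra.
have [C C0 HC] := rate_le XR e0; have X0 := XR.1.
have D0 : 0 < 1 + e^-1 by have : 0 < e^-1 by [rewrite invr_gt0]; lra.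
exists (C * (1 + e^-1)) => [|J M]; first exact: mulr_gt0.
apply: (@le_trans _ _ (\sum_(J <= j < M) C * X J * expR ((1 + e) * lg J) *
   expR (- (1 + e) * lg j))).
  apply: ler_sum_nat => j /andP[Jj _]; have [h _] := HC _ _ Jj.
  apply: le_trans h _; rewrite mulrAC -!mulrA -expRD; apply: ler_wpM2l; first exact: ltW.
  apply: ler_wpM2l; first exact: ltW.
  by rewrite ler_expR /e; apply: eqW; field.
rewrite -mulr_sumr; apply: le_trans (ler_wpM2l _ (lg_tail_sum J M e0)) _.
  by rewrite !mulr_ge0 ?expR_ge0 // ltW.
apply: eqW; rewrite -lgK (_ : (1 + e) * lg J = lg J + e * lg J); last by ring.
have := expRxMexpNx_1 (e * lg J); rewrite expRD mulNr => h.
transitivity (C * (1 + e^-1) * expR (lg J) * X J * (expR (e * lg J) * expR (- (e * lg J)))).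
  by ring.
by rewrite h mulr1.
Qed.

(** Doubling the index changes a regularly varying sequence by a bounded factor.  This
    is why all levels of a dyadic block can be treated alike. *)
Lemma rate_block k X (B : nat) : rate lg k X -> exists2 C, 0 < C &
  forall i j, (i <= j)%N -> (j.+1 <= B * i.+1)%N -> X j <= C * X i /\ X i <= C * X j.
Proof.
move=> XR; have X0 := XR.1; have [C C0 HC] := rate_le XR ltr01.
pose b : R := ln B.+1%:R.
have b0 : 0 <= b by rewrite ln_ge0 // ler1n.
exists (C * expR ((`|k| + 1) * b)) => [|i j ij jB]; first by rewrite mulr_gt0 // expR_gt0.
have h1 : 0 <= lg j - lg i by rewrite subr_ge0 lg_homo.
have h2 : lg j - lg i <= b.
  rewrite lerBlDr /lg /b -lnM ?posrE // ler_ln ?posrE ?mulr_gt0 // -natrM ler_nat.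
  by apply: leq_trans jB _; rewrite leq_mul2r leqnSn orbT.
have nk := ler_norm k; have nk' := ler_norm (- k); rewrite normrN in nk'.
have k1 : 0 <= `|k| + 1 by have := normr_ge0 k; lra.
have hb := ler_wpM2l k1 h2.
have h3 : (k + 1) * (lg j - lg i) <= (`|k| + 1) * b.
  by apply: le_trans _ hb; apply: ler_wpM2r; lra.
have h4 : (- k + 1) * (lg j - lg i) <= (`|k| + 1) * b.
  by apply: le_trans _ hb; apply: ler_wpM2r; lra.
have [hj hi] := HC _ _ ij; split; [apply: le_trans hj _|apply: le_trans hi _].
  by apply: ler_wpM2r; [exact: ltW|rewrite ler_wpM2l ?ler_expR // ltW].
by apply: ler_wpM2r; [exact: ltW|rewrite ler_wpM2l ?ler_expR // ltW].
Qed.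

Lemma rate_arith m : (0 < m)%N -> rate lg 1 (fun j => (m * j).+1%:R).
Proof.
move=> m0; apply: (@rate_equiv _ _ _ _ (ln m%:R) (rate_gauge 1 lg_homo)) => // j.
rewrite expRK mul1r /lg ger0_norm.
  rewrite lerBlDr -lnM ?posrE ?ltr0n // ler_ln ?posrE ?mulr_gt0 ?ltr0n// -natrM ler_nat.
  by rewrite mulnS; lia.
by rewrite subr_ge0 ler_ln ?posrE// ler_nat ltnS; nia.
Qed.

Lemma rate_slowly_varying m s : (0 < m)%N -> slowly_varying s ->
  rate lg 0 (fun j => s (m * j).+1%:R).
Proof.
move=> m0 sv; have [s0 _ _] := sv; split=> [j|e e0]; first exact: s0.
have [_ /(_ 1 ltr01)[D HD]] := rate_arith m0.
have e1 : 0 < e / 2 by lra.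
have [C HC] := slowly_varying_potter sv e1.
exists (C + e / 2 * D) => i j ij.
have i1 : 1 <= (m * i).+1%:R :> R by rewrite ler1n.
have i2 : (m * i).+1%:R <= (m * j).+1%:R :> R by rewrite ler_nat ltnS leq_mul2l ij orbT.
have := HC _ _ i1 i2.
move: (HD _ _ ij); rewrite ler_norml => /andP[_ h].
have e2 := ltW e1.
have := ler_wpM2l e2 h.
rewrite mul0r subr0; lra.
Qed.

Lemma slowly_varying_near (s : R -> R) (B : R) : slowly_varying s -> exists2 C, 0 <= C & forall x y,
  1 <= x -> 1 <= y -> `|ln x - ln y| <= B -> `|ln (s x) - ln (s y)| <= C.
Proof.
move=> sv; have [C HC] := slowly_varying_potter sv ltr01.
exists (`|C + B|) => // x y x1 y1; rewrite ler_norml => /andP[h1 h2].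
have := ler_norm (C + B).
have [xy|yx] := leP x y; first by have := HC _ _ x1 xy; rewrite distrC; lra.
by have := HC _ _ y1 (ltW yx); lra.
Qed.

End Rate.

(** * Codes and integer vectors *)

Section Code.
Local Close Scope classical_set_scope.
Local Open Scope nat_scope.
Context (s M : nat).
Notation word := {ffun 'I_s -> 'I_M}.

Definition hamming (a b : word) : nat := #|[set i | a i != b i]|.

Lemma card_near (a : word) (A : {set 'I_s}) :
  #|[set x : word | [forall i, (i \notin A) ==> (x i == a i)]]| = M ^ #|A|.
Proof.
pose F (i : 'I_s) : pred 'I_M := if i \in A then predT else pred1 (a i).
have -> : #|[set x : word | [forall i, (i \notin A) ==> (x i == a i)]]| = #|family F|.
  apply: eq_card => x; rewrite inE; apply/fintype.forallP/familyP => /= H i.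
    by have := H i; rewrite /F; case: (i \in A).
  by have := H i; rewrite /F; case: (i \in A).
rewrite card_family foldrE big_map big_enum /=.
rewrite (bigID (fun i => i \in A)) /= [X in _ * X]big1 ?muln1.
  rewrite -sum1_card expn_sum; apply: eq_bigr => i iA.
  by rewrite /F iA expn1 eq_cardT ?size_enum_ord // => ?; rewrite inE.
by move=> i iA; rewrite /F (negbTE iA) card1.
Qed.

(** Squared so as to avoid a half-integer power of the size of the alphabet: a word at
    distance at most s / 2 is given by the set of the places where it differs, at
    most 2 ^ s choices, and by at most s / 2 letters. *)
Lemma card_hamming_ball (a : word) :
  #|[set x : word | 2 * hamming a x <= s]| ^ 2 <= (2 ^ s) ^ 2 * M ^ s.
Proof.
have [M0|M0] := posnP M.
  have [s0|s0] := posnP s.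
    have e : M ^ s = 1 by rewrite s0.
    have := max_card (mem [set x : word | 2 * hamming a x <= s]).
    rewrite card_ffun !card_ord e muln1.
    by case: #|_| => [|[|//]] _ //; rewrite exp1n sqrn_gt0 expn_gt0.
  by have := a (Ordinal s0); case; rewrite {1}M0.
pose D (x : word) : {set 'I_s} := [set i | a i != x i].
pose B := [set x : word | 2 * hamming a x <= s].
have h : #|B| <= \sum_(A : {set 'I_s} | 2 * #|A| <= s) M ^ #|A|.
  rewrite -sum1_card (partition_big D (fun A : {set 'I_s} => 2 * #|A| <= s)) /=; last first.
    by move=> x; rewrite inE.
  apply: leq_sum => A _; rewrite -(card_near a) -sum1_card.
  rewrite [leqRHS](bigID (fun x => (x \in B) && (D x == A))) /=.
  apply: leq_trans (leq_addr _ _); apply/eq_leq/eq_bigl => x.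
  apply: esym; apply: andb_idl => /andP[_ /eqP <-]; rewrite inE.
  by apply/fintype.forallP => i; apply/implyP; rewrite inE negbK eq_sym.
have h1 (A : {set 'I_s}) : 2 * #|A| <= s -> (M ^ #|A|) ^ 2 <= M ^ s.
  by move=> As; rewrite -expnM mulnC leq_pexp2l.
pose N := \max_(A : {set 'I_s} | 2 * #|A| <= s) M ^ #|A|.
have hN : N ^ 2 <= M ^ s.
  rewrite /N; elim/big_rec: _ => [|A n As hn] //.
  by rewrite /maxn; case: ifP => // _; exact: h1.
have h2 : #|B| <= 2 ^ s * N.
  apply: leq_trans h _; apply: (@leq_trans (\sum_(A : {set 'I_s} | 2 * #|A| <= s) N)).
    by apply: leq_sum => A As; apply: (leq_bigmax_cond _ As).
  rewrite sum_nat_const leq_mul2r; apply/orP; right.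
  by apply: leq_trans (max_card _) _; rewrite -cardsT -powersetT card_powerset cardsT card_ord.
by apply: leq_trans (_ : (2 ^ s * N) ^ 2 <= _); rewrite ?leq_exp2r // expnMn leq_mul2l hN orbT.
Qed.

(** Gilbert's argument: the balls around the words of a maximal code cover all words. *)
Lemma code_exists : exists C : {set word},
  {in C &, forall a b, a != b -> s <= 2 * hamming a b} /\
  M ^ s <= (#|C| * 2 ^ s) ^ 2.
Proof.
pose P (C : {set word}) := [forall a in C, forall b in C, (a != b) ==> (s <= 2 * hamming a b)].
have P0 : P finset.set0 by apply/fintype.forallP => a; rewrite inE.
case: (@arg_maxnP _ finset.set0 P (fun C => #|C|) P0) => C PC Cmax.
exists C; split.
  move=> a b aC bC; move/fintype.forallP: PC => /(_ a); rewrite aC => /fintype.forallP/(_ b).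
  by rewrite bC /= => /implyP.
have cover : [set: word] \subset \bigcup_(a in C) [set x : word | 2 * hamming a x <= s].
  apply/fintype.subsetP => x _; apply/negPn/negP => xC.
  have far a : a \in C -> s < 2 * hamming a x.
    move=> aC; rewrite ltnNge; apply: contra xC => ax.
    by apply/finset.bigcupP; exists a => //; rewrite inE.
  have xnC : x \notin C.
    apply/negP => /far; rewrite /hamming (_ : [set i | x i != x i] = finset.set0) ?cards0 //.
    by apply/setP => i; rewrite !inE eqxx.
  have hs a b : hamming a b = hamming b a.
    by rewrite /hamming; apply: eq_card => i; rewrite !inE eq_sym.
  suff PU : P (x |: C) by have := Cmax _ PU; rewrite /geq /= cardsU1 xnC add1n ltnn.
  apply/fintype.forallP => a; apply/implyP => aC; apply/fintype.forallP => b; apply/implyP => bC.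
  apply/implyP => ab; move: aC bC; rewrite !inE => /orP[/eqP ax|aC] /orP[/eqP bx|bC].
  - by rewrite ax bx eqxx in ab.
  - by rewrite ax hs ltnW // far.
  - by rewrite bx ltnW // far.
  - move/fintype.forallP: PC => /(_ a); rewrite aC => /fintype.forallP/(_ b).
    by rewrite bC ab.
have h : M ^ s <= \sum_(a in C) #|[set x : word | 2 * hamming a x <= s]|.
  have -> : M ^ s = #|[set: word]| by rewrite cardsT card_ffun !card_ord.
  apply: leq_trans (subset_leq_card cover) _.
  elim/big_rec2 : _ => [|a n A _ h]; first by rewrite cards0.
  by apply: leq_trans (leq_card_setU _ _) _; rewrite leq_add2l.
have [->//|Ms0] := posnP (M ^ s).
pose N := \max_(a in C) #|[set x : word | 2 * hamming a x <= s]|.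
have hN : N ^ 2 <= (2 ^ s) ^ 2 * M ^ s.
  rewrite /N; elim/big_rec: _ => // a n _ hn; rewrite /maxn; case: ifP => // _.
  exact: card_hamming_ball.
have h2 : M ^ s <= #|C| * N.
  apply: leq_trans h _; rewrite -sum_nat_const; apply: leq_sum => a aC.
  exact: (leq_bigmax_cond _ aC).
rewrite expnMn -(leq_pmul2r Ms0) -mulnA.
apply: (@leq_trans ((#|C| * N) ^ 2)); first by rewrite mulnn leq_exp2r.
by rewrite expnMn leq_mul2l hN orbT.
Qed.
End Code.

(** With 4 ^ (k + 1) letters, the factor 2 ^ s lost in the covering is absorbed. *)
Lemma code_exists_pow (s k : nat) : exists C : {set {ffun 'I_s -> 'I_(4 ^ k.+1)}},
  {in C &, forall a b, a != b -> (s <= 2 * hamming a b)%N} /\ (2 ^ (k * s) <= #|C|)%N.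
Proof.
have [C [CP hC]] := code_exists s (4 ^ k.+1); exists C; split => //.
have s0 : (0 < 2 ^ s)%N by rewrite expn_gt0.
rewrite -(leq_pmul2r s0) -(@leq_exp2r _ _ 2) //; apply: leq_trans hC.
rewrite -expnD -!expnM (_ : 4 = 2 ^ 2)%N // -!expnM leq_exp2l //; lia.
Qed.

Section Enumeration.
Context {V : choiceType}.
Implicit Types (S : seq V) (K : nat).

Definition irange K : seq int :=
  0 :: [seq Posz j.+1 | j <- iota 0 K] ++ [seq Negz j | j <- iota 0 K].

Lemma mem_irange K (i : int) : (i \in irange K) = (`|i| <= K)%N.
Proof.
rewrite inE mem_cat; apply/or3P/idP => [[/eqP->//|/mapP[j]|/mapP[j]]|].
- by rewrite mem_iota => /andP[_ jK] ->.
- by rewrite mem_iota => /andP[_ jK] ->.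
case: i => [[|j]|j] /= h; first exact: Or31.
- by apply: Or32; apply/mapP; exists j; rewrite ?mem_iota.
- by apply: Or33; apply/mapP; exists j; rewrite ?mem_iota.
Qed.

(** The integer vectors supported by [S] whose l_1 norm is at most [K]. *)
Fixpoint ivectors S K : seq (V -> int) :=
  if S is x :: S' then
    flatten [seq [seq (fun y => if y == x then i else k y) | k <- ivectors S' (K - `|i|)%N]
            | i <- irange K]
  else [:: fun=> 0].

Lemma ivectors_cons x S K : ivectors (x :: S) K =
  flatten [seq [seq (fun y => if y == x then i else k y) | k <- ivectors S (K - `|i|)%N]
          | i <- irange K].
Proof. by []. Qed.

Lemma mem_ivectors S K (k : V -> int) : uniq S -> (forall x, x \notin S -> k x = 0) ->
  (\sum_(x <- S) `|k x| <= K)%N -> k \in ivectors S K.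
Proof.
elim: S K k => [|x S IH] K k.
  by move=> _ k0 _; rewrite inE; apply/eqP/funext => x; rewrite k0.
rewrite ivectors_cons cons_uniq => /andP[xS uS] k0; rewrite big_cons => kK.
pose k' y := if y == x then 0 else k y.
apply/flatten_mapP; exists (k x); first by rewrite mem_irange; lia.
apply/mapP; exists k'; last by apply/funext => y; rewrite /k'; case: eqP => // ->.
apply: IH => //.
- move=> y yS; rewrite /k'; case: eqP => // /eqP yx; apply: k0.
  by rewrite inE negb_or yx.
- rewrite leq_subRL; last by lia.
  apply: leq_trans kK; rewrite leq_add2l; apply: eq_leq; apply: eq_big_seq => y yS.
  by rewrite /k'; case: eqP => // yx; rewrite -yx yS in xS.
Qed.

Lemma ivectors_supp S K k x : k \in ivectors S K -> x \notin S -> k x = 0.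
Proof.
elim: S K k => [|y S IH] K k; first by rewrite inE => /eqP ->.
rewrite ivectors_cons => /flatten_mapP[i _ /mapP[k' kS ->]]; rewrite inE negb_or => /andP[/negbTE -> xS].
exact: IH kS xS.
Qed.

Context {R : realType}.

(** The number of vectors is at most x ^ - K times the generating function of the l_1
    norm, which is ((1 + x) / (1 - x)) ^ (size S), for every x between 0 and 1. *)
Lemma size_ivectors S K (x : R) : 0 < x < 1 ->
  (size (ivectors S K))%:R <= x ^- K * ((1 + x) / (1 - x)) ^+ size S.
Proof.
move=> /andP[x0 x1]; have y0 : 0 < 1 - x by lra.
have c0 : 0 < (1 + x) / (1 - x) by apply: divr_gt0; lra.
elim: S K => [|y S IH] K.
  by rewrite expr0 mulr1 invf_ge1 ?exprn_gt0 // exprn_ile1 // ltW.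
rewrite ivectors_cons size_flatten sumnE /shape !big_map natr_sum.
apply: (@le_trans _ _ (\sum_(i <- irange K)
    x ^+ `|i|%N * (x ^- K * ((1 + x) / (1 - x)) ^+ size S))).
  rewrite big_seq [leRHS]big_seq; apply: ler_sum => i; rewrite mem_irange size_map => iK.
  apply: le_trans (IH _) _; rewrite mulrA; apply: ler_wpM2r; first by rewrite exprn_ge0 // ltW.
  rewrite -{2}(subnK iK) exprD invfM mulrCA divff ?mulr1 // expf_neq0 //; lra.
rewrite -mulr_suml exprS [leRHS]mulrCA; apply: ler_wpM2r.
  by rewrite mulr_ge0 ?invr_ge0 ?exprn_ge0 // ltW.
rewrite /irange big_cons big_cat /= !big_map expr0.
have h : \sum_(j <- iota 0 K) x ^+ j.+1 <= x / (1 - x).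
  rewrite -{1}(subn0 K) -[X in iota _ X]/(K - 0)%N big_mkord.
  under eq_bigr do rewrite exprS.
  rewrite -mulr_sumr; apply: ler_wpM2l; first exact: ltW.
  by apply: geometric_le => //; exact: ltW.
have -> : (1 + x) / (1 - x) = 1 + (x / (1 - x) + x / (1 - x)) by field; lra.
by rewrite lerD2l lerD.
Qed.

Lemma ln3_le2 : ln 3 <= 2 :> R.
Proof.
have h := @expR_ge1Dx R 1; have h2 : (3 : R) <= expR 2.
  rewrite (_ : 2 = 1 + 1 :> R) // expRD.
  have : (1 + 1) * (1 + 1) <= expR 1 * expR 1 :> R by apply: ler_pM; lra.
  lra.
by rewrite -(expRK 2) ler_ln ?posrE ?expR_gt0.
Qed.

Lemma ln4_le2 : ln 4 <= 2 :> R.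
Proof.
have h := @expR_ge1Dx R 1; have h2 : (4 : R) <= expR 2.
  rewrite (_ : 2 = 1 + 1 :> R) // expRD.
  have : (1 + 1) * (1 + 1) <= expR 1 * expR 1 :> R by apply: ler_pM; lra.
  lra.
by rewrite -(expRK 2) ler_ln ?posrE ?expR_gt0.
Qed.

(** The choice x = 1 - e / 2, for an l_1 norm of 1 / e units per coordinate. *)
Lemma size_ivectors_dense S K (H e : R) : 0 < e <= 1 -> (size S)%:R <= H -> K%:R <= H / e ->
  (size (ivectors S K))%:R <= expR (H * (3 - ln e)).
Proof.
move=> /andP[e0 e1] SH KH; pose x := 1 - e / 2.
have x0 : 0 < x by rewrite /x; lra.
have x01 : 0 < x < 1 by rewrite x0 /x; lra.
apply: le_trans (size_ivectors S K x01) _.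
have c1 : 0 < (1 + x) / (1 - x) by apply: divr_gt0; rewrite /x; lra.
have lnx : - ln x <= e.
  have xV : 0 < x^-1 by rewrite invr_gt0.
  have := expR_ge1Dx (ln x^-1); rewrite lnK ?posrE // lnV ?posrE // => h.
  have : x^-1 <= 1 + e; last lra.
  by rewrite -[x^-1]mul1r ler_pdivrMr // /x; nra.
have lnc : ln ((1 + x) / (1 - x)) <= 2 - ln e.
  have := ln4_le2; have : ln ((1 + x) / (1 - x)) <= ln (4 / e).
    have e4 : 0 < 4 / e by apply: divr_gt0.
    rewrite ler_ln ?posrE // (_ : 1 - x = e / 2); last by rewrite /x; ring.
    rewrite ler_pdivrMr; last lra.
    have -> : 4 / e * (e / 2) = 2 by field; lra.
    rewrite /x; lra.
  have -> : ln (4 / e) = ln 4 - ln e by rewrite ln_div ?posrE.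
  lra.
have -> : x ^- K = expR (K%:R * - ln x).
  by rewrite expRM_natl expRN lnK ?posrE // exprVn.
rewrite -[X in X ^+ _]lnK ?posrE // -expRM_natl -expRD ler_expR.
have le0 : ln e <= 0 by rewrite ln_le0.
have h1 : K%:R * - ln x <= H.
  apply: le_trans (ler_wpM2l _ lnx) _ => //.
  by rewrite -ler_pdivlMr.
have h2 : (size S)%:R * ln ((1 + x) / (1 - x)) <= H * (2 - ln e).
  apply: le_trans (ler_wpM2l _ lnc) _ => //; apply: ler_wpM2r => //; lra.
lra.
Qed.

(** The choice x = s / (3 N), for an l_1 norm small compared with the number of
    coordinates: each unit costs about ln (N / s). *)
Lemma size_ivectors_sparse S K (s N : R) : 0 < s -> s <= N -> (size S)%:R <= N -> K%:R <= s ->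
  (size (ivectors S K))%:R <= expR (s * (3 + ln (N / s))).
Proof.
move=> s0 sN SN Ks; have N0 : 0 < N by lra.
pose x := s / (3 * N); have N3 : 0 < 3 * N by lra.
have x0 : 0 < x by apply: divr_gt0.
have x3 : x <= 1 / 3 by rewrite /x ler_pdivrMr //; lra.
have x01 : 0 < x < 1 by rewrite x0; lra.
apply: le_trans (size_ivectors S K x01) _.
have c1 : 0 < (1 + x) / (1 - x) by apply: divr_gt0; lra.
have lnx : - ln x <= 2 + ln (N / s).
  have := ln3_le2; rewrite /x !ln_div ?posrE // lnM ?posrE //; lra.
have lnx0 : 0 <= - ln x by rewrite oppr_ge0 ln_le0 //; lra.
have lnc : ln ((1 + x) / (1 - x)) <= 3 * x.
  rewrite -[leRHS]expRK ler_ln ?posrE ?expR_gt0 //.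
  apply: le_trans _ (expR_ge1Dx _); rewrite ler_pdivrMr; nra.
have -> : x ^- K = expR (K%:R * - ln x).
  by rewrite expRM_natl expRN lnK ?posrE // exprVn.
rewrite -[X in X ^+ _]lnK ?posrE // -expRM_natl -expRD ler_expR.
have h1 : K%:R * - ln x <= s * (2 + ln (N / s)).
  apply: le_trans (ler_wpM2r lnx0 Ks) _; apply: ler_wpM2l => //; exact: ltW.
have h2 : (size S)%:R * ln ((1 + x) / (1 - x)) <= N * (3 * x).
  apply: le_trans (ler_wpM2l _ lnc) _ => //; apply: ler_wpM2r => //; lra.
have h3 : N * (3 * x) = s by rewrite /x; field; lra.
lra.
Qed.

End Enumeration.

(** * The levels of a regular tree *)

(** All that is used of a regular tree: the level of a vertex, its ancestors, the
    list of the vertices of a level, and the number of descendants on each level, up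
    to the factor [c]. *)
Record leveled (R : realType) (c : R) (H : nat -> R) (V : choiceType) := Leveled {
  lev : V -> nat;
  anc : V -> nat -> V;
  Lv : nat -> seq V;
  Lv_uniq : forall j, uniq (Lv j);
  mem_Lv : forall j x, (x \in Lv j) = (lev x == j);
  anc_lev : forall x, anc x (lev x) = x;
  lev_anc : forall x j, (j <= lev x)%N -> lev (anc x j) = j;
  anc_anc : forall x j k, (j <= k)%N -> (k <= lev x)%N -> anc (anc x k) j = anc x j;
  count_anc : forall j l y, (j <= l)%N -> lev y = j ->
    c^-1 * (H l / H j) <= (count (fun x => anc x j == y) (Lv l))%:R <= c * (H l / H j);
  size_Lv0 : size (Lv 0) = 1%N }.

Section TreeLevels.
Context {V : choiceType} (E : rel V) (root : V).
Hypothesis treeE : is_tree E.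

Let sp_ex y : exists s, simple_path E root s y.
Proof. by have [_ _ /(_ root y)[s [sy _]]] := treeE; exists s. Qed.

Definition rpath (y : V) : seq V := sval (cid (sp_ex y)).

Lemma simple_path_uniq x y s s' : simple_path E x s y -> simple_path E x s' y -> s = s'.
Proof.
by have [_ _ /(_ x y)[s0 [_ U]]] := treeE; move=> /U <- /U <-.
Qed.

Lemma rpathP y : simple_path E root (rpath y) y.
Proof. exact: svalP (cid (sp_ex y)). Qed.

Definition depth y := size (rpath y).
Definition ancestor y j := nth root (root :: rpath y) j.

Lemma ancestor_depth y : ancestor y (depth y) = y.
Proof. by rewrite /ancestor /depth -last_nth; have /and3P[_ _ /eqP] := rpathP y. Qed.

Lemma rpath_ancestor y j : (j <= depth y)%N -> rpath (ancestor y j) = take j (rpath y).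
Proof.
move=> jy; apply: (simple_path_uniq (rpathP _)); have /and3P[p1 p2 p3] := rpathP y.
apply/and3P; split; first exact: take_path.
- by have := take_uniq j.+1 p2.
- by rewrite (last_nth root) size_takel // /ancestor; case: j jy => // j jy /=; rewrite nth_take.
Qed.

Lemma depth_ancestor y j : (j <= depth y)%N -> depth (ancestor y j) = j.
Proof. by move=> jy; rewrite /depth rpath_ancestor // size_takel. Qed.

Lemma ancestor_ancestor y j k : (j <= k)%N -> (k <= depth y)%N ->
  ancestor (ancestor y k) j = ancestor y j.
Proof.
move=> jk ky; rewrite /ancestor -/(ancestor y k) rpath_ancestor //.
by case: j jk => // j jk /=; rewrite nth_take.
Qed.

(** Uniqueness of paths turns the order of the tree into a comparison of prefixes of
    the paths from the root. *)
Lemma tree_leP x y : tree_le E root x y <-> (depth x <= depth y)%N /\ ancestor y (depth x) = x.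
Proof.
split=> [[s /(simple_path_uniq (rpathP y)) <- xs]|[xy <-]].
  have [j jy xj] : exists2 j, (j <= depth y)%N & ancestor y j = x.
    exists (index x (root :: rpath y)); last by rewrite /ancestor nth_index.
    by rewrite -ltnS /depth -/(size (root :: rpath y)) index_mem.
  by rewrite -xj depth_ancestor.
exists (rpath y); first exact: rpathP.
by rewrite /ancestor mem_nth.
Qed.

Lemma graph_dist_uniq x y k l : graph_dist E x y k -> graph_dist E x y l -> k = l.
Proof.
move=> [[s [s1 s2 s3]] s4] [[t [t1 t2 t3]] t4]; apply/eqP; rewrite eqn_leq.
by apply/andP; split; [rewrite -t3; exact: s4|rewrite -s3; exact: t4].
Qed.

Lemma graph_dist_tree_le x y : tree_le E root x y -> graph_dist E x y (depth y - depth x).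
Proof.
move=> /tree_leP[xy ax]; have /and3P[p1 p2 /eqP p3] := rpathP y.
pose s := drop (depth x) (rpath y).
have E1 : x :: s = drop (depth x) (root :: rpath y).
  by rewrite -{1}ax /s /ancestor -drop_nth // ltnS.
have sp : simple_path E x s y.
  apply/and3P; split.
  - have := p1; rewrite -{1}(cat_take_drop (depth x) (rpath y)) cat_path => /andP[_].
    rewrite (last_nth root) size_takel //.
    suff -> : nth root (root :: take (depth x) (rpath y)) (depth x) = x by [].
    by rewrite -[RHS]ax /ancestor; case: (depth x) => // j /=; rewrite nth_take.
  - by rewrite E1 drop_uniq.
  - apply/eqP; rewrite -p3 -[in RHS](cat_take_drop (depth x) (rpath y)) last_cat.
    rewrite (last_nth root _ (take _ _)) size_takel //.
    suff -> : nth root (root :: take (depth x) (rpath y)) (depth x) = x by [].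
    by rewrite -[RHS]ax /ancestor; case: (depth x) => // j /=; rewrite nth_take.
have ss : size s = (depth y - depth x)%N by rewrite size_drop.
split; first by exists s; have /and3P[? _ /eqP ?] := sp.
move=> t tp tl; case: (shortenP tp) tl => t' tp' tu tt tl.
have -> : (depth y - depth x)%N = size t'.
  by rewrite -ss (simple_path_uniq sp (s' := t')) //; apply/and3P; split => //; rewrite tl.
by apply: uniq_leq_size => //; case/andP: tu.
Qed.

Lemma descendantsP l x y :
  descendants E root l x y <-> depth y = (depth x + l)%N /\ ancestor y (depth x) = x.
Proof.
split=> [[xy d]|[dy ax]].
  have /tree_leP[xy1 xy2] := xy; split => //.
  by rewrite (graph_dist_uniq d (graph_dist_tree_le xy)) subnKC.
have xy : tree_le E root x y by apply/tree_leP; rewrite dy leq_addr.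
by split => //; have := graph_dist_tree_le xy; rewrite dy addKn.
Qed.

Lemma summation_opE (R : realType) (u w f : V -> R) x :
  summation_op E root u w f x =
  w x * \sum_(j < (depth x).+1) u (ancestor x j) * f (ancestor x j).
Proof.
rewrite /summation_op; congr (_ * _).
have /and3P[_ p2 _] := rpathP x.
rewrite (_ : [set y | tree_le E root y x] = [set` root :: rpath x]); last first.
  apply/seteqP; split => y /= => [[s /(simple_path_uniq (rpathP x)) <-//]|].
  by move=> ys; exists (rpath x) => //; exact: rpathP.
rewrite -fsbig_seq // (big_nth root) big_mkord /=.
by apply: eq_bigr.
Qed.

End TreeLevels.

Section RegularTreeLevels.
Context {R : realType} (h : R -> R) (m : nat) (c : R) (V : choiceType) (E : rel V) (root : V).
Context (I : nat -> Type) (eta : forall j, I j -> V).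
Hypothesis reg : regular_tree h m c E root eta.

(** The listing of the vertices by [eta] need not start at the root; the partition
    property forces [eta j] to list the vertices of depth [j], by induction on the
    depth.  The levels are then the sets of descendants of the root. *)
Lemma regular_tree_leveled :
  exists t : leveled c (fun j => (h (2 ^- (m * j)))^-1) V,
    (forall x, exists i : I (lev t x), x = eta i) /\
    forall (u w f : V -> R) x, summation_op E root u w f x =
      w x * \sum_(j < (lev t x).+1) u (anc t x j) * f (anc t x j).
Proof.
have [treeE [g gK Kg] part card] := reg.
have dep j (i : I j) : depth root treeE (eta i) = j.
  move: {2}(depth _ _ _) (erefl (depth root treeE (eta i))) => n.
  elim: n j i => [|n IH] j i dn.
    case: j i dn => // j i d0.
    have [C _ _] := part j; have : range (@eta j.+1) (eta i) by exists i.
    rewrite -C => -[i' _ /(descendantsP root treeE)[]].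
    by rewrite d0 addn1.
  have nd : (n <= depth root treeE (eta i))%N by rewrite dn.
  pose z := ancestor root treeE (eta i) n.
  have dz : depth root treeE z = n by rewrite depth_ancestor.
  have [k [i' zE]] : exists k (i' : I k), z = eta i'.
    by exists (tag (g z)), (tagged (g z)); rewrite Kg.
  have kn : k = n by rewrite -(IH k i') -?zE.
  subst k.
  have [C _ _] := part n.
  have : range (@eta n.+1) (eta i).
    rewrite -C; exists i' => //; apply/(descendantsP root treeE).
    by rewrite -zE dz addn1 dn.
  case=> i2 _ E2; have := f_equal g E2.
  have := gK (existT _ n.+1 i2); have := gK (existT _ j i); rewrite /= => -> ->.
  by move=> jE; have := congr1 (@tag _ _) jE => /= nj; rewrite dn nj.
have ex x : exists i : I (depth root treeE x), x = eta i.
  have : eta (tagged (g x)) = x by rewrite Kg.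
  move: (tag (g x)) (tagged (g x)) => j i <-.
  by rewrite dep; exists i.
have d0 : depth root treeE root = 0%N.
  suff : rpath root treeE root = [::] by rewrite /depth => ->.
  by apply: (simple_path_uniq treeE (rpathP root treeE root)); rewrite /simple_path /= eqxx.
have a0 x : ancestor root treeE x 0 = root by [].
have fin j : finite_set (descendants E root j root).
  have [i rE] := ex root.
  by have [] := card _ j i; rewrite -rE.
pose Lv j : seq V := fset_set (descendants E root j root).
have LvP j x : (x \in Lv j) = (depth root treeE x == j).
  rewrite in_fset_set //; apply/idP/eqP.
    by rewrite inE => /(descendantsP root treeE)[->]; rewrite d0.
  by move=> xj; rewrite inE; apply/(descendantsP root treeE); rewrite d0 a0.
have cnt j l y : (j <= l)%N -> depth root treeE y = j ->
    c^-1 * ((h (2 ^- (m * l)))^-1 / (h (2 ^- (m * j)))^-1) <=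
     (count (fun x => ancestor root treeE x j == y) (Lv l))%:R
     <= c * ((h (2 ^- (m * l)))^-1 / (h (2 ^- (m * j)))^-1).
  move=> jl yj; have [i yE] := ex y.
  have [fd] := card _ (l - j)%N i; rewrite -yE /= yj subnKC //.
  rewrite invrK [X in c^-1 * X]mulrC [X in c * X]mulrC.
  suff -> : #|` fset_set (descendants E root (l - j) y)|%fset =
            count (fun x => ancestor root treeE x j == y) (Lv l) by [].
  rewrite -size_filter; apply/perm_size/uniq_perm; rewrite ?filter_uniq ?fset_uniq // => x.
  rewrite mem_filter LvP in_fset_set; last by rewrite yE.
  apply/idP/andP => [|[/eqP ax /eqP xl]].
    by rewrite inE => /(descendantsP root treeE)[]; rewrite yj subnKC // => -> ->.
  by rewrite inE; apply/(descendantsP root treeE); rewrite yj subnKC.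
have s0 : size (Lv 0) = 1%N.
  have : perm_eq (Lv 0) [:: root].
    apply: uniq_perm; rewrite ?fset_uniq // => x.
    rewrite LvP inE; apply/eqP/eqP => [x0|-> //].
    by rewrite -(ancestor_depth root treeE x) x0 a0.
  by move/perm_size.
exists (@Leveled R c _ V (depth root treeE) (ancestor root treeE) Lv
  (fun j => fset_uniq _) LvP (ancestor_depth root treeE) (@depth_ancestor _ _ root treeE)
  (@ancestor_ancestor _ _ root treeE) cnt s0); split => //= u w f x.
exact: summation_opE.
Qed.

End RegularTreeLevels.

(** * Norms of the path sums on groups of levels *)

Section PowerMean.
Context {R : realType}.

(** The graph of a convex power lies above its tangents; this is Young's inequality. *)
Lemma powR_tangent (s x y : R) : 1 <= s -> 0 <= x -> 0 <= y ->
  x `^ s + s * x `^ (s - 1) * (y - x) <= y `^ s.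
Proof.
rewrite le_eqVlt => /predU1P[<- x0 y0|s1 x0 y0].
  by rewrite subrr powRr0 !powRr1 // !mul1r addrC subrK.
have s0 : 0 < s by lra.
have s10 : s - 1 != 0 by rewrite subr_eq0 gt_eqF.
have := @conjugate_powR _ y (x `^ (s - 1)) s (s / (s - 1)) y0 (powR_ge0 _ _) s0.
rewrite divr_gt0 ?subr_gt0 // => /(_ isT).
have -> : s^-1 + (s / (s - 1))^-1 = 1 by field; apply/andP; split => //; lra.
move=> /(_ erefl); rewrite -powRrM.
have -> : (s - 1) * (s / (s - 1)) = s by field.
have -> : x `^ s = x * x `^ (s - 1) by rewrite mulr_powRB1.
set z := x `^ (s - 1); move: (y `^ s) => ys h.
have : s * (y * z) <= s * (ys / s + x * z / (s / (s - 1))) by rewrite ler_pM2l.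
have -> : s * (ys / s + x * z / (s / (s - 1))) = ys + (s - 1) * (x * z).
  by field; apply/andP; split => //; lra.
lra.
Qed.

(** Jensen's inequality for the power [s] with the weights [a], obtained by summing
    the tangent inequality at the mean value. *)
Lemma power_mean (I : Type) (r : seq I) (P : pred I) (s : R) (a y : I -> R) : 1 <= s ->
  (forall i, P i -> 0 <= a i) -> (forall i, P i -> 0 <= y i) ->
  (\sum_(i <- r | P i) a i * y i) `^ s <=
  (\sum_(i <- r | P i) a i) `^ (s - 1) * \sum_(i <- r | P i) a i * y i `^ s.
Proof.
move=> s1 a0 y0; set A := \sum_(i <- r | P i) a i.
set Y := \sum_(i <- r | P i) a i * y i.
have A0 : 0 <= A by exact: sumr_ge0.
have Y0 : 0 <= Y by apply: sumr_ge0 => i Pi; rewrite mulr_ge0 ?a0 ?y0.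
have S0 : 0 <= \sum_(i <- r | P i) a i * y i `^ s.
  by apply: sumr_ge0 => i Pi; rewrite mulr_ge0 ?a0 ?powR_ge0.
have [A00|A00] := eqVneq A 0.
  suff -> : Y = 0 by rewrite powR0 ?mulr_ge0 ?powR_ge0 //; lra.
  have h (l : seq I) : \sum_(i <- l | P i) a i = 0 -> \sum_(i <- l | P i) a i * y i = 0.
    elim: l => [|i l IH]; rewrite ?big_nil // !big_cons; case: ifP => // Pi.
    move=> /eqP; rewrite paddr_eq0 ?a0 ?sumr_ge0 // => /andP[/eqP -> /eqP /IH ->].
    by rewrite mul0r addr0.
  by rewrite /Y h.
have Ap : 0 < A by rewrite lt_neqAle eq_sym A00.
pose x := Y / A; have x0 : 0 <= x by rewrite divr_ge0.
have -> : Y = A * x by rewrite /x mulrC divfK.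
rewrite powRM // -{1}(@mulr_powRB1 _ A s) //; last lra.
rewrite (mulrC A) -mulrA; apply: ler_wpM2l; first exact: powR_ge0.
have h : \sum_(i <- r | P i) a i * (x `^ s + s * x `^ (s - 1) * (y i - x)) <=
    \sum_(i <- r | P i) a i * y i `^ s.
  by apply: ler_sum => i Pi; apply: ler_wpM2l; [exact: a0|apply: powR_tangent => //; exact: y0].
apply: le_trans h; apply: eqW.
have -> : \sum_(i <- r | P i) a i * (x `^ s + s * x `^ (s - 1) * (y i - x)) =
   A * (x `^ s - s * x `^ (s - 1) * x) + s * x `^ (s - 1) * Y.
  rewrite /A /Y mulr_suml mulr_sumr -big_split /=; apply: eq_bigr => i _; ring.
by rewrite (_ : Y = A * x); [ring|rewrite /x mulrC divfK].
Qed.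

End PowerMean.

Section Push.
Context {R : realType} (c : R) (H : nat -> R) (V : choiceType) (t : leveled c H V).
Implicit Types (F : V -> R).

(** Fubini on pairs of comparable vertices. *)
Lemma sum_anc F j l : (j <= l)%N ->
  \sum_(x <- Lv t l) F (anc t x j) =
  \sum_(y <- Lv t j) F y * (count (fun x => anc t x j == y) (Lv t l))%:R.
Proof.
move=> jl.
transitivity (\sum_(x <- Lv t l) \sum_(y <- Lv t j) (if anc t x j == y then F y else 0)).
  rewrite big_seq [RHS]big_seq; apply: eq_bigr => x; rewrite mem_Lv => /eqP xl.
  rewrite (bigD1_seq (anc t x j)) ?Lv_uniq ?mem_Lv ?lev_anc ?xl //= eqxx big1 ?addr0 // => y.
  by rewrite eq_sym => /negbTE ->.
rewrite exchange_big /=; apply: eq_bigr => y _.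
by rewrite -big_mkcond /= big_const_seq iter_addr_0 mulr_natr.
Qed.

Lemma push_le F j l : (forall y, 0 <= F y) -> (j <= l)%N ->
  \sum_(x <- Lv t l) F (anc t x j) <= c * (H l / H j) * \sum_(y <- Lv t j) F y.
Proof.
move=> F0 jl; rewrite sum_anc // mulr_sumr big_seq [leRHS]big_seq; apply: ler_sum => y.
rewrite mem_Lv => /eqP yj; have /andP[_ h] := count_anc jl yj.
by rewrite mulrC; apply: ler_wpM2r.
Qed.

Lemma push_ge F j l : (forall y, 0 <= F y) -> (j <= l)%N ->
  c^-1 * (H l / H j) * \sum_(y <- Lv t j) F y <= \sum_(x <- Lv t l) F (anc t x j).
Proof.
move=> F0 jl; rewrite sum_anc // mulr_sumr big_seq [leRHS]big_seq; apply: ler_sum => y.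
rewrite mem_Lv => /eqP yj; have /andP[h _] := count_anc jl yj.
by rewrite [leRHS]mulrC; apply: ler_wpM2r.
Qed.

Lemma size_Lv j : c^-1 * (H j / H 0) <= (size (Lv t j))%:R <= c * (H j / H 0).
Proof.
have e l : \sum_(x <- Lv t l) (1 : R) = (size (Lv t l))%:R.
  by rewrite big_const_seq iter_addr_0 count_predT.
have := @push_le (fun=> 1) 0 j (fun=> ler01) (leq0n _).
have := @push_ge (fun=> 1) 0 j (fun=> ler01) (leq0n _).
by rewrite !e size_Lv0 !mulr1 => -> ->.
Qed.

End Push.

Section Operator.
Context {R : realType} (c : R) (H : nat -> R) (q : R) (u w : nat -> R).
Hypotheses (c1 : 1 <= c) (H0 : forall j, 0 < H j) (q1 : 1 <= q).
Hypotheses (u0 : forall j, 0 < u j) (w0 : forall j, 0 < w j).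

Section OneTree.
Context (V : choiceType) (t : leveled c H V).
Implicit Types (e : V -> R) (P : pred nat).

Definition lsum (M : nat) (F : V -> R) : R := \sum_(l < M) \sum_(x <- Lv t l) F x.

(** The part of the path sum coming from the levels in [P], with absolute values.  The
    groups of levels on which functions are rounded are such sets [P]. *)
Definition psum P e (x : V) : R :=
  w (lev t x) * \sum_(j < (lev t x).+1 | P j) u j * `|e (anc t x j)|.

Lemma psum_ge0 P e x : 0 <= psum P e x.
Proof.
by apply: mulr_ge0; [exact: ltW|apply: sumr_ge0 => j _; rewrite mulr_ge0 // ltW].
Qed.

Lemma ler_lsum M F G : (forall x, (lev t x < M)%N -> F x <= G x) -> lsum M F <= lsum M G.
Proof.
move=> FG; apply: ler_sum => l _; rewrite big_seq [leRHS]big_seq; apply: ler_sum => x.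
by rewrite mem_Lv => /eqP xl; apply: FG; rewrite xl.
Qed.

(** Minkowski's inequality for the groups of levels, in the form of Jensen's inequality
    with the bounds [b] themselves as weights. *)
Lemma psum_groups (grp : nat -> nat) (b : nat -> R) (B : R) e :
  (forall j, (grp j <= j)%N) -> (forall g, 0 < b g) ->
  (forall G, \sum_(g < G) b g <= B) ->
  (forall g M, lsum M (fun x => psum (fun j => grp j == g) e x `^ q) <= b g `^ q) ->
  forall M, lsum M (fun x => psum xpredT e x `^ q) <= B `^ q.
Proof.
move=> gj b0 bB hb M.
have B0 : 0 <= B by have := bB 0; rewrite big_ord0.
pose D g x := psum (fun j => grp j == g) e x.
have DE x : psum xpredT e x = \sum_(g < (lev t x).+1) b g * (D g x / b g).
  under eq_bigr do rewrite mulrC divfK ?gt_eqF //.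
  rewrite /D /psum -mulr_sumr; congr (_ * _).
  under [RHS]eq_bigr do rewrite big_mkcond.
  rewrite exchange_big /=; apply: eq_bigr => j _.
  have jl : (grp j < (lev t x).+1)%N by rewrite ltnS (leq_trans (gj _)) // -ltnS.
  rewrite (bigD1 (Ordinal jl)) //= eqxx big1 ?addr0 // => g /eqP gj'.
  by case: eqP => // jg; case: gj'; apply/val_inj.
apply: (@le_trans _ _ (lsum M (fun x => B `^ (q - 1) * \sum_(g < M) b g `^ (1 - q) * D g x `^ q))).
  apply: ler_lsum => x xM; rewrite DE.
  apply: le_trans (power_mean _ q1 _ _) _.
  - by move=> g _; exact: ltW.
  - by move=> g _; rewrite divr_ge0 ?psum_ge0 // ltW.
  apply: ler_pM; rewrite ?powR_ge0 //.
  - by apply: sumr_ge0 => g _; rewrite mulr_ge0 ?powR_ge0 // ltW.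
  - by apply: ge0_ler_powR; rewrite ?nnegrE ?sumr_ge0 ?subr_ge0 // => g _; exact: ltW.
  rewrite (big_ord_widen _ (fun g => b g * (D g x / b g) `^ q) xM) big_mkcond /=.
  apply: ler_sum => g _; case: ifP => _; last by rewrite mulr_ge0 ?powR_ge0.
  rewrite powRM ?psum_ge0 ?invr_ge0 ?(ltW (b0 _)) // mulrCA mulrC; apply: ler_wpM2r; first exact: powR_ge0.
  rewrite -powR_inv1 ?(ltW (b0 _)) // -powRrM mulN1r -{1}(powRr1 (ltW (b0 g))) -powRD //.
  by rewrite (gt_eqF (b0 g)) implybT.
rewrite /lsum.
under eq_bigr do under eq_bigr do rewrite mulr_sumr.
under eq_bigr do rewrite exchange_big /=.
rewrite exchange_big /=.
have -> : B `^ q = B `^ (q - 1) * B by rewrite mulrC mulr_powRB1 // (lt_le_trans ltr01 q1).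
apply: (@le_trans _ _ (\sum_(g < M) B `^ (q - 1) * b g)).
  apply: ler_sum => g _; under eq_bigr do rewrite -!mulr_sumr.
  rewrite -!mulr_sumr; apply: ler_wpM2l; first exact: powR_ge0.
  have E1 : b g = b g `^ (1 - q) * b g `^ q.
    rewrite -powRD; last by rewrite (gt_eqF (b0 g)) implybT.
    by rewrite subrK powRr1 // ltW.
  by rewrite [leRHS]E1; apply: ler_wpM2l; [exact: powR_ge0|exact: hb].
by rewrite -mulr_sumr; apply: ler_wpM2l => //; exact: powR_ge0.
Qed.

(** On a single level there is no interaction between ancestors, and the values of
    [w] below level [j] sum up to [W j]. *)
Lemma psum_level (W : nat -> R) (C0 : R) e j :
  (forall j, 0 <= W j) ->
  (forall j M, \sum_(j <= l < M) w l `^ q * H l <= C0 * W j `^ q * H j) ->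
  forall M, lsum M (fun x => psum (pred1 j) e x `^ q) <=
    c * C0 * (u j * W j) `^ q * \sum_(y <- Lv t j) `|e y| `^ q.
Proof.
move=> W0 hW M; have q0 : q != 0 by rewrite gt_eqF // (lt_le_trans ltr01 q1).
pose S := \sum_(y <- Lv t j) `|e y| `^ q.
have S0 : 0 <= S by apply: sumr_ge0 => y _; exact: powR_ge0.
have lev_le l : \sum_(x <- Lv t l) psum (pred1 j) e x `^ q <=
    if (j <= l)%N then c * u j `^ q / H j * S * (w l `^ q * H l) else 0.
  case: leqP => [jl|lj]; last first.
    rewrite big_seq big1 // => x; rewrite mem_Lv => /eqP xl.
    rewrite /psum big1 ?mulr0 ?powR0 // => i /eqP ij.
    by have := ltn_ord i; rewrite ij xl ltnS leqNgt lj.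
  have -> : \sum_(x <- Lv t l) psum (pred1 j) e x `^ q =
      w l `^ q * u j `^ q * \sum_(x <- Lv t l) `|e (anc t x j)| `^ q.
    rewrite mulr_sumr big_seq [RHS]big_seq; apply: eq_bigr => x; rewrite mem_Lv => /eqP xl.
    rewrite /psum xl; have jl' : (j < l.+1)%N by [].
    rewrite (big_pred1 (Ordinal jl')) => [|i]; last by rewrite /= -(inj_eq val_inj).
    by rewrite !powRM ?mulr_ge0 ?(ltW (w0 _)) ?(ltW (u0 _)) //= mulrA.
  have := @push_le _ _ _ _ t (fun y => `|e y| `^ q) j l (fun=> powR_ge0 _ _) jl.
  move=> /(ler_wpM2l (mulr_ge0 (powR_ge0 (w l) q) (powR_ge0 (u j) q))) h.
  apply: le_trans h _; apply: eqW; rewrite -/S; field; by rewrite gt_eqF.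
apply: (@le_trans _ _ (\sum_(l < M) if (j <= l)%N then c * u j `^ q / H j * S * (w l `^ q * H l) else 0)).
  by apply: ler_sum => l _; exact: lev_le.
rewrite -big_mkcond /=.
have -> : \sum_(l < M | (j <= l)%N) c * u j `^ q / H j * S * (w l `^ q * H l) =
   c * u j `^ q / H j * S * \sum_(j <= l < M) (w l `^ q * H l).
  by rewrite mulr_sumr big_geq_mkord /=.
have c0 : 0 <= c := le_trans ler01 c1.
have p0 : 0 <= c * u j `^ q / H j * S.
  by rewrite !mulr_ge0 ?powR_ge0 ?invr_ge0 // ltW.
apply: le_trans (ler_wpM2l p0 (hW j M)) _; apply: eqW.
rewrite powRM ?(ltW (u0 _)) // -/S; field; by rewrite gt_eqF.
Qed.

(** Below level [b] the path sum over the levels of [P] is constant along paths, so it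
    is transported to level [b]; the sum of [w] ^ q from level [a] on gives [W a]. *)
Lemma psum_critical (W : nat -> R) (C0 : R) e P a b : (0 <= C0) ->
  (forall j M, \sum_(j <= l < M) w l `^ q * H l <= C0 * W j `^ q * H j) ->
  (forall j, P j -> (a <= j < b)%N) ->
  forall M, lsum M (fun x => psum P e x `^ q) <=
    c * C0 * W a `^ q * H a / H b *
      \sum_(x <- Lv t b) (\sum_(j < b | P j) u j * `|e (anc t x j)|) `^ q.
Proof.
move=> C00 hW hP M; have q0 : 0 < q by rewrite (lt_le_trans ltr01 q1).
have c0 : 0 < c := lt_le_trans ltr01 c1.
pose F n x := (\sum_(j < n | P j) u j * `|e (anc t x j)|) `^ q.
have F0 n x : 0 <= F n x by exact: powR_ge0.
pose S := \sum_(x <- Lv t b) F b x.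
have S0 : 0 <= S by apply: sumr_ge0.
have sum0 n x : 0 <= \sum_(j < n | P j) u j * `|e (anc t x j)|.
  by apply: sumr_ge0 => j _; rewrite mulr_ge0 // ltW.
have psE l : \sum_(x <- Lv t l) psum P e x `^ q = w l `^ q * \sum_(x <- Lv t l) F l.+1 x.
  rewrite mulr_sumr big_seq [RHS]big_seq; apply: eq_bigr => x; rewrite mem_Lv => /eqP xl.
  by rewrite /psum xl powRM // ltW.
have lev_le l : \sum_(x <- Lv t l) psum P e x `^ q <=
    if (a <= l)%N then c / H b * S * (w l `^ q * H l) else 0.
  rewrite psE; case: leqP => [al|la]; last first.
    rewrite big1 ?mulr0 // => x _; rewrite /F big1 ?powR0 ?gt_eqF // => j Pj.
    have /andP[aj _] := hP _ Pj; have := ltn_ord j; rewrite ltnS => jl.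
    by have := leq_ltn_trans (leq_trans aj jl) la; rewrite ltnn.
  suff h : \sum_(x <- Lv t l) F l.+1 x <= c / H b * S * H l.
    by rewrite [leRHS]mulrCA; apply: ler_wpM2l => //; exact: powR_ge0.
  have [lb|bl] := ltnP l b.
    have h := @push_ge _ _ _ _ t (F l.+1) l b (F0 _) (ltnW lb).
    have h2 : \sum_(x <- Lv t b) F l.+1 (anc t x l) <= S.
      rewrite /S big_seq [leRHS]big_seq; apply: ler_sum => x; rewrite mem_Lv => /eqP xb.
      apply: ge0_ler_powR; rewrite ?nnegrE ?sum0 //; first exact: ltW.
      have -> : \sum_(j < l.+1 | P j) u j * `|e (anc t (anc t x l) j)| =
          \sum_(j < l.+1 | P j) u j * `|e (anc t x j)|.
        apply: eq_bigr => j _; rewrite anc_anc //; first by rewrite -ltnS.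
        by rewrite xb ltnW.
      rewrite (big_ord_widen_cond b P (fun j => u j * `|e (anc t x j)|) lb).
      rewrite [leRHS](bigID (fun j : 'I_b => (j < l.+1)%N)) /=.
      by rewrite lerDl; apply: sumr_ge0 => j _; rewrite mulr_ge0 // ltW.
    have h3 := le_trans h h2.
    have k0 : 0 < c^-1 * (H b / H l) by rewrite mulr_gt0 ?invr_gt0 // divr_gt0.
    rewrite -(ler_pM2l k0); apply: le_trans h3 _; apply: eqW.
    by field; rewrite !gt_eqF.
  have h := @push_le _ _ _ _ t (F b) b l (F0 _) bl.
  apply: (@le_trans _ _ (\sum_(x <- Lv t l) F b (anc t x b))); last first.
    by apply: le_trans h _; rewrite -/S; apply: eqW; field; rewrite gt_eqF.
  rewrite big_seq [leRHS]big_seq; apply: ler_sum => x; rewrite mem_Lv => /eqP xl.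
  apply: eqW; rewrite /F; congr (_ `^ _).
  rewrite (big_ord_widen_cond l.+1 P (fun j => u j * `|e (anc t (anc t x b) j)|)) //; last first.
    by rewrite (leq_trans bl).
  apply: eq_big => [j|j Pj].
    by apply/idP/andP => [Pj|[]//]; split => //; have /andP[] := hP _ Pj.
  by rewrite anc_anc ?xl //; have /andP[_ /ltnW] := hP _ Pj.
apply: (@le_trans _ _ (\sum_(l < M) if (a <= l)%N then c / H b * S * (w l `^ q * H l) else 0)).
  by apply: ler_sum => l _; exact: lev_le.
rewrite -big_mkcond /=.
have -> : \sum_(l < M | (a <= l)%N) c / H b * S * (w l `^ q * H l) =
   c / H b * S * \sum_(a <= l < M) (w l `^ q * H l).
  by rewrite mulr_sumr big_geq_mkord /=.
have p0 : 0 <= c / H b * S by rewrite !mulr_ge0 ?invr_ge0 // ltW.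
apply: le_trans (ler_wpM2l p0 (hW a M)) _; apply: eqW.
by rewrite -/S; field; rewrite gt_eqF.
Qed.

End OneTree.

Lemma sum_triangle (P : pred nat) (F : nat -> nat -> R) M :
  \sum_(l < M) \sum_(j < l.+1 | P j) F j l = \sum_(j < M | P j) \sum_(j <= l < M) F j l.
Proof.
transitivity (\sum_(l < M) \sum_(j < M | P j) (if (j <= l)%N then F j l else 0)).
  apply: eq_bigr => l _; rewrite (big_ord_widen_cond M P (F^~ l)) // -big_mkcondr /=.
  by apply: eq_bigl.
rewrite exchange_big /=; apply: eq_bigr => j _.
by rewrite -big_mkcond /= big_geq_mkord.
Qed.

(** When w ^ q H decays geometrically, the levels decouple: Jensen's inequality with
    the geometric weights exp (eps j) costs less than the decay. *)
Lemma psum_noncritical (nu : R) : nu < 0 -> rate lin nu (fun l => w l `^ q * H l) ->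
  exists2 C, 0 < C & forall (V : choiceType) (t : leveled c H V) (e : V -> R) (P : pred nat) M,
    lsum t M (fun x => psum t P e x `^ q) <=
    C * \sum_(j < M | P j) (u j * w j) `^ q * \sum_(y <- Lv t j) `|e y| `^ q.
Proof.
move=> nu0 wR; have q0 : 0 < q by rewrite (lt_le_trans ltr01 q1).
(* small enough for (q - 1) eps < - nu, so that a decay remains *)
pose eps := - nu / (2 * q); have eps0 : 0 < eps by rewrite divr_gt0 //; lra.
pose a j := expR (eps * lin j).
have aR : rate lin eps a := rate_gauge eps lin_homo.
have a0 j : 0 < a j by exact: expR_gt0.
have X0 : nu + (q - 1) * eps < 0.
  have -> : nu + (q - 1) * eps = nu * ((q + 1) / (2 * q)) by rewrite /eps; field; rewrite gt_eqF.
  by rewrite nmulr_rlt0 // divr_gt0; lra.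
have [C1 C10 hC1] := rate_sum_head eps0 aR.
have [C2 C20 hC2] := rate_sum_tail X0 (rateM wR (rate_powR (q - 1) aR)).
have c0 : 0 < c := lt_le_trans ltr01 c1.
exists (C1 `^ (q - 1) * c * C2) => [|V t e P M].
  by rewrite !mulr_gt0 // powR_gt0.
pose S j := \sum_(y <- Lv t j) `|e y| `^ q.
have S0 j : 0 <= S j by apply: sumr_ge0 => y _; exact: powR_ge0.
pose K j := a j `^ (1 - q) * u j `^ q * (S j / H j).
have K0 j : 0 <= K j by rewrite !mulr_ge0 ?powR_ge0 // ?invr_ge0 // ltW.
have lev_le l : \sum_(x <- Lv t l) psum t P e x `^ q <=
   \sum_(j < l.+1 | P j) C1 `^ (q - 1) * c * K j * (w l `^ q * H l * a l `^ (q - 1)).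
  have pw x : lev t x = l -> psum t P e x `^ q <= w l `^ q * C1 `^ (q - 1) * a l `^ (q - 1) *
     \sum_(j < l.+1 | P j) a j `^ (1 - q) * u j `^ q * `|e (anc t x j)| `^ q.
    move=> xl; rewrite /psum xl powRM ?(ltW (w0 _)) //; last first.
      by apply: sumr_ge0 => j _; rewrite mulr_ge0 // ltW.
    rewrite -!mulrA; apply: ler_wpM2l; first exact: powR_ge0.
    have -> : \sum_(j < l.+1 | P j) u j * `|e (anc t x j)| =
       \sum_(j < l.+1 | P j) a j * (u j * `|e (anc t x j)| / a j).
      by apply: eq_bigr => j _; rewrite [RHS]mulrC divfK // gt_eqF.
    apply: le_trans (power_mean _ q1 _ _) _.
    - by move=> j _; exact: ltW.
    - by move=> j _; rewrite divr_ge0 ?mulr_ge0 // ltW.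
    rewrite mulrA -powRM ?(ltW C10) ?(ltW (a0 _)) //.
    apply: ler_pM; rewrite ?powR_ge0 //.
    - by apply: sumr_ge0 => j _; rewrite mulr_ge0 ?powR_ge0 // ltW.
    - apply: ge0_ler_powR; rewrite ?nnegrE ?sumr_ge0 ?subr_ge0 //.
      + by move=> j _; exact: ltW.
      + by rewrite mulr_ge0 // ltW.
      + apply: le_trans (hC1 l); rewrite [leRHS](bigID (fun j : 'I_l.+1 => P j)) /= lerDl.
        by apply: sumr_ge0 => j _; exact: ltW.
    apply: ler_sum => j _; apply: eqW.
    rewrite !powRM ?mulr_ge0 ?invr_ge0 ?(ltW (u0 _)) ?(ltW (a0 _)) //.
    have -> : a j `^ (1 - q) = a j * (a j)^-1 `^ q.
      rewrite -powR_inv1 ?(ltW (a0 _)) // -powRrM mulN1r -{2}(powRr1 (ltW (a0 j))) -powRD //.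
      by rewrite (gt_eqF (a0 j)) implybT.
    ring.
  apply: (@le_trans _ _ (\sum_(x <- Lv t l) w l `^ q * C1 `^ (q - 1) * a l `^ (q - 1) *
     \sum_(j < l.+1 | P j) a j `^ (1 - q) * u j `^ q * `|e (anc t x j)| `^ q)).
    by rewrite big_seq [leRHS]big_seq; apply: ler_sum => x; rewrite mem_Lv => /eqP; exact: pw.
  rewrite -mulr_sumr exchange_big /= mulr_sumr; apply: ler_sum => j _.
  rewrite -mulr_sumr.
  have jl : (j <= l)%N by rewrite -ltnS.
  have h := @push_le _ _ _ _ t (fun y => `|e y| `^ q) j l (fun=> powR_ge0 _ _) jl.
  have p0 : 0 <= w l `^ q * C1 `^ (q - 1) * a l `^ (q - 1) * (a j `^ (1 - q) * u j `^ q).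
    by rewrite !mulr_ge0 ?powR_ge0.
  rewrite mulrA; apply: le_trans (ler_wpM2l p0 h) _; apply: eqW; rewrite /K -/(S j).
  by field; rewrite gt_eqF.
apply: (@le_trans _ _ (\sum_(l < M) \sum_(j < l.+1 | P j)
    C1 `^ (q - 1) * c * K j * (w l `^ q * H l * a l `^ (q - 1)))).
  by apply: ler_sum => l _; exact: lev_le.
rewrite (sum_triangle P (fun j l => C1 `^ (q - 1) * c * K j * (w l `^ q * H l * a l `^ (q - 1)))).
rewrite mulr_sumr; apply: ler_sum => j _; rewrite -mulr_sumr.
have p0 : 0 <= C1 `^ (q - 1) * c * K j by apply: mulr_ge0 => //; rewrite mulr_ge0 ?powR_ge0 // ltW.
apply: le_trans (ler_wpM2l p0 (hC2 j M)) _; apply: eqW.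
rewrite /K -/(S j) powRM ?(ltW (u0 _)) ?(ltW (w0 _)) //.
have -> : a j `^ (1 - q) = (a j `^ (q - 1))^-1 by rewrite -powRN opprB.
by field; rewrite !gt_eqF // powR_gt0.
Qed.

End Operator.

(** * Balls, levels and blocks of levels *)

Section Blocks.
Context {R : realType} (c : R) (H : nat -> R).

Section OneTree.
Context (V : choiceType) (t : leveled c H V).
Implicit Types (e f : V -> R) (P : pred nat).

Definition level_union (M : nat) (P : pred nat) : seq V :=
  flatten [seq Lv t j | j <- iota 0 M & P j].

Lemma big_level_union M P (F : V -> R) :
  \sum_(x <- level_union M P) F x = \sum_(j < M | P j) \sum_(x <- Lv t j) F x.
Proof.
rewrite /level_union big_flatten big_map big_filter.
by rewrite -(big_mkord P (fun j => \sum_(x <- Lv t j) F x)) /index_iota subn0.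
Qed.

Lemma mem_level_union M P x : (x \in level_union M P) = ((lev t x < M)%N && P (lev t x)).
Proof.
apply/flattenP/andP => [[s /mapP[j]]|[xM Px]].
  rewrite mem_filter mem_iota add0n => /andP[Pj /andP[_ jM]] ->.
  by rewrite mem_Lv => /eqP ->.
exists (Lv t (lev t x)); last by rewrite mem_Lv.
by apply/mapP; exists (lev t x); rewrite // mem_filter mem_iota Px.
Qed.

Lemma level_union_uniq M P : uniq (level_union M P).
Proof.
rewrite /level_union; have : uniq [seq j <- iota 0 M | P j] by rewrite filter_uniq ?iota_uniq.
elim: [seq j <- iota 0 M | P j] => //= j s IH /andP[js us].
rewrite cat_uniq Lv_uniq IH // andbT /=; apply/hasPn => x /flattenP[s' /mapP[k ks ->]].
rewrite mem_Lv /= mem_Lv => /eqP xk; apply: contra js => /eqP <-.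
by rewrite xk.
Qed.

(** The unit ball of l_p expressed by finite sums over levels. *)
Definition in_ball (p : \bar R) (f : V -> R) : Prop :=
  match p with
  | r%:E => forall M, lsum t M (fun x => `|f x| `^ r) <= 1
  | _ => forall x, `|f x| <= 1
  end.

Lemma in_ball_le1 p f x : (1 < p)%E -> in_ball p f -> `|f x| <= 1.
Proof.
case: p => [r| |] //= r1 h.
have r0 : 0 < r by move: r1; rewrite lte_fin => r1; lra.
have h1 : `|f x| `^ r <= 1.
  apply: le_trans (h (lev t x).+1); rewrite /lsum (bigD1 ord_max) //=.
  rewrite (bigD1_seq x) ?Lv_uniq ?mem_Lv //= -addrA lerDl addr_ge0 ?sumr_ge0 // => *;
    rewrite ?powR_ge0 // sumr_ge0 // => *; exact: powR_ge0.
rewrite leNgt; apply/negP => fx.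
have := @gt0_ltr_powR R r r0 1 `|f x|; rewrite !nnegrE ler01 normr_ge0 => /(_ isT isT fx).
by rewrite powR1 ltNge h1.
Qed.

Lemma in_ball_sub p e f : (1 < p)%E -> (forall x, `|e x| <= `|f x|) ->
  in_ball p f -> in_ball p e.
Proof.
case: p => [r| |] //= r1 ef h; last by move=> x; exact: le_trans (ef x) (h x).
move=> M; apply: le_trans (h M); apply: ler_lsum => x _.
by apply: ge0_ler_powR; rewrite ?nnegrE //; move: r1; rewrite lte_fin => r1; lra.
Qed.

Lemma in_ball_level_union (r : R) f M P : in_ball r%:E f ->
  \sum_(x <- level_union M P) `|f x| `^ r <= 1.
Proof.
move=> h; apply: le_trans (h M); rewrite big_level_union /lsum.
rewrite [leRHS](bigID (fun j : 'I_M => P j)) /= lerDl.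
by apply: sumr_ge0 => j _; apply: sumr_ge0 => x _; exact: powR_ge0.
Qed.

End OneTree.

Hypotheses (c1 : 1 <= c) (H0 : forall j, 0 < H j).

(** Hoelder's inequality on the vertices of the levels in [P], where each vertex of
    level [j] has the weight 1 / H_j, so that every level has mass about 1. *)
Lemma block_holder (r : R) (p : \bar R) : 1 <= r -> (r%:E <= p)%E ->
  exists2 C, 0 < C & forall (V : choiceType) (t : leveled c H V) (e : V -> R) M (P : pred nat),
   in_ball t p e ->
   \sum_(j < M | P j) H j `^ (r * fine p^-1%E - 1) * \sum_(x <- Lv t j) `|e x| `^ r <=
   C * (\sum_(j < M | P j) 1) `^ (1 - r * fine p^-1%E).
Proof.
move=> r1 rp; have r0 : 0 < r by lra.
have c0 : 0 < c := lt_le_trans ltr01 c1.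
have K0 : 0 < c / H 0 by rewrite divr_gt0.
exists ((c / H 0) `^ (1 - r * fine p^-1%E)) => [|V t e M P eB]; first exact: powR_gt0.
have n0 : 0 <= \sum_(j < M | P j) (1 : R) by exact: sumr_ge0.
pose om x := (H (lev t x))^-1.
have A_le : \sum_(x <- level_union t M P) om x <= c / H 0 * \sum_(j < M | P j) 1.
  rewrite big_level_union mulr_sumr; apply: ler_sum => j _.
  have -> : \sum_(x <- Lv t j) om x = (H j)^-1 * (size (Lv t j))%:R.
    rewrite -sum1_size natr_sum mulr_sumr big_seq [RHS]big_seq; apply: eq_bigr => x.
    by rewrite mem_Lv mulr1 => /eqP <-.
  have /andP[_ h] := size_Lv t j; rewrite mulr1 mulrC ler_pdivrMr //.
  by apply: le_trans h _; apply: eqW; ring.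
have A0 : 0 <= \sum_(x <- level_union t M P) om x.
  by apply: sumr_ge0 => x _; rewrite invr_ge0 ltW.
rewrite -powRM //; last exact: ltW.
case: p rp eB => [s| |] //= rp eB; last first.
  rewrite mulr0 subr0 sub0r powRr1; last by apply: mulr_ge0 => //; exact: ltW.
  apply: le_trans A_le.
  rewrite big_level_union; apply: ler_sum => j _; rewrite mulr_sumr big_seq [leRHS]big_seq.
  apply: ler_sum => x; rewrite mem_Lv => /eqP xj.
  rewrite /om xj powR_inv1 ?(ltW (H0 _)) // ler_piMr ?invr_ge0 ?(ltW (H0 _)) //.
  have p1 : 1 `^ r = 1 :> R by rewrite powR1.
  by rewrite -p1; apply: ge0_ler_powR; rewrite ?nnegrE //; exact: ltW.
have rs : r <= s by rewrite -lee_fin.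
have s0 : 0 < s by lra.
have sg1 : 1 <= s / r by rewrite ler_pdivlMr ?mul1r.
have sg0 : 0 < s / r by lra.
rewrite inver (gt_eqF s0) /=.
pose y x := H (lev t x) `^ (r / s) * `|e x| `^ r.
set Y := (X in X <= _).
have YE : Y = \sum_(x <- level_union t M P) om x * y x.
  rewrite big_level_union; apply: eq_bigr => j _; rewrite mulr_sumr big_seq [RHS]big_seq.
  apply: eq_bigr => x; rewrite mem_Lv => /eqP xj; rewrite /om /y xj mulrA; congr (_ * _).
  rewrite powRD; last by rewrite (gt_eqF (H0 _)) implybT.
  by rewrite powR_inv1 ?(ltW (H0 _)) // mulrC.
have y0 x : 0 <= y x by rewrite mulr_ge0 ?powR_ge0.
have Y0 : 0 <= Y by rewrite YE; apply: sumr_ge0 => x _; rewrite mulr_ge0 // invr_ge0 ltW.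
have h : Y `^ (s / r) <= (c / H 0 * \sum_(j < M | P j) 1) `^ (s / r - 1).
  rewrite YE; apply: le_trans (power_mean _ sg1 _ _) _ => //.
    by move=> x _; rewrite invr_ge0 ltW.
  rewrite -[leRHS]mulr1; apply: ler_pM; rewrite ?powR_ge0 //.
  - by apply: sumr_ge0 => x _; rewrite mulr_ge0 ?powR_ge0 // invr_ge0 ltW.
  - apply: ge0_ler_powR => //; rewrite ?nnegrE //; first lra.
    by apply: mulr_ge0 => //; exact: ltW.
  apply: le_trans (in_ball_level_union M P eB); apply: ler_sum => x _; apply: eqW.
  rewrite /om /y powRM ?powR_ge0 // -!powRrM.
  have -> : r / s * (s / r) = 1 by field; rewrite !gt_eqF.
  have -> : r * (s / r) = s by field; rewrite gt_eqF.
  by rewrite powRr1 ?(ltW (H0 _)) // mulrA mulVf ?mul1r // gt_eqF.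
have -> : 1 - r / s = (s / r - 1) * (s / r)^-1 by field; rewrite !gt_eqF.
rewrite powRrM -[leLHS](powRr1 Y0) -[X in Y `^ X](@divff _ (s / r)) ?gt_eqF // powRrM.
by apply: ge0_ler_powR; rewrite ?nnegrE ?powR_ge0 ?invr_ge0 // ltW.
Qed.

Lemma level_holder (r : R) (p : \bar R) : 1 <= r -> (r%:E <= p)%E ->
  exists2 C, 0 < C & forall (V : choiceType) (t : leveled c H V) (e : V -> R) j,
   in_ball t p e -> \sum_(x <- Lv t j) `|e x| `^ r <= C * H j `^ (1 - r * fine p^-1%E).
Proof.
move=> r1 rp; have [C C0 hC] := block_holder r1 rp; exists C => // V t e j eB.
have := hC V t e j.+1 (pred1 j) eB.
have E1 (F : nat -> R) : \sum_(i < j.+1 | pred1 j i) F i = F j.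
  by rewrite (big_pred1 ord_max) // => i; rewrite /= -(inj_eq val_inj).
rewrite (E1 (fun=> 1)) (E1 (fun i => H i `^ (r * fine p^-1%E - 1) *
  \sum_(x <- Lv t i) `|e x| `^ r)).
rewrite powR1 mulr1 /= => h.
have hp : 0 < H j `^ (1 - r * fine p^-1%E) by exact: powR_gt0.
rewrite -(ler_pM2l (_ : 0 < H j `^ (r * fine p^-1%E - 1))) ?powR_gt0 //.
apply: le_trans h _; rewrite mulrCA -powRD ?(gt_eqF (H0 _)) ?implybT //.
by rewrite subrKA subrr powRr0 mulr1.
Qed.

(** A geometric sequence is comparable with its largest term on any set of indices. *)
Lemma rate_sum_bounded (k : R) (X : nat -> R) : k != 0 -> rate lin k X -> exists2 C, 0 < C &
  forall b (Q : pred nat) Y, 0 <= Y -> (forall j, (j < b)%N -> Q j -> X j <= Y) ->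
  \sum_(j < b | Q j) X j <= C * Y.
Proof.
move=> k0 XR; have X0 := XR.1.
case: (ltgtP k 0) k0 => // kk _.
  have [C C0 hC] := rate_sum_tail kk XR; exists C => // b Q Y Y0 hY.
  have [/existsP[j0 Qj0]|/existsPn nQ] := boolP [exists j : 'I_b, Q j]; last first.
    by rewrite big1 ?mulr_ge0 ?(ltW C0) // => j Qj; have := nQ j; rewrite Qj.
  case: (@arg_minnP _ j0 (fun j : 'I_b => Q j) (fun j => j : nat) Qj0) => J QJ Jmin.
  apply: (@le_trans _ _ (\sum_(J <= j < b) X j)); last first.
    by apply: le_trans (hC _ _) _; apply: ler_wpM2l; [exact: ltW|exact: hY].
  rewrite big_geq_mkord [leRHS](bigID (fun j : 'I_b => Q j)) /=.
  have E1 : \sum_(i < b | (J <= i)%N && Q i) X i = \sum_(j < b | Q j) X j.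
    by apply: eq_bigl => j; apply: andb_idl; exact: Jmin.
  by rewrite E1 lerDl; apply: sumr_ge0 => j _; exact: ltW.
have [C C0 hC] := rate_sum_head kk XR; exists C => // b Q Y Y0 hY.
have [/existsP[j0 Qj0]|/existsPn nQ] := boolP [exists j : 'I_b, Q j]; last first.
  by rewrite big1 ?mulr_ge0 ?(ltW C0) // => j Qj; have := nQ j; rewrite Qj.
case: (@arg_maxnP _ j0 (fun j : 'I_b => Q j) (fun j => j : nat) Qj0) => J QJ Jmax.
apply: (@le_trans _ _ (\sum_(j < J.+1) X j)); last first.
  by apply: le_trans (hC _) _; apply: ler_wpM2l; [exact: ltW|exact: hY].
rewrite (big_ord_widen b X (ltn_ord J)) [leRHS](bigID (fun j : 'I_b => Q j)) /=.
have E1 : \sum_(i < b | (i < J.+1)%N && Q i) X i = \sum_(j < b | Q j) X j.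
  by apply: eq_bigl => j; apply: andb_idl; exact: Jmax.
by rewrite E1 lerDl; apply: sumr_ge0 => j _; exact: ltW.
Qed.

(** The z_j are bounded by [delta] and by (G / H_j) ^ (1 / p).  The first bound is used
    while H_j <= G delta ^ - p and the second one afterwards: both sums are geometric
    and dominated by the common value at the threshold. *)
Lemma threshold_sum (k p q : R) : 0 < k -> rate lin k H -> 1 <= p -> p < q ->
  exists2 C, 0 < C & forall b (Q : pred nat) (z : nat -> R) (delta G : R),
    0 < delta -> 0 <= G -> (forall j, (j < b)%N -> Q j -> [/\ 0 <= z j, z j <= delta & H j * z j `^ p <= G]) ->
    \sum_(j < b | Q j) H j `^ q^-1 * z j <= C * (delta `^ (1 - p / q) * G `^ q^-1).
Proof.
move=> k0 HR p1 pq; have p0 : 0 < p by lra.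
have q0 : 0 < q by lra.
have Hp := rate_powR q^-1 HR; have Hm := rate_powR (q^-1 - p^-1) HR.
have kp : q^-1 * k != 0 by rewrite gt_eqF // mulr_gt0 ?invr_gt0.
have qp : q^-1 - p^-1 < 0 by rewrite subr_lt0 ltf_pV2.
have km : (q^-1 - p^-1) * k != 0 by rewrite lt_eqF // nmulr_rlt0.
have [C1 C10 h1] := rate_sum_bounded kp Hp; have [C2 C20 h2] := rate_sum_bounded km Hm.
exists (C1 + C2) => [|b Q z d G d0 G0 hz]; first lra.
have [G00|Gn0] := eqVneq G 0.
  rewrite big1 ?mulr_ge0 ?powR_ge0 //; first lra.
  move=> j Qj; have [z0 _ hG] := hz j (ltn_ord j) Qj.
  have : z j `^ p <= 0 by rewrite -(pmulr_rle0 _ (H0 j)) -G00.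
  move=> hz0; have /eqP : z j `^ p = 0 by apply/le_anti; rewrite hz0 powR_ge0.
  by rewrite powR_eq0 => /andP[/eqP -> _]; rewrite mulr0.
have Gp : 0 < G by rewrite lt_neqAle eq_sym Gn0.
(* the value of H at which the two bounds on z agree *)
pose X := G * d `^ (- p); have X0 : 0 < X by rewrite mulr_gt0 ?powR_gt0.
have dp r : X `^ r = G `^ r * d `^ (- p * r).
  by rewrite powRM ?powR_ge0 ?(ltW Gp) // -powRrM.
rewrite (bigID (fun j : 'I_b => H j <= X)) /= mulrDl; apply: lerD.
  apply: (@le_trans _ _ (d * \sum_(j < b | Q j && (H j <= X)) H j `^ q^-1)).
    rewrite mulr_sumr; apply: ler_sum => j /andP[Qj _]; rewrite mulrC.
    by apply: ler_wpM2r; [exact: powR_ge0|case: (hz j (ltn_ord j) Qj)].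
  have := h1 b (fun j => Q j && (H j <= X)) (X `^ q^-1) (powR_ge0 _ _).
  move=> /(_ _)/(ler_wpM2l (ltW d0)) h; apply: le_trans (h _) _.
    by move=> j _ /andP[_ jX]; apply: ge0_ler_powR; rewrite ?nnegrE ?invr_ge0 // ltW.
  apply: eqW; rewrite dp mulrCA; congr (_ * _); rewrite mulrCA mulrC; congr (_ * _).
  rewrite -{1}(powRr1 (ltW d0)) -powRD; last by rewrite (gt_eqF d0) implybT.
  by rewrite mulNr.
apply: (@le_trans _ _ (G `^ p^-1 * \sum_(j < b | Q j && ~~ (H j <= X)) H j `^ (q^-1 - p^-1))).
  rewrite mulr_sumr; apply: ler_sum => j /andP[Qj _].
  have [z0 _ hG] := hz j (ltn_ord j) Qj.
  rewrite powRB; last by rewrite (gt_eqF (H0 _)) implybT.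
  rewrite [leRHS]mulrCA; apply: ler_wpM2l; first exact: powR_ge0.
  rewrite ler_pdivlMr ?powR_gt0 // mulrC -[X in _ * X](powRr1 z0) -[X in z j `^ X](@divff _ p) ?gt_eqF //.
  rewrite powRrM -powRM ?powR_ge0 ?(ltW (H0 _)) //; apply: ge0_ler_powR => //.
  - by rewrite invr_ge0 ltW.
  - by rewrite nnegrE mulr_ge0 ?powR_ge0 // ltW.
have := h2 b (fun j => Q j && ~~ (H j <= X)) (X `^ (q^-1 - p^-1)) (powR_ge0 _ _).
move=> /(_ _)/(ler_wpM2l (powR_ge0 G p^-1)) h; apply: le_trans (h _) _.
  move=> j _ /andP[_]; rewrite -ltNge => jX.
  have -> : q^-1 - p^-1 = - (p^-1 - q^-1) by ring.
  rewrite !powRN lef_pV2 ?posrE ?powR_gt0 //.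
  by apply: ge0_ler_powR; rewrite ?nnegrE ?(ltW (H0 _)) ?(ltW X0) ?(ltW jX) //; lra.
apply: eqW; rewrite dp mulrCA; congr (_ * _); rewrite mulrCA mulrA -powRD; last by rewrite (gt_eqF Gp) implybT.
rewrite subrK mulrC; congr (_ * _); congr (_ `^ _); field; rewrite !gt_eqF //.
Qed.

End Blocks.

Section BlockBounds.
Context {R : realType} (c : R) (H : nat -> R) (q : R) (u w : nat -> R).
Hypotheses (c1 : 1 <= c) (H0 : forall j, 0 < H j) (q1 : 1 <= q).
Hypotheses (u0 : forall j, 0 < u j) (w0 : forall j, 0 < w j).

(** For a + 1 <= b <= 2 (a + 1) this is a dyadic block of levels. *)
Definition block (a b : nat) : pred nat := fun j => (a <= j < b)%N.

Lemma count_block a b M : \sum_(j < M | block a b j) (1 : R) <= b%:R.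
Proof.
rewrite (big_ord_widen_cond (maxn M b) (block a b) (fun=> 1)) ?leq_maxl //.
apply: (@le_trans _ _ (\sum_(j < maxn M b | (j < b)%N) 1)).
  rewrite [leRHS](bigID (fun j : 'I_(maxn M b) => block a b j && (j < M)%N)) /=.
  set X := \sum_(i < _ | block _ _ _ && _) _; set Y := \sum_(i < _ | _ && _) 1.
  suff -> : X = Y by rewrite lerDl; apply: sumr_ge0.
  apply: eq_bigl => j; apply: esym; apply: andb_idl => /andP[/andP[_ ->]] //.
by rewrite -(big_ord_widen (maxn M b) (fun=> 1)) ?leq_maxr // big_const_ord iter_addr_0.
Qed.

Lemma powR_absorb (C X : R) : 0 < C -> 0 <= X -> C * X `^ q = (C `^ q^-1 * X) `^ q.
Proof.
move=> C0 X0; have q0 : 0 < q := lt_le_trans ltr01 q1.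
by rewrite powRM ?powR_ge0 // -powRrM mulVf ?gt_eqF // powRr1 // ltW.
Qed.

Lemma ler_powr (x y r : R) : 0 <= r -> 0 <= x -> x <= y -> x `^ r <= y `^ r.
Proof.
by move=> r0 x0 xy; apply: ge0_ler_powR; rewrite ?nnegrE // (le_trans x0).
Qed.

(** The levels decouple and Hoelder's inequality is applied to the whole block at once,
    which produces the power 1 / q - 1 / p of its length. *)
Lemma block_ge_noncritical (nu k : R) (p : \bar R) : (q%:E <= p)%E ->
  nu < 0 -> rate lin nu (fun l => w l `^ q * H l) ->
  rate lg k (fun j => u j * w j * H j `^ (q^-1 - fine p^-1%E)) ->
  0 <= 1 - q * fine p^-1%E ->
  exists2 C, 0 < C & forall (V : choiceType) (t : leveled c H V) (e : V -> R) a b M,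
    in_ball t p e -> (b <= 2 * a.+1)%N ->
    lsum t M (fun x => psum u w t (block a b) e x `^ q) <=
    (C * (u a * w a * H a `^ (q^-1 - fine p^-1%E) * a.+1%:R `^ (q^-1 - fine p^-1%E))) `^ q.
Proof.
move=> qp nu0 wR DR pq; have q0 : 0 < q := lt_le_trans ltr01 q1.
set ip := fine p^-1%E in DR pq *.
pose D j := u j * w j * H j `^ (q^-1 - ip).
have D0 j : 0 < D j by rewrite !mulr_gt0 // powR_gt0.
have [C1 C10 h1] := psum_noncritical c1 H0 q1 u0 w0 nu0 wR.
have [C2 C20 h2] := block_holder c1 H0 q1 qp.
have DE : forall j, D j = u j * w j * H j `^ (q^-1 - ip) := fun=> erefl.
have [C3 C30 h3] : exists2 C, 0 < C & forall i j, (i <= j)%N -> (j.+1 <= 2 * i.+1)%N ->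
  D j <= C * D i /\ D i <= C * D j := rate_block 2 DR.
clearbody D.
exists ((C1 * C3 `^ q * C2 * 2 `^ (1 - q * ip)) `^ q^-1) => [|V t e a b M eB ab].
  by rewrite powR_gt0 // !mulr_gt0 ?powR_gt0.
rewrite -DE -powR_absorb; first last.
- by rewrite !mulr_ge0 ?powR_ge0 // ltW.
- by rewrite !mulr_gt0 ?powR_gt0.
apply: le_trans (h1 V t e (block a b) M) _.
rewrite -!mulrA; apply: ler_wpM2l; first exact: ltW.
apply: (@le_trans _ _ ((C3 * D a) `^ q *
   \sum_(j < M | block a b j) H j `^ (q * ip - 1) * \sum_(y <- Lv t j) `|e y| `^ q)).
  rewrite mulr_sumr; apply: ler_sum => j /andP[aj jb].
  have -> : (u j * w j) `^ q = D j `^ q * H j `^ (q * ip - 1).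
    rewrite DE [in RHS]powRM ?powR_ge0 ?mulr_ge0 ?(ltW (u0 _)) ?(ltW (w0 _)) //.
    rewrite -mulrA -powRrM -powRD; last by rewrite (gt_eqF (H0 _)) implybT.
    have -> : (q^-1 - ip) * q + (q * ip - 1) = 0 by field; rewrite gt_eqF.
    by rewrite powRr0 mulr1.
  rewrite mulrA; apply: ler_wpM2r; first by apply: sumr_ge0 => y _; exact: powR_ge0.
  apply: ler_wpM2r; first exact: powR_ge0.
  apply: ler_powr; [exact: ltW|exact: ltW|].
  by have [] := h3 a j aj (leq_trans jb ab).
rewrite (powRM _ (ltW C30) (ltW (D0 a))) -mulrA; apply: ler_wpM2l; first exact: powR_ge0.
have := h2 V t e M (block a b) eB; rewrite -/ip => h.
apply: le_trans (ler_wpM2l (powR_ge0 _ _) h) _.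
rewrite mulrCA; apply: ler_wpM2l; first exact: ltW.
rewrite (powRM _ (ltW (D0 a)) (powR_ge0 _ _)) [leRHS]mulrCA; apply: ler_wpM2l; first exact: powR_ge0.
have -> : (a.+1%:R `^ (q^-1 - ip)) `^ q = a.+1%:R `^ (1 - q * ip).
  by rewrite -powRrM; congr (_ `^ _); field; rewrite gt_eqF.
rewrite -powRM //; apply: ge0_ler_powR => //; rewrite ?nnegrE ?mulr_ge0 ?sumr_ge0 //.
by apply: le_trans (count_block _ _ _) _; rewrite -natrM ler_nat.
Qed.

(** The path sum over the block is first bounded by Jensen's inequality, at the cost
    of the power 1 - 1 / q of the length of the block. *)
Lemma block_ge_critical (W : nat -> R) (C0 k : R) (p : \bar R) : (q%:E <= p)%E ->
  0 < C0 -> (forall j, 0 < W j) ->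
  (forall j M, \sum_(j <= l < M) w l `^ q * H l <= C0 * W j `^ q * H j) ->
  rate lg k (fun j => u j * H j `^ (- fine p^-1%E)) ->
  0 <= 1 - q * fine p^-1%E ->
  exists2 C, 0 < C & forall (V : choiceType) (t : leveled c H V) (e : V -> R) a b M,
    in_ball t p e -> (b <= 2 * a.+1)%N ->
    lsum t M (fun x => psum u w t (block a b) e x `^ q) <=
    (C * (u a * W a * H a `^ (q^-1 - fine p^-1%E) * a.+1%:R `^ (1 - fine p^-1%E))) `^ q.
Proof.
move=> qp C00 W0 hW vR pq; have q0 : 0 < q := lt_le_trans ltr01 q1.
have c0 : 0 < c := lt_le_trans ltr01 c1.
set ip := fine p^-1%E in vR pq *.
pose v j := u j * H j `^ (- ip).
have v0 j : 0 < v j by rewrite !mulr_gt0 // powR_gt0.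
have [C2 C20 h2] := block_holder c1 H0 q1 qp.
have vE : forall j, v j = u j * H j `^ (- ip) := fun=> erefl.
have [C3 C30 h3] : exists2 C, 0 < C & forall i j, (i <= j)%N -> (j.+1 <= 2 * i.+1)%N ->
  v j <= C * v i /\ v i <= C * v j := rate_block 2 vR.
clearbody v.
exists ((c * C0 * (C3 `^ q * c * C2) * 2 `^ (q - 1) * 2 `^ (1 - q * ip)) `^ q^-1) => [|V t e a b M eB ab].
  by rewrite powR_gt0 // !mulr_gt0 ?powR_gt0.
rewrite -powR_absorb; first last.
- by rewrite !mulr_ge0 ?powR_ge0 // ltW.
- by rewrite !mulr_gt0 ?powR_gt0.
apply: le_trans (psum_critical c1 H0 q1 u0 w0 t e (ltW C00) hW (P := block a b) (fun j h => h) M) _.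
pose n : R := \sum_(j < b | block a b j) 1.
have n0 : 0 <= n by exact: sumr_ge0.
have nab : n <= 2 * a.+1%:R.
  by apply: le_trans (count_block _ _ _) _; rewrite -natrM ler_nat.
have pw x : (\sum_(j < b | block a b j) u j * `|e (anc t x j)|) `^ q <=
   n `^ (q - 1) * (C3 * v a) `^ q * \sum_(j < b | block a b j) H j `^ (q * ip) * `|e (anc t x j)| `^ q.
  have -> : \sum_(j < b | block a b j) u j * `|e (anc t x j)| =
     \sum_(j < b | block a b j) 1 * (u j * `|e (anc t x j)|).
    by apply: eq_bigr => j _; rewrite mul1r.
  apply: le_trans (power_mean _ q1 _ _) _ => //.
    by move=> j _; rewrite mulr_ge0 // ltW.
  rewrite -/n -mulrA; apply: ler_wpM2l; first exact: powR_ge0.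
  rewrite mulr_sumr; apply: ler_sum => j /andP[aj jb]; rewrite mul1r mulrA.
  rewrite powRM ?(ltW (u0 _)) //; apply: ler_wpM2r; first exact: powR_ge0.
  have -> : H j `^ (q * ip) = (H j `^ ip) `^ q by rewrite -powRrM mulrC.
  rewrite -powRM ?mulr_ge0 ?powR_ge0 ?(ltW C30) ?(ltW (v0 _)) //.
  apply: ler_powr; [exact: ltW|exact: ltW|].
  have -> : u j = v j * H j `^ ip.
    by rewrite vE powRN divfK // gt_eqF // powR_gt0.
  apply: ler_wpM2r; first exact: powR_ge0.
  by have [] := h3 a j aj (leq_trans jb ab).
have S_le : \sum_(x <- Lv t b) (\sum_(j < b | block a b j) u j * `|e (anc t x j)|) `^ q <=
  n `^ (q - 1) * (C3 * v a) `^ q * (c * H b * (C2 * n `^ (1 - q * ip))).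
  apply: (@le_trans _ _ (\sum_(x <- Lv t b) n `^ (q - 1) * (C3 * v a) `^ q *
      \sum_(j < b | block a b j) H j `^ (q * ip) * `|e (anc t x j)| `^ q)).
    by apply: ler_sum => x _; exact: pw.
  rewrite -mulr_sumr; apply: ler_wpM2l; first by rewrite mulr_ge0 ?powR_ge0.
  rewrite exchange_big /=; have := h2 V t e b (block a b) eB; rewrite -/ip => h.
  apply: le_trans (ler_wpM2l (_ : 0 <= c * H b) h); last by rewrite mulr_ge0 // ltW.
  rewrite mulr_sumr; apply: ler_sum => j /andP[aj jb]; rewrite -mulr_sumr.
  have := @push_le _ _ _ _ t (fun y => `|e y| `^ q) j b (fun=> powR_ge0 _ _) (ltnW jb).
  move=> /(ler_wpM2l (powR_ge0 (H j) (q * ip))) h'; apply: le_trans h' _; apply: eqW.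
  rewrite powRB; last by rewrite (gt_eqF (H0 _)) implybT.
  by rewrite (powRr1 (ltW (H0 _))); field; rewrite gt_eqF.
have K0 : 0 <= c * C0 * W a `^ q * H a / H b.
  by rewrite !mulr_ge0 ?powR_ge0 ?invr_ge0 // ltW.
apply: le_trans (ler_wpM2l K0 S_le) _.
have -> : (u a * W a * H a `^ (q^-1 - ip) * a.+1%:R `^ (1 - ip)) `^ q =
   v a `^ q * W a `^ q * H a * (a.+1%:R `^ (q - 1) * a.+1%:R `^ (1 - q * ip)).
  rewrite -powRD // ?pnatr_eq0 ?implybT // -[in RHS](powRr1 (ltW (H0 a))).
  rewrite vE !powRM ?mulr_ge0 ?powR_ge0 ?(ltW (u0 _)) ?(ltW (W0 _)) // -!powRrM.
  have -> : (q^-1 - ip) * q = - ip * q + 1 by field; rewrite gt_eqF.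
  rewrite (@powRD _ (H a)); last by rewrite (gt_eqF (H0 _)) implybT.
  have -> : (1 - ip) * q = q - 1 + (1 - q * ip) by ring.
  ring.
have hn1 : n `^ (q - 1) <= 2 `^ (q - 1) * a.+1%:R `^ (q - 1).
  by rewrite -powRM //; apply: ge0_ler_powR; rewrite ?nnegrE ?mulr_ge0 ?subr_ge0.
have hn2 : n `^ (1 - q * ip) <= 2 `^ (1 - q * ip) * a.+1%:R `^ (1 - q * ip).
  by rewrite -powRM //; apply: ge0_ler_powR; rewrite ?nnegrE ?mulr_ge0.
have hn : n `^ (q - 1) * n `^ (1 - q * ip) <=
    (2 `^ (q - 1) * a.+1%:R `^ (q - 1)) * (2 `^ (1 - q * ip) * a.+1%:R `^ (1 - q * ip)).
  by apply: ler_pM; rewrite ?powR_ge0.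
pose Z := c * C0 * W a `^ q * H a * (C3 `^ q * v a `^ q) * c * C2.
have Z0 : 0 <= Z by rewrite !mulr_ge0 ?powR_ge0 // ltW.
have := ler_wpM2l Z0 hn; rewrite /Z (powRM _ (ltW C30) (ltW (v0 a))) => h.
apply: le_trans (le_trans _ h) _; last by apply: eqW; ring.
by apply: eqW; field; rewrite gt_eqF.
Qed.

(** The bound by [delta] converts l_q norms into l_p norms. *)
Lemma block_lt_noncritical (nu k p : R) : 1 < p -> p < q ->
  nu < 0 -> rate lin nu (fun l => w l `^ q * H l) ->
  rate lg k (fun j => u j * w j) ->
  exists2 C, 0 < C & forall (V : choiceType) (t : leveled c H V) (e : V -> R) a b M delta,
    in_ball t p%:E e -> (b <= 2 * a.+1)%N -> 0 < delta ->
    (forall x, block a b (lev t x) -> `|e x| <= delta) ->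
    lsum t M (fun x => psum u w t (block a b) e x `^ q) <=
    (C * (u a * w a * delta `^ (1 - p / q))) `^ q.
Proof.
move=> p1 pq nu0 wR DR; have q0 : 0 < q := lt_le_trans ltr01 q1.
pose D j := u j * w j.
have D0 j : 0 < D j by rewrite !mulr_gt0 // powR_gt0.
have [C1 C10 h1] := psum_noncritical c1 H0 q1 u0 w0 nu0 wR.
have DE : forall j, D j = u j * w j := fun=> erefl.
have [C3 C30 h3] : exists2 C, 0 < C & forall i j, (i <= j)%N -> (j.+1 <= 2 * i.+1)%N ->
  D j <= C * D i /\ D i <= C * D j := rate_block 2 DR.
clearbody D.
exists ((C1 * C3 `^ q) `^ q^-1) => [|V t e a b M d eB ab d0 ed].
  by rewrite powR_gt0 // !mulr_gt0 ?powR_gt0.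
rewrite -DE -powR_absorb; first last.
- by rewrite !mulr_ge0 ?powR_ge0 // ltW.
- by rewrite !mulr_gt0 ?powR_gt0.
apply: le_trans (h1 V t e (block a b) M) _.
rewrite -!mulrA; apply: ler_wpM2l; first exact: ltW.
apply: (@le_trans _ _ ((C3 * D a) `^ q * d `^ (q - p) *
   \sum_(j < M | block a b j) \sum_(y <- Lv t j) `|e y| `^ p)).
  rewrite mulr_sumr; apply: ler_sum => j Pj; have /andP[aj jb] := Pj.
  rewrite -mulrA -DE; apply: ler_pM; rewrite ?powR_ge0 ?sumr_ge0 //.
    apply: ler_powr; [exact: ltW|exact: ltW (D0 j)|].
    by have [] := h3 a j aj (leq_trans jb ab).
  rewrite mulr_sumr big_seq [leRHS]big_seq; apply: ler_sum => x; rewrite mem_Lv => /eqP xj.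
  have -> : `|e x| `^ q = `|e x| `^ (q - p) * `|e x| `^ p.
    by rewrite -powRD ?subrK // gt_eqF.
  apply: ler_wpM2r; first exact: powR_ge0.
  apply: ge0_ler_powR; rewrite ?nnegrE ?subr_ge0 ?(ltW d0) ?(ltW pq) //.
  by apply: ed; rewrite xj.
have h := in_ball_level_union M (block a b) eB; rewrite big_level_union in h.
have Z0 : 0 <= (C3 * D a) `^ q * d `^ (q - p) by rewrite mulr_ge0 ?powR_ge0.
apply: le_trans (ler_wpM2l Z0 h) _; apply: eqW.
rewrite mulr1 (powRM _ (ltW C30) (ltW (D0 a))) -!mulrA; congr (_ * _).
rewrite powRM ?(ltW (D0 _)) ?powR_ge0 // -powRrM; congr (_ * _ `^ _).
by field; rewrite gt_eqF.
Qed.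

(** The sum along a path is estimated by [threshold_sum]: a geometric sum, hence no
    loss in the length of the block. *)
Lemma block_lt_critical (W : nat -> R) (C0 kH k p : R) : 1 < p -> p < q ->
  0 < kH -> rate lin kH H ->
  0 < C0 -> (forall j, 0 < W j) ->
  (forall j M, \sum_(j <= l < M) w l `^ q * H l <= C0 * W j `^ q * H j) ->
  rate lg k (fun j => u j * H j `^ (- q^-1)) ->
  exists2 C, 0 < C & forall (V : choiceType) (t : leveled c H V) (e : V -> R) a b M delta,
    in_ball t p%:E e -> (b <= 2 * a.+1)%N -> 0 < delta ->
    (forall x, block a b (lev t x) -> `|e x| <= delta) ->
    lsum t M (fun x => psum u w t (block a b) e x `^ q) <=
    (C * (u a * W a * delta `^ (1 - p / q))) `^ q.
Proof.
move=> p1 pq kH0 HR C00 W0 hW vR; have q0 : 0 < q := lt_le_trans ltr01 q1.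
have c0 : 0 < c := lt_le_trans ltr01 c1.
pose v j := u j * H j `^ (- q^-1).
have v0 j : 0 < v j by rewrite !mulr_gt0 // powR_gt0.
have [C2 C20 h2] := threshold_sum H0 kH0 HR (ltW p1) pq.
have vE : forall j, v j = u j * H j `^ (- q^-1) := fun=> erefl.
have [C3 C30 h3] : exists2 C, 0 < C & forall i j, (i <= j)%N -> (j.+1 <= 2 * i.+1)%N ->
  v j <= C * v i /\ v i <= C * v j := rate_block 2 vR.
clearbody v.
exists ((c * C0 * (C3 `^ q * C2 `^ q * c)) `^ q^-1) => [|V t e a b M d eB ab d0 ed].
  by rewrite powR_gt0 // !mulr_gt0 ?powR_gt0.
rewrite -powR_absorb; first last.
- by rewrite !mulr_ge0 ?powR_ge0 // ltW.
- by rewrite !mulr_gt0 ?powR_gt0.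
apply: le_trans (psum_critical c1 H0 q1 u0 w0 t e (ltW C00) hW (P := block a b) (fun j h => h) M) _.
pose G x := \sum_(j < b | block a b j) H j * `|e (anc t x j)| `^ p.
have G0 x : 0 <= G x by apply: sumr_ge0 => j _; rewrite mulr_ge0 ?powR_ge0 // ltW.
have pw x : lev t x = b -> (\sum_(j < b | block a b j) u j * `|e (anc t x j)|) `^ q <=
   (C3 * v a) `^ q * (C2 `^ q * (d `^ (q - p) * G x)).
  move=> xb.
  have -> : (C3 * v a) `^ q * (C2 `^ q * (d `^ (q - p) * G x)) =
     (C3 * v a * (C2 * (d `^ (1 - p / q) * G x `^ q^-1))) `^ q.
    rewrite [RHS]powRM ?mulr_ge0 ?powR_ge0 ?(ltW C30) ?(ltW C20) ?(ltW (v0 _)) //; congr (_ * _).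
    rewrite !powRM ?mulr_ge0 ?powR_ge0 ?(ltW C20) // -!powRrM mulVf ?gt_eqF // powRr1 //.
    by congr (_ * (_ `^ _ * _)); field; rewrite gt_eqF.
  apply: ler_powr; first exact: ltW.
    by apply: sumr_ge0 => j _; rewrite mulr_ge0 // ltW.
  apply: (@le_trans _ _ (C3 * v a * \sum_(j < b | block a b j) H j `^ q^-1 * `|e (anc t x j)|)).
    rewrite mulr_sumr; apply: ler_sum => j /andP[aj jb]; rewrite mulrA.
    apply: ler_wpM2r => //.
    have -> : u j = v j * H j `^ q^-1.
      by rewrite vE powRN divfK // gt_eqF // powR_gt0.
    apply: ler_wpM2r; first exact: powR_ge0.
    by have [] := h3 a j aj (leq_trans jb ab).
  apply: ler_wpM2l; first by rewrite mulr_ge0 // ltW.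
  apply: (h2 b (block a b) (fun j => `|e (anc t x j)|)) => // j jb Pj; split => //.
    by apply: ed; rewrite lev_anc // xb ltnW.
  rewrite /G (bigD1 (Ordinal jb)) //= lerDl; apply: sumr_ge0 => i _.
  by rewrite mulr_ge0 ?powR_ge0 // ltW.
have SG : \sum_(x <- Lv t b) G x <= c * H b.
  rewrite exchange_big /=; apply: (@le_trans _ _ (c * H b * \sum_(x <- level_union t b (block a b)) `|e x| `^ p)).
    rewrite big_level_union mulr_sumr; apply: ler_sum => j /andP[aj jb]; rewrite -mulr_sumr.
    have := @push_le _ _ _ _ t (fun y => `|e y| `^ p) j b (fun=> powR_ge0 _ _) (ltnW jb).
    move=> /(ler_wpM2l (ltW (H0 j))) h'; apply: le_trans h' _; apply: eqW.
    by field; rewrite gt_eqF.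
  rewrite -[leRHS]mulr1; apply: ler_wpM2l; first by rewrite mulr_ge0 // ltW.
  exact: in_ball_level_union.
have S_le : \sum_(x <- Lv t b) (\sum_(j < b | block a b j) u j * `|e (anc t x j)|) `^ q <=
  (C3 * v a) `^ q * (C2 `^ q * (d `^ (q - p) * (c * H b))).
  apply: (@le_trans _ _ (\sum_(x <- Lv t b) (C3 * v a) `^ q * (C2 `^ q * (d `^ (q - p) * G x)))).
    by rewrite big_seq [leRHS]big_seq; apply: ler_sum => x; rewrite mem_Lv => /eqP; exact: pw.
  rewrite -!mulr_sumr; do 3 (apply: ler_wpM2l; first exact: powR_ge0).
  exact: SG.
have K0 : 0 <= c * C0 * W a `^ q * H a / H b.
  by rewrite !mulr_ge0 ?powR_ge0 ?invr_ge0 // ltW.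
apply: le_trans (ler_wpM2l K0 S_le) _; apply: eqW.
have -> : (u a * W a * d `^ (1 - p / q)) `^ q = v a `^ q * W a `^ q * H a * d `^ (q - p).
  rewrite -[in RHS](powRr1 (ltW (H0 a))).
  rewrite vE !powRM ?mulr_ge0 ?powR_ge0 ?(ltW (u0 _)) ?(ltW (W0 _)) // -!powRrM.
  have -> : - q^-1 * q = - 1 by field; rewrite gt_eqF.
  rewrite powRN powRr1 ?(ltW (H0 _)) //.
  have -> : (1 - p / q) * q = q - p by field; rewrite gt_eqF.
  by field; rewrite gt_eqF.
rewrite (powRM _ (ltW C30) (ltW (v0 a))).
by field; rewrite gt_eqF.
Qed.

End BlockBounds.

(** * Covering by rounding *)

Section Norms.
Context {R : realType} (c : R) (H : nat -> R) (V : choiceType) (t : leveled c H V).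
Implicit Types (f g : V -> R).

Lemma lsum_level_union M (F : V -> R) : lsum t M F = \sum_(x <- level_union t M predT) F x.
Proof. by rewrite big_level_union. Qed.

(** A finite set of vertices is contained in finitely many levels. *)
Lemma esum_le_levels (F : V -> R) (B : R) : (forall x, 0 <= F x) ->
  (forall M, lsum t M F <= B) -> (\esum_(x in [set: V]) (F x)%:E <= B%:E)%E.
Proof.
move=> F0 h; apply: ge_ereal_sup => _ [A [fA _] <-].
rewrite fsbig_finite //= sumEFin lee_fin.
pose M := (\max_(x <- fset_set A) lev t x).+1.
apply: le_trans (h M); rewrite lsum_level_union.
have sub x : x \in fset_set A -> x \in level_union t M predT.
  move=> xA; rewrite mem_level_union andbT ltnS.
  by rewrite (big_rem x xA) /= leq_maxl.
rewrite [leRHS](bigID (fun x => x \in fset_set A)) /=.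
rewrite -[X in _ <= X + _]big_filter.
have -> : \sum_(i <- [seq i <- level_union t M predT | i \in fset_set A]) F i = \sum_(i <- fset_set A) F i.
  apply: perm_big; apply: uniq_perm; rewrite ?filter_uniq ?level_union_uniq ?fset_uniq // => x.
  by rewrite mem_filter andb_idr //; exact: sub.
by rewrite lerDl; apply: sumr_ge0.
Qed.

Lemma levels_le_esum (F : V -> R) M : (forall x, 0 <= F x) ->
  ((lsum t M F)%:E <= \esum_(x in [set: V]) (F x)%:E)%E.
Proof.
move=> F0; apply: esum_ge; exists [set` level_union t M predT]; first by split.
by rewrite -fsbig_seq ?level_union_uniq //= sumEFin lsum_level_union.
Qed.

Lemma lp_norm_le (r : R) f (B : R) : 1 <= r -> 0 <= B ->
  (forall M, lsum t M (fun x => `|f x| `^ r) <= B `^ r) -> (lp_norm r%:E f <= B%:E)%E.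
Proof.
move=> r1 B0 h; have r0 : 0 < r by lra.
rewrite /lp_norm.
have h1 := esum_le_levels (fun x => powR_ge0 `|f x| r) h.
have e0 : (0 <= \esum_(x in [set: V]) (`|f x| `^ r)%:E)%E.
  by apply: esum_ge0 => x _; rewrite lee_fin powR_ge0.
have -> : B%:E = ((B `^ r)%:E `^ r^-1)%E.
  by rewrite poweR_EFin -powRrM divff ?gt_eqF // powRr1.
apply: gt0_ler_poweR => //; first by rewrite invr_ge0 ltW.
- by rewrite in_itv /= e0 leey.
- by rewrite in_itv /= lee_fin powR_ge0 leey.
Qed.

Lemma lp_norm_levels (r : R) f (B : R) : 1 <= r -> 0 <= B ->
  (lp_norm r%:E f <= B%:E)%E -> forall M, lsum t M (fun x => `|f x| `^ r) <= B `^ r.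
Proof.
move=> r1 B0 h M; have r0 : 0 < r by lra.
have e0 : (0 <= \esum_(x in [set: V]) (`|f x| `^ r)%:E)%E.
  by apply: esum_ge0 => x _; rewrite lee_fin powR_ge0.
have h1 := levels_le_esum M (fun x => powR_ge0 `|f x| r).
rewrite -lee_fin; apply: le_trans h1 _.
have -> : (\esum_(x in [set: V]) (`|f x| `^ r)%:E = lp_norm r%:E f `^ r)%E.
  by rewrite /lp_norm -poweRrM mulVf ?gt_eqF // poweRe1.
rewrite -poweR_EFin; apply: gt0_ler_poweR => //; first exact: ltW.
- by rewrite in_itv /= poweR_ge0 leey.
- by rewrite in_itv /= lee_fin B0 leey.
Qed.

Lemma lp_norm_le1 (p : \bar R) f : (1 < p)%E -> (lp_norm p f <= 1%:E)%E -> in_ball t p f.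
Proof.
case: p => [r| |] //=; rewrite ?lte_fin.
  move=> r1 h M; have := @lp_norm_levels r f 1 (ltW r1) ler01 h M.
  by rewrite powR1.
move=> _ h x; rewrite -lee_fin; apply: le_trans h.
by apply: ereal_sup_ubound; exists x.
Qed.

Lemma in_ball_lp_norm (p : \bar R) f : (1 < p)%E -> in_ball t p f -> (lp_norm p f <= 1%:E)%E.
Proof.
case: p => [r| |] //=; rewrite ?lte_fin.
  by move=> r1 h; apply: lp_norm_le => // [|M]; [exact: ltW|rewrite powR1].
by move=> _ h; apply: ge_ereal_sup => _ [x _ <-]; rewrite lee_fin.
Qed.

End Norms.

Section Entropy.
Context {R : realType} (c : R) (H : nat -> R) (q : R) (u w : nat -> R).
Hypotheses (c1 : 1 <= c) (H0 : forall j, 0 < H j) (q1 : 1 <= q).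
Hypotheses (u0 : forall j, 0 < u j) (w0 : forall j, 0 < w j).

Definition level_op (V : choiceType) (t : leveled c H V) (f : V -> R) : V -> R :=
  fun x => w (lev t x) * \sum_(j < (lev t x).+1) u j * f (anc t x j).

Section OneTree.
Context (V : choiceType) (t : leveled c H V).
Implicit Types (f : V -> R).

Lemma level_opB (f g : V -> R) : level_op t (f - g) = level_op t f - level_op t g.
Proof.
apply/funext => x; rewrite /level_op !fctE -mulrBr -sumrB; congr (_ * _).
by apply: eq_bigr => j _; rewrite mulrBr.
Qed.

Lemma norm_level_op f x : `|level_op t f x| <= psum u w t xpredT f x.
Proof.
rewrite /level_op /psum normrM gtr0_norm //; apply: ler_wpM2l; first exact: ltW.
apply: le_trans (ler_norm_sum _ _ _) _; apply: ler_sum => j _.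
by rewrite normrM gtr0_norm.
Qed.

Lemma level_op_lsum f (B : R) : (forall M, lsum t M (fun x => psum u w t xpredT f x `^ q) <= B `^ q) ->
  forall M, lsum t M (fun x => `|level_op t f x| `^ q) <= B `^ q.
Proof.
move=> h M; apply: le_trans (h M); apply: ler_lsum => x _.
apply: ler_powr => //; [exact: le_trans ler01 q1|exact: norm_level_op].
Qed.

(** This provides the centres of the covering: they must have finite norm. *)
Lemma level_op_finite (W : nat -> R) (C0 : R) f (N : nat) : 0 < C0 -> (forall j, 0 < W j) ->
  (forall j M, \sum_(j <= l < M) w l `^ q * H l <= C0 * W j `^ q * H j) ->
  (forall x, (N <= lev t x)%N -> f x = 0) -> (lp_norm q%:E (level_op t f) < +oo)%E.
Proof.
move=> C00 W0 hW fN; have q0 : 0 < q := lt_le_trans ltr01 q1.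
have c0 : 0 < c := lt_le_trans ltr01 c1.
pose S j := \sum_(y <- Lv t j) `|f y| `^ q.
have S0 j : 0 <= S j by apply: sumr_ge0 => y _; exact: powR_ge0.
pose b0 j := (c * C0 * (u j * W j) `^ q * S j) `^ q^-1.
(* any summable positive bounds will do above level N, where f vanishes *)
pose b j := if (j < N)%N then b0 j + 1 else (1 / 2) ^+ j.
have bp j : 0 < b j.
  rewrite /b; case: ifP => _; last by rewrite exprn_gt0.
  by rewrite ltr_pwDr // powR_ge0.
pose B := \sum_(j < N) b j + 2.
suff h : forall M, lsum t M (fun x => psum u w t xpredT f x `^ q) <= B `^ q.
  have B0 : 0 <= B by rewrite addr_ge0 // sumr_ge0 // => j _; exact: ltW.
  have := @lp_norm_le _ _ _ _ t q (level_op t f) B q1 B0 (level_op_lsum h).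
  by move=> /le_lt_trans; apply; rewrite ltry.
apply: (psum_groups q1 u0 w0 (grp := id) (b := b)) => // [G|g M].
  pose b' j : R := if (j < N)%N then b j else 0.
  have : \sum_(g < G) b g <= \sum_(g < G) b' g + \sum_(g < G) (1 / 2) ^+ g.
    rewrite -big_split /=; apply: ler_sum => g _; rewrite /b' /b; case: ifP => _.
      by rewrite lerDl exprn_ge0.
    by rewrite add0r.
  move=> /le_trans; apply; apply: lerD.
    have b'0 j : 0 <= b' j by rewrite /b'; case: ifP => _ //; exact: ltW.
    apply: (@le_trans _ _ (\sum_(g < maxn G N) b' g)).
      rewrite (big_ord_widen (maxn G N) b') ?leq_maxl //.
      by rewrite [leRHS](bigID (fun g : 'I_(maxn G N) => (g < G)%N)) /= lerDl sumr_ge0.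
    rewrite (big_ord_widen (maxn G N) b) ?leq_maxr //.
    rewrite [leRHS]big_mkcond /=; apply: ler_sum => j _; rewrite /b'.
    by case: ifP.
  have h2 : (0 : R) <= 1 / 2 by lra.
  have h3 : (1 / 2 : R) < 1 by lra.
  by apply: le_trans (geometric_le G h2 h3) _; apply: eqW; field.
have := psum_level c1 H0 q1 u0 w0 t f g (fun j => ltW (W0 j)) hW M.
move=> /le_trans; apply; rewrite -/(S g).
have [gN|Ng] := ltnP g N.
  rewrite /b gN; have -> : c * C0 * (u g * W g) `^ q * S g = b0 g `^ q.
    rewrite /b0 -powRrM mulVf ?gt_eqF // powRr1 //.
    by rewrite !mulr_ge0 ?powR_ge0 // ltW.
  apply: ler_powr; [exact: ltW|exact: powR_ge0|by rewrite lerDl].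
rewrite /S big_seq big1 ?mulr0 ?powR_ge0 // => y; rewrite mem_Lv => /eqP yg.
by rewrite fN ?yg // normr0 powR0 // gt_eqF.
Qed.

(** Rounding towards zero, which is what keeps the error below |y|. *)
Definition rtrunc (y : R) : int :=
  if 0 <= y then Posz (Num.truncn y) else - Posz (Num.truncn (- y)).

Lemma rtrunc_norm (y : R) : `|rtrunc y|%N = Num.truncn `|y|.
Proof.
rewrite /rtrunc; case: ifPn => [y0|]; first by rewrite ger0_norm.
by rewrite -ltNge => y0; rewrite ltr0_norm // abszN.
Qed.

Lemma rtrunc_error (y : R) : `|y - (rtrunc y)%:~R| <= Num.min 1 `|y|.
Proof.
have key (z : R) : 0 <= z -> `|z - (Num.truncn z)%:R| <= Num.min 1 z.
  move=> z0; have /andP[h1 h2] := truncn_itv z0; rewrite ger0_norm ?subr_ge0 //.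
  case: (leP 1 z) => _; first by rewrite lerBlDl natr1 ltW.
  by rewrite lerBlDr lerDl ler0n.
rewrite /rtrunc; case: ifPn => [y0|].
  by rewrite (ger0_norm y0); exact: key.
rewrite -ltNge => y0; have h := key (- y); rewrite oppr_ge0 in h.
by rewrite (ltr0_norm y0) mulrNz opprK -normrN opprD; apply: h; exact: ltW.
Qed.

Variables (grp : nat -> nat) (delta : nat -> R) (K : nat -> nat) (Mx : nat).
Hypothesis delta0 : forall g, 0 < delta g.

Definition group_seq (g : nat) : seq V := level_union t Mx (fun j => grp j == g).

(** One list for all functions of the ball; [Mx] bounds the levels where a rounding may
    be nonzero. *)
Fixpoint roundings (G : nat) : seq (V -> R) :=
  if G is G'.+1 then
    [seq (fun x => a x + delta G' * (k x)%:~R) | a <- roundings G',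
      k <- ivectors (group_seq G') (K G')]
  else [:: fun=> 0].

Lemma size_roundings G :
  size (roundings G) = (\prod_(g < G) size (ivectors (group_seq g) (K g)))%N.
Proof.
elim: G => [|G IH] /=; first by rewrite big_ord0.
by rewrite size_allpairs IH big_ord_recr.
Qed.

Lemma roundings_supp G k x : k \in roundings G -> (Mx <= lev t x)%N -> k x = 0.
Proof.
elim: G k => [|G IH] k /=; first by rewrite inE => /eqP ->.
move=> /allpairsP[[a b] /= [aG bK ->]] xM; rewrite IH // (ivectors_supp bK) ?mulr0 ?addr0 //.
by rewrite mem_level_union negb_and -leqNgt xM.
Qed.

Definition rounding f : V -> R :=
  fun x => delta (grp (lev t x)) * (rtrunc (f x / delta (grp (lev t x))))%:~R.

Lemma mem_roundings G f : (forall j, (grp j < G)%N -> (j < Mx)%N) ->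
  (forall g, (g < G)%N ->
    (\sum_(x <- group_seq g) Num.truncn (`|f x| / delta g) <= K g)%N) ->
  (fun x => if (grp (lev t x) < G)%N then rounding f x else 0) \in roundings G.
Proof.
elim: G => [|G IH] hM hK; first by rewrite inE; apply/eqP/funext.
apply/allpairsP.
pose k x : int := if x \in group_seq G then rtrunc (f x / delta G) else 0.
exists ((fun x => if (grp (lev t x) < G)%N then rounding f x else 0), k); split => /=.
- apply: IH => [j jG|g gG]; first by apply: hM; rewrite ltnW.
  by apply: hK; rewrite ltnW.
- apply: mem_ivectors; first exact: level_union_uniq.
    by move=> x xS; rewrite /k (negbTE xS).
  apply: leq_trans (hK G (ltnSn G)); apply: eq_leq; apply: eq_big_seq => x xS.
  by rewrite /k xS rtrunc_norm normrM (gtr0_norm (_ : 0 < (delta G)^-1)) ?invr_gt0.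
- apply/funext => x; rewrite /k mem_level_union.
  have [xG|Gx|xG] := ltngtP (grp (lev t x)) G.
  + by rewrite ltnS ltnW // andbF mulr0 addr0.
  + by rewrite ltnS leqNgt Gx andbF mulr0 addr0.
  + rewrite xG ltnSn hM ?xG //= add0r /rounding xG //.
Qed.

(** The covering consists of the images of the roundings.  The groups from [G] on are
    not rounded at all: the values there are smaller than the step. *)
Lemma entropy_upper (p : \bar R) (W : nat -> R) (C0 B : R) (G n : nat) :
  (1 < p)%E -> 0 < C0 -> (forall j, 0 < W j) ->
  (forall j M, \sum_(j <= l < M) w l `^ q * H l <= C0 * W j `^ q * H j) ->
  0 < B ->
  (forall j, (grp j < G)%N -> (j < Mx)%N) ->
  (forall f, in_ball t p f -> forall g, (g < G)%N ->
    (\sum_(x <- group_seq g) Num.truncn (`|f x| / delta g) <= K g)%N) ->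
  (forall f x, in_ball t p f -> (G <= grp (lev t x))%N -> `|f x| < delta (grp (lev t x))) ->
  (\prod_(g < G) size (ivectors (group_seq g) (K g)) <= 2 ^ n.-1)%N ->
  (forall e, in_ball t p e -> (forall x, `|e x| <= delta (grp (lev t x))) ->
    forall M, lsum t M (fun x => psum u w t xpredT e x `^ q) <= B `^ q) ->
  (entropy_number (lp_norm p) (lp_norm q%:E) (level_op t) n <= B%:E)%E.
Proof.
move=> p1 C00 W0 hW B0 hM hK hG hcard hB; apply: ereal_inf_lbound.
exists B => //=; split => //.
exists (fun i => level_op t (nth (fun=> 0) (roundings G) i)); split => [i|f fB].
  have [iG|Gi] := ltnP i (size (roundings G)).
    by apply: (level_op_finite (N := Mx) C00 W0 hW) => x xM; apply: roundings_supp xM; exact: mem_nth.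
  by apply: (level_op_finite (N := Mx) C00 W0 hW) => x xM; rewrite nth_default.
have {}fB := @lp_norm_le1 _ _ _ _ t p f p1 fB.
have mR := mem_roundings hM (hK f fB).
set r := (X in X \in _) in mR.
have rlt : (index r (roundings G) < 2 ^ n.-1)%N.
  by apply: leq_trans hcard; rewrite -size_roundings index_mem.
exists (Ordinal rlt); rewrite /= nth_index // -level_opB.
have rE x : r x = rounding f x.
  rewrite /r; case: ltnP => // Gx; rewrite /rounding.
  have h := hG f x fB Gx; have d0 := delta0 (grp (lev t x)).
  suff -> : rtrunc (f x / delta (grp (lev t x))) = 0 by rewrite mulr0.
  apply/eqP; rewrite -absz_eq0 rtrunc_norm -leqn0 -ltnS truncn_lt_nat //.
  by rewrite normrM (gtr0_norm (_ : 0 < (delta _)^-1)) ?invr_gt0 // ltr_pdivrMr // mul1r.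
have er x : `|(f - r) x| <= Num.min (delta (grp (lev t x))) `|f x|.
  rewrite !fctE rE /rounding; set d := delta _; have d0 : 0 < d by exact: delta0.
  have -> : f x - d * (rtrunc (f x / d))%:~R = d * (f x / d - (rtrunc (f x / d))%:~R).
    by rewrite mulrBr mulrCA divff ?mulr1 // gt_eqF.
  rewrite normrM (gtr0_norm d0); have := rtrunc_error (f x / d).
  move=> /(ler_wpM2l (ltW d0)) /le_trans; apply.
  rewrite normrM (gtr0_norm (_ : 0 < d^-1)) ?invr_gt0 // minr_pMr ?(ltW d0) //.
  by rewrite mulr1 mulrCA divff ?mulr1 // gt_eqF.
apply: (@lp_norm_le _ _ _ _ t q) => //; first exact: ltW.
apply: level_op_lsum; apply: hB => [|x].
  apply: in_ball_sub fB => // x; apply: le_trans (er x) _.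
  by rewrite ge_min lexx orbT.
by apply: le_trans (er x) _; rewrite ge_min lexx.
Qed.

End OneTree.
End Entropy.

(** * Packing by codes *)

Section Lower.
Context {R : realType} (c : R) (H : nat -> R) (q : R) (u w : nat -> R).
Hypotheses (c1 : 1 <= c) (H0 : forall j, 0 < H j) (q1 : 1 <= q).
Hypotheses (u0 : forall j, 0 < u j) (w0 : forall j, 0 < w j).
Context (V : choiceType) (t : leveled c H V).

(** Two of more than 2 ^ (n - 1) points share a ball of the covering; the triangle
    inequality bounds their distance by twice the radius. *)
Lemma entropy_packing (p : \bar R) (I : finType) (A : {set I}) (F : I -> V -> R) (D : R) (n : nat) :
  (1 < p)%E -> 0 < D -> (2 ^ n.-1 < #|A|)%N ->
  (forall a, a \in A -> in_ball t p (F a)) ->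
  (forall a b, a \in A -> b \in A -> a != b ->
    exists M, D `^ q <= lsum t M (fun x => `|level_op u w t (F a) x - level_op u w t (F b) x| `^ q)) ->
  ((D / 2)%:E <= entropy_number (lp_norm p) (lp_norm q%:E) (level_op u w t) n)%E.
Proof.
move=> p1 D0 cA FA FD; apply: le_ereal_inf_tmp => _ [e [e0 [y [_ hy]]] <-].
have q0 : 0 < q := lt_le_trans ltr01 q1.
rewrite lee_fin.
have [idx hidx] : {idx : I -> 'I_(2 ^ n.-1) | forall a, a \in A ->
    (lp_norm q%:E (level_op u w t (F a) - y (idx a))%R <= e%:E)%E}.
  have n0 : (0 < 2 ^ n.-1)%N by rewrite expn_gt0.
  have ex a : exists i, a \in A -> (lp_norm q%:E (level_op u w t (F a) - y i)%R <= e%:E)%E.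
    have [aA|_] := boolP (a \in A); last by exists (Ordinal n0).
    have [i hi] := hy _ (in_ball_lp_norm p1 (FA a aA)).
    by exists i.
  by have [idx hidx] := choice ex; exists idx.
have [a [b [aA bA ab E1]]] : exists a b, [/\ a \in A, b \in A, a != b & idx a = idx b].
  apply: contrapT => no.
  have inj : {in A &, injective idx}.
    move=> a b aA bA E1; apply/eqP; apply: contrapT => /negP ab.
    by apply: no; exists a, b.
  have := max_card (mem (idx @: A)); rewrite card_in_imset // card_ord.
  by rewrite leqNgt cA.
have [M hM] := FD a b aA bA ab.
have ha := lp_norm_levels t q1 (ltW e0) (hidx a aA) M.
have hb := lp_norm_levels t q1 (ltW e0) (hidx b bA) M.
have tri (x x' z : R) : `|x - x'| `^ q <= 2 `^ (q - 1) * (`|x - z| `^ q + `|x' - z| `^ q).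
  pose f (i : bool) := if i then `|x - z| else `|x' - z|.
  have := @power_mean R bool [:: true; false] predT q (fun=> 1) f q1 (fun _ _ => ler01).
  rewrite !big_cons !big_nil /= !addr0 !mul1r => h.
  have f0 i : predT i -> 0 <= f i by case: i => _ /=.
  apply: le_trans (h f0).
  apply: ler_powr => //; first exact: ltW.
  by rewrite (distrC x' z) (le_trans _ (ler_normD _ _)) // addrA subrK.
have h : D `^ q <= (2 * e) `^ q.
  apply: le_trans hM _.
  apply: (@le_trans _ _ (2 `^ (q - 1) * (lsum t M (fun x => `|(level_op u w t (F a) - y (idx a)) x| `^ q)
     + lsum t M (fun x => `|(level_op u w t (F b) - y (idx b)) x| `^ q)))).
    rewrite /lsum -big_split mulr_sumr; apply: ler_sum => l _.
    rewrite -big_split mulr_sumr; apply: ler_sum => x _.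
    by rewrite E1 !fctE; exact: tri.
  rewrite powRM ?(ltW e0) //.
  have -> : 2 `^ q = 2 `^ (q - 1) * 2 :> R.
    by rewrite mulrC mulr_powRB1.
  rewrite -mulrA; apply: ler_wpM2l; first exact: powR_ge0.
  by rewrite [leRHS]mulrDl !mul1r; apply: lerD.
have : D <= 2 * e; last lra.
rewrite leNgt; apply/negP => eD; have e20 : 0 <= 2 * e by lra.
have := @gt0_ltr_powR R q q0 (2 * e) D; rewrite !nnegrE e20 (ltW D0) => /(_ isT isT eD).
by rewrite ltNge h.
Qed.

(** Level [J] is cut into [s] groups of 4 ^ (k + 1) vertices, and a code word selects
    one vertex in each group.  Below the selected vertices the function depends only
    on the level, through [g].  Two words that differ in s / 2 places give images
    that differ on the descendants of at least s / 2 vertices. *)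
Lemma entropy_lower_radial (p : \bar R) (J s k n M : nat) (g : nat -> R) :
  (1 < p)%E -> (0 < s)%N -> (n <= k * s)%N -> (0 < n)%N ->
  (s * 4 ^ k.+1 <= size (Lv t J))%N ->
  (forall l, 0 <= g l) -> (forall l, (M <= l)%N -> g l = 0) ->
  match p return Prop with
  | r%:E => s%:R * c * \sum_(J <= l < M) (H l / H J) * g l `^ r <= 1
  | _ => forall l, g l <= 1
  end ->
  0 < \sum_(J <= l < M) (H l / H J) * (w l * \sum_(J <= j < l.+1) u j * g j) `^ q ->
  (((c^-1 * (s%:R / 2) *
    \sum_(J <= l < M) (H l / H J) * (w l * \sum_(J <= j < l.+1) u j * g j) `^ q) `^ q^-1 / 2)%:E <=
   entropy_number (lp_norm p) (lp_norm q%:E) (level_op u w t) n)%E.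
Proof.
move=> p1 s0 nks n0 sJ g0 gM gp Phi0; have q0 : 0 < q := lt_le_trans ltr01 q1.
have c0 : 0 < c := lt_le_trans ltr01 c1.
set A := (4 ^ k.+1)%N in sJ.
have A0 : (0 < A)%N by rewrite expn_gt0.
have LJ0 : (0 < size (Lv t J))%N by apply: leq_trans sJ; rewrite muln_gt0 s0.
have [x0 _] : exists x0, x0 \in Lv t J.
  by case: (Lv t J) LJ0 => // x0 ? _; exists x0; rewrite inE eqxx.
(* the b-th group consists of the positions b A, ..., b A + A - 1 in the list of level J *)
pose pos (a : {ffun 'I_s -> 'I_A}) (b : 'I_s) : nat := (b * A + a b)%N.
have posJ a b : (pos a b < size (Lv t J))%N.
  apply: leq_trans sJ; rewrite /pos; have := ltn_ord (a b); have := ltn_ord b.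
  move: (nat_of_ord b) (nat_of_ord (a b)) => b' a' hb ha.
  apply: (@leq_trans (b'.+1 * A)); first by rewrite mulSn addnC ltn_add2r.
  by rewrite leq_mul2r hb orbT.
pose vtx a b := nth x0 (Lv t J) (pos a b).
have vtxJ a b : vtx a b \in Lv t J by rewrite mem_nth.
have vtx_inj a b a' b' : vtx a b = vtx a' b' -> b = b' /\ a b = a' b'.
  move/eqP; rewrite nth_uniq ?Lv_uniq // => /eqP; rewrite /pos => E1.
  have hb := ltn_ord (a b); have hb' := ltn_ord (a' b').
  have e1 : b = b' :> nat.
    have := congr1 (fun m => m %/ A)%N E1.
    by rewrite !divnMDl // !divn_small // !addn0.
  split; first exact: val_inj.
  apply: val_inj; have := E1; rewrite /= e1; exact: addnI.
pose chosen a y := [exists b, y == vtx a b].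
have sum_pt v : v \in Lv t J -> \sum_(y <- Lv t J) (y == v)%:R = 1 :> R.
  move=> vJ; rewrite (bigD1_seq v) ?Lv_uniq //= eqxx big1 ?addr0 // => y.
  by move/negbTE ->.
have chosen_card a : \sum_(y <- Lv t J) (chosen a y)%:R <= s%:R :> R.
  apply: (@le_trans _ _ (\sum_(y <- Lv t J) \sum_(b < s) (y == vtx a b)%:R)).
    apply: ler_sum => y _; rewrite /chosen; case: existsP => [[b yb]|_]; last exact: sumr_ge0.
    by rewrite (bigD1 b) //= yb lerDl; exact: sumr_ge0.
  rewrite exchange_big /=; under eq_bigr do rewrite sum_pt //.
  by rewrite sumr_const card_ord.
have chosen_diff a b : (hamming a b)%:R <= \sum_(y <- Lv t J) (chosen a y != chosen b y)%:R :> R.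
  have -> : (hamming a b)%:R = \sum_(i < s | a i != b i) \sum_(y <- Lv t J) (y == vtx a i)%:R :> R.
    under eq_bigr do rewrite sum_pt //.
    rewrite /hamming -sum1_card natr_sum; apply: eq_bigl => i; by rewrite inE.
  rewrite exchange_big /=; apply: ler_sum => y _.
  have [/existsP[i /andP[ai /eqP yi]]|/existsPn no] :=
      boolP [exists i, (a i != b i) && (y == vtx a i)]; last first.
    rewrite big1 // => i ai; have := no i; rewrite ai /= => /negbTE -> //.
  have -> : chosen a y by apply/existsP; exists i; rewrite yi.
  have -> : chosen b y = false.
    apply/existsP => -[i' /eqP]; rewrite yi => /vtx_inj[ii' E1].
    by move: ai; rewrite E1 ii' eqxx.
  rewrite (bigD1 i) //= yi eqxx big1 ?addr0 // => i' /andP[_ ii'].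
  by case: eqP => // /vtx_inj[E1 _]; rewrite E1 eqxx in ii'.
have [C [CP Ccard]] := code_exists_pow s k.
pose F (a : {ffun 'I_s -> 'I_A}) (x : V) : R :=
  if (J <= lev t x)%N && chosen a (anc t x J) then g (lev t x) else 0.
pose Phi l := w l * \sum_(J <= j < l.+1) u j * g j.
have Phi_ge0 l : 0 <= Phi l.
  by rewrite mulr_ge0 ?(ltW (w0 _)) // sumr_ge0 // => j _; rewrite mulr_ge0 // ltW.
have TF a x : level_op u w t (F a) x = (chosen a (anc t x J) && (J <= lev t x)%N)%:R * Phi (lev t x).
  rewrite /level_op /Phi mulrCA; congr (_ * _).
  rewrite big_geq_mkord mulr_sumr [RHS]big_mkcond /=; apply: eq_bigr => j _.
  have jl : (j <= lev t x)%N by rewrite -ltnS.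
  rewrite /F lev_anc //; case: leqP => Jj /=; last by rewrite mulr0.
  rewrite anc_anc // (leq_trans Jj jl) andbT.
  by case: (chosen _ _); rewrite ?mul1r ?mul0r ?mulr0.
pose S := \sum_(J <= l < M) (H l / H J) * Phi l `^ q.
have S0 : 0 < S by exact: Phi0.
pose Z := c^-1 * (s%:R / 2) * S.
have Z0 : 0 < Z by rewrite !mulr_gt0 ?invr_gt0 ?ltr0n.
apply: (@entropy_packing p _ C F (Z `^ q^-1) n) => //.
- by rewrite powR_gt0.
- apply: leq_trans Ccard; rewrite ltn_exp2l //.
  by rewrite (prednK n0).
- move=> a _; case: p p1 gp => [r| |] //= p1 gp; last first.
    by move=> x; rewrite /F; case: ifP => _; rewrite ?normr0 // ger0_norm.
  move=> M'; have r0 : 0 < r by move: p1; rewrite lte_fin => p1; lra.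
  apply: le_trans gp.
  pose f l := s%:R * c * ((H l / H J) * g l `^ r).
  have f0 l : 0 <= f l.
    by rewrite !mulr_ge0 ?powR_ge0 ?invr_ge0 ?(ltW c0) ?(ltW (H0 _)).
  apply: (@le_trans _ _ (\sum_(l < M' | (J <= l)%N) f l)); last first.
    rewrite mulr_sumr big_geq_mkord.
    rewrite (big_ord_widen_cond (maxn M' M) (fun l => (J <= l)%N) f) ?leq_maxl //.
    rewrite (big_ord_widen_cond (maxn M' M) (fun l => (J <= l)%N) f) ?leq_maxr //.
    rewrite [leLHS]big_mkcond [leRHS]big_mkcond; apply: ler_sum => l _ /=.
    case: (J <= l)%N => //=; case: (ltnP l M) => lM; first by case: ifP.
    by case: ifP => // _; rewrite /f gM // powR0 ?gt_eqF // !mulr0.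
  rewrite /lsum [leRHS]big_mkcond; apply: ler_sum => l _.
  case: ifPn => [Jl|]; last first.
    rewrite -ltnNge => lJ; rewrite big_seq big1 // => x; rewrite mem_Lv => /eqP xl.
    by rewrite /F xl leqNgt lJ /= normr0 powR0 // gt_eqF.
  apply: (@le_trans _ _ (g l `^ r * \sum_(x <- Lv t l) (chosen a (anc t x J))%:R)).
    rewrite mulr_sumr big_seq [leRHS]big_seq; apply: ler_sum => x; rewrite mem_Lv => /eqP xl.
    rewrite /F xl Jl /=; case: (chosen _ _); first by rewrite mulr1 ger0_norm.
    by rewrite normr0 powR0 ?mulr0 // gt_eqF.
  have := @push_le _ _ _ _ t (fun y => (chosen a y)%:R) J l (fun=> ler0n _ _) Jl.
  move=> /(ler_wpM2l (powR_ge0 (g l) r)) /le_trans; apply.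
  have h2 : 0 <= g l `^ r * (c * (H l / H J)).
    by rewrite !mulr_ge0 ?powR_ge0 ?invr_ge0 ?(ltW c0) ?(ltW (H0 _)).
  rewrite [leLHS]mulrA; apply: le_trans (ler_wpM2l h2 (chosen_card a)) _.
  by apply: eqW; rewrite /f; ring.
- move=> a b aC bC ab; exists M.
  rewrite -powRrM mulVf ?gt_eqF // powRr1 ?(ltW Z0) //.
  rewrite /Z /S mulr_sumr big_geq_mkord /lsum big_mkcond /=; apply: ler_sum => l _.
  case: ifPn => [Jl|_]; last by apply: sumr_ge0 => x _; exact: powR_ge0.
  have -> : \sum_(x <- Lv t l) `|level_op u w t (F a) x - level_op u w t (F b) x| `^ q =
      Phi l `^ q * \sum_(x <- Lv t l) (chosen a (anc t x J) != chosen b (anc t x J))%:R.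
    rewrite mulr_sumr big_seq [RHS]big_seq; apply: eq_bigr => x; rewrite mem_Lv => /eqP xl.
    rewrite !TF xl Jl !andbT -mulrBl normrM powRM // (ger0_norm (Phi_ge0 l)) mulrC; congr (_ * _).
    case: (chosen a _); case: (chosen b _); rewrite ?subrr ?subr0 ?sub0r ?normrN ?normr0 ?normr1 ?powR0 ?powR1 //;
      by rewrite gt_eqF.
  have h := @push_ge _ _ _ _ t (fun y => (chosen a y != chosen b y)%:R) J l (fun=> ler0n _ _) Jl.
  apply: (@le_trans _ _ (Phi l `^ q * (c^-1 * (H l / H J) * (s%:R / 2)))); first by apply: eqW; ring.
  apply: ler_wpM2l; first exact: powR_ge0.
  apply: le_trans h; apply: ler_wpM2l.
    by rewrite !mulr_ge0 ?invr_ge0 ?(ltW c0) ?(ltW (H0 _)).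
  apply: le_trans (chosen_diff a b).
  by rewrite ler_pdivrMr // mulrC -natrM ler_nat; exact: CP.
Qed.
End Lower.

(** * Upper bounds: the levels up to the critical one *)

Lemma sum_piecewise (R : realType) (J G : nat) (a b : nat -> R) :
  (forall i, 0 <= a i) -> (forall i, 0 <= b i) ->
  \sum_(g < G) (if (g <= J)%N then a g else b (g - J.+1)%N) <=
  \sum_(g < J.+1) a g + \sum_(i < G - J.+1) b i.
Proof.
move=> a0 b0; pose f g := if (g <= J)%N then a g else b (g - J.+1)%N.
have f0 g : 0 <= f g by rewrite /f; case: ifP.
have GG : (G <= J.+1 + (G - J.+1))%N by lia.
apply: (@le_trans _ _ (\sum_(g < J.+1 + (G - J.+1)) f g)).
  rewrite (big_ord_widen _ f GG) [leRHS](bigID (fun g : 'I__ => (g < G)%N)) /=.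
  by rewrite lerDl sumr_ge0.
rewrite big_split_ord /=; apply: lerD; apply: ler_sum => g _; rewrite /f /=.
  by rewrite -ltnS ltn_ord.
by rewrite leqNgt ltnS leq_addr /= addKn.
Qed.

Lemma low_group_index (J j g x : nat) : (g <= J)%N -> (J < j)%N ->
  (((J.+1 + x)%N == g) = false) * ((j == g) = false).
Proof. by move=> gJ Jj; split; lia. Qed.

Lemma high_group_index (J j i : nat) : (j <= J)%N -> (j == (J.+1 + i)%N) = false.
Proof. by move=> jJ; lia. Qed.

Section Upper.
Context {R : realType} (c : R) (H : nat -> R) (q : R) (u w W : nat -> R) (C0 : R) (p : \bar R).
Hypotheses (c1 : 1 <= c) (H0 : forall j, 0 < H j) (q1 : 1 <= q).
Hypothesis Hhomo : {homo H : i j / (i <= j)%N >-> i <= j}.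
Hypotheses (u0 : forall j, 0 < u j) (w0 : forall j, 0 < w j) (W0 : forall j, 0 < W j).
Hypotheses (C00 : 0 < C0)
  (hW : forall j M, \sum_(j <= l < M) w l `^ q * H l <= C0 * W j `^ q * H j).
Hypothesis p1 : (1 < p)%E.
Context (kH kd : R).
Hypotheses (kH0 : 0 < kH) (HR : rate lin kH H).
Notation ip := (fine p^-1%E).
Hypothesis DR : rate lin kd (fun j => u j * W j * H j `^ (q^-1 - ip)).

Let D j := u j * W j * H j `^ (q^-1 - ip).

Let s := (`|kd| + 1) / kH.
(** The steps below [J] are those that would balance level [j], reduced by a power of
    H_j / H_J so large that the errors sum up geometrically towards level [J]. *)
Definition low_eps J j := (H j / H J) `^ s.
Definition low_delta J j := low_eps J j * H j `^ (- ip).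

Let q0 : 0 < q. Proof. exact: lt_le_trans ltr01 q1. Qed.
Let c0 : 0 < c. Proof. exact: lt_le_trans ltr01 c1. Qed.
Let s0 : 0 < s.
Proof. by rewrite /s divr_gt0 // ltr_wpDl. Qed.
Let D0 j : 0 < D j. Proof. by rewrite !mulr_gt0 // powR_gt0. Qed.

Lemma low_eps_gt0 J j : 0 < low_eps J j.
Proof. by rewrite powR_gt0 // divr_gt0. Qed.

Lemma low_delta_gt0 J j : 0 < low_delta J j.
Proof. by rewrite mulr_gt0 ?low_eps_gt0 // powR_gt0. Qed.

(** The l_1 norm of f on level [j] is at most a constant times H_j ^ (1 - 1 / p). *)
Lemma low_counts : exists2 C1, 0 < C1 & forall (V : choiceType) (t : leveled c H V) f J j,
  in_ball t p f ->
  (\sum_(x <- Lv t j) Num.truncn (`|f x| / low_delta J j) <= Num.truncn (C1 * H j / low_eps J j))%N.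
Proof.
have p1' : (1%:E <= p)%E by exact: ltW.
have [C1 C10 h1] := level_holder c1 H0 (lexx 1) p1'.
exists C1 => // V t f J j fB; have d0 := low_delta_gt0 J j; have e0 := low_eps_gt0 J j.
rewrite truncn_ge_nat; last by rewrite !mulr_ge0 ?invr_ge0 // ltW.
rewrite natr_sum; apply: (@le_trans _ _ (\sum_(x <- Lv t j) `|f x| / low_delta J j)).
  by apply: ler_sum => x _; rewrite truncn_le divr_ge0 // ltW.
rewrite -mulr_suml ler_pdivrMr //.
have := h1 V t f j fB; under eq_bigr do rewrite powRr1 //.
move=> /le_trans; apply; apply: eqW; rewrite /low_delta mul1r.
rewrite powRD; last by rewrite (gt_eqF (H0 _)) implybT.
by rewrite powRr1 ?(ltW (H0 _)) //; field; rewrite gt_eqF.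
Qed.

(** The logarithm of 1 / [low_eps] is dominated by a square root of H_J / H_j, which
    keeps the total number of bits proportional to H_J. *)
Definition low_bits (C : R) J j := C * (H j `^ (2^-1) * H J `^ (2^-1)).

Lemma low_sizes (C1 : R) : 0 < C1 -> exists2 C2, 0 < C2 &
  forall (V : choiceType) (t : leveled c H V) J j (S : seq V), (j <= J)%N -> size S = size (Lv t j) ->
  (size (ivectors S (Num.truncn (C1 * H j / low_eps J j))))%:R <= expR (low_bits C2 J j).
Proof.
move=> C10; pose C2 := C1 + c / H 0; have C20 : 0 < C2 by rewrite addr_gt0 // divr_gt0.
exists (C2 * (3 + 2 * s)) => [|V t J j S jJ SL].
  by rewrite mulr_gt0 // addr_gt0 // mulr_gt0.
have e0 := low_eps_gt0 J j.
have e1 : low_eps J j <= 1.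
  have <- : 1 `^ s = 1 :> R by rewrite powR1.
  apply: ler_powr; [exact: ltW|by rewrite divr_ge0 // ltW|].
  by rewrite ler_pdivrMr // mul1r; exact: Hhomo.
have c1e : 0 <= C1 * H j / low_eps J j by rewrite !mulr_ge0 ?invr_ge0 // ltW.
apply: le_trans (@size_ivectors_dense V R S _ (C2 * H j) (low_eps J j) _ _ _) _.
- by rewrite e0 e1.
- rewrite SL; have /andP[_ h] := size_Lv t j; apply: le_trans h _.
  rewrite /C2 mulrDl mulrA mulrAC lerDr mulr_ge0 // ltW //.
- apply: le_trans (_ : C1 * H j / low_eps J j <= _); first by rewrite truncn_le.
  rewrite ler_pM2r ?invr_gt0 // /C2 mulrDl lerDl mulr_ge0 ?divr_ge0 // ltW //.
rewrite ler_expR /low_bits -!mulrA; apply: ler_wpM2l; first exact: ltW.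
set x := H j; set y := H J.
have x0 : 0 < x by exact: H0.
have y0 : 0 < y by exact: H0.
have xy : x <= y by exact: Hhomo.
pose r := (y / x) `^ (2^-1).
have r1 : 1 <= r.
  have <- : 1 `^ (2^-1) = 1 :> R by rewrite powR1.
  by apply: ler_powr; rewrite ?invr_ge0 // ler_pdivlMr // mul1r.
have xr : x `^ (2^-1) * y `^ (2^-1) = x * r.
  rewrite /r -(powR_inv1 (ltW x0)) powRM ?powR_ge0 ?(ltW y0) // -powRrM.
  rewrite mulrCA -{2}(powRr1 (ltW x0)) -powRD; last by rewrite (gt_eqF x0) implybT.
  by rewrite mulrC; congr (_ * _ `^ _); field.
have lnr : - ln (low_eps J j) <= 2 * s * r.
  rewrite /low_eps ln_powR -/x -/y ln_div ?posrE //.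
  have := @ln_sublinear R r (lt_le_trans ltr01 r1).
  rewrite /r ln_powR ln_div ?posrE // -/r => h.
  have := ler_wpM2l (ltW s0) (ltW h); move: (ln x) (ln y) => a b; lra.
rewrite [leRHS]mulrC xr -mulrA; apply: ler_wpM2l; first exact: ltW.
move: (ln _) lnr => z lnr; nra.
Qed.

Lemma low_bits_sum (C2 : R) : 0 < C2 -> exists2 C3, 0 < C3 & forall J,
  \sum_(j < J.+1) low_bits C2 J j <= C3 * H J.
Proof.
move=> C20; have kk : 0 < 2^-1 * kH by rewrite mulr_gt0 // invr_gt0.
have [C C10 h] := rate_sum_head kk (rate_powR 2^-1 HR).
exists (C2 * C) => [|J]; first exact: mulr_gt0.
rewrite /low_bits -mulr_sumr -mulr_suml -!mulrA; apply: ler_wpM2l; first exact: ltW.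
apply: le_trans (ler_wpM2r (powR_ge0 _ _) (h J)) _; apply: eqW.
rewrite -mulrA -powRD; last by rewrite (gt_eqF (H0 _)) implybT.
by congr (_ * _); rewrite -[RHS](powRr1 (ltW (H0 J))); congr (_ `^ _); field.
Qed.

Lemma low_block : exists2 C4, 0 < C4 & forall (V : choiceType) (t : leveled c H V) e J j M,
  (forall x, lev t x = j -> `|e x| <= low_delta J j) ->
  lsum t M (fun x => psum u w t (pred1 j) e x `^ q) <= (C4 * (D j * low_eps J j)) `^ q.
Proof.
pose C := c * C0 * (c / H 0); have Cp : 0 < C by rewrite !mulr_gt0 // invr_gt0.
exists (C `^ q^-1) => [|V t e J j M ed]; first exact: powR_gt0.
have e0 := low_eps_gt0 J j; have d0 := low_delta_gt0 J j.
rewrite -powR_absorb //; last by rewrite mulr_ge0 // ltW.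
apply: le_trans (psum_level c1 H0 q1 u0 w0 t e j (fun j => ltW (W0 j)) hW M) _.
have h : \sum_(y <- Lv t j) `|e y| `^ q <= low_delta J j `^ q * (c * (H j / H 0)).
  have /andP[_ h] := size_Lv t j.
  apply: le_trans _ (ler_wpM2l (powR_ge0 _ _) h).
  rewrite -sum1_size natr_sum mulr_sumr big_seq [leRHS]big_seq; apply: ler_sum => x.
  rewrite mem_Lv mulr1 => /eqP xj; apply: ler_powr; [exact: ltW|by []|exact: ed].
have p0 : 0 <= c * C0 * (u j * W j) `^ q by rewrite !mulr_ge0 ?powR_ge0 // ltW.
apply: le_trans (ler_wpM2l p0 h) _; apply: eqW.
rewrite /D /low_delta !powRM ?mulr_ge0 ?powR_ge0 ?(ltW (u0 _)) ?(ltW (W0 _)) ?(ltW e0) //.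
rewrite -!powRrM.
have -> : (q^-1 - ip) * q = - ip * q + 1 by field; rewrite gt_eqF.
rewrite (@powRD _ (H j)); last by rewrite (gt_eqF (H0 _)) implybT.
by rewrite (powRr1 (ltW (H0 j))) /C; ring.
Qed.

Lemma low_block_sum (C4 : R) : 0 < C4 -> exists2 C5, 0 < C5 & forall J,
  \sum_(j < J.+1) C4 * (D j * low_eps J j) <= C5 * D J.
Proof.
move=> C40; have kk : 0 < kd + s * kH.
  have -> : s * kH = `|kd| + 1 by rewrite /s; field; rewrite gt_eqF.
  have := ler_norm (- kd); rewrite normrN; lra.
have [C C10 h] := rate_sum_head kk (rateM DR (rate_powR s HR)).
exists (C4 * C) => [|J]; first exact: mulr_gt0.
have -> : \sum_(j < J.+1) C4 * (D j * low_eps J j) =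
   C4 * (H J `^ s)^-1 * \sum_(j < J.+1) D j * H j `^ s.
  rewrite mulr_sumr; apply: eq_bigr => j _; rewrite /low_eps.
  rewrite powRM ?invr_ge0 ?(ltW (H0 _)) // -(powR_inv1 (ltW (H0 J))) -powRrM mulN1r powRN; ring.
have p0 : 0 <= C4 * (H J `^ s)^-1 by rewrite mulr_ge0 ?invr_ge0 ?powR_ge0 // ltW.
apply: le_trans (ler_wpM2l p0 (h J)) _; apply: eqW; rewrite /D.
by field; rewrite gt_eqF // powR_gt0.
Qed.

Lemma psum_eq (V : choiceType) (t : leveled c H V) (P Q : pred nat) e x :
  P =1 Q -> psum u w t P e x = psum u w t Q e x.
Proof. by move=> PQ; rewrite /psum; congr (_ * _); apply: eq_bigl => j; exact: PQ. Qed.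

(** The levels up to [J] are rounded one by one and contribute the first term of the
    bound.  Above [J] the groups [gh], the steps [dh], the l_1 bounds [Kh] and the
    number of [bits] are left open: the three regimes differ only there. *)
Lemma upper_assembly : exists C : R, 0 < C /\
  forall (V : choiceType) (t : leveled c H V) (J n Mx Gh : nat) (gh : nat -> nat)
    (dh : nat -> R) (Kh : nat -> nat) (bits bh : nat -> R) (Bh : R),
  let grp j := if (j <= J)%N then j else (J.+1 + gh j)%N in
  let hseq i := level_union t Mx (fun j => grp j == (J.+1 + i)%N) in
  (forall j, (J < j)%N -> (J.+1 + gh j <= j)%N) ->
  (forall j, (J < j)%N -> (gh j < Gh)%N -> (j < Mx)%N) -> (J < Mx)%N ->
  (forall i, 0 < dh i) -> (forall i, 0 < bh i) -> 0 <= Bh ->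
  (forall f i, in_ball t p f -> (i < Gh)%N ->
     (\sum_(x <- hseq i) Num.truncn (`|f x| / dh i) <= Kh i)%N) ->
  (forall f x, in_ball t p f -> (J < lev t x)%N -> (Gh <= gh (lev t x))%N ->
     `|f x| < dh (gh (lev t x))) ->
  (forall i, (i < Gh)%N -> (size (ivectors (hseq i) (Kh i)))%:R <= expR (bits i)) ->
  (forall i, 0 <= bits i) ->
  C * H J + \sum_(i < Gh) bits i <= n.-1%:R * ln 2 ->
  (forall e i M, in_ball t p e ->
     (forall x, (J < lev t x)%N -> gh (lev t x) = i -> `|e x| <= dh i) ->
     lsum t M (fun x => psum u w t (fun j => (J < j)%N && (gh j == i)) e x `^ q) <= bh i `^ q) ->
  (forall G, \sum_(i < G) bh i <= Bh) ->
  (entropy_number (lp_norm p) (lp_norm q%:E) (level_op u w t) n <= (C * D J + Bh)%:E)%E.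
Proof.
have [C1 C10 h1] := low_counts; have [C2 C20 h2] := low_sizes C10.
have [C3 C30 h3] := low_bits_sum C20; have [C4 C40 h4] := low_block.
have [C5 C50 h5] := low_block_sum C40.
exists (C3 + C5); split; first exact: addr_gt0.
move=> V t J n Mx Gh gh dh Kh bits bh Bh grp hseq ghle ghM JM dh0 bh0 Bh0 hK hG hS bits0 hbits hB hBh.
have grpE j g : (g <= J)%N -> (grp j == g) = (j == g).
  move=> gJ; rewrite /grp; case: ifP => // /negbT; rewrite -ltnNge => Jj.
  by rewrite !(low_group_index _ gJ Jj).
have grpH j i : (grp j == (J.+1 + i)%N) = (J < j)%N && (gh j == i).
  rewrite /grp; case: (leqP j J) => [jJ|Jj] /=; last by rewrite eqn_add2l.
  by rewrite high_group_index.
have sub_pos g : (J < g)%N -> g = (J.+1 + (g - J.+1))%N by move=> Jg; rewrite subnKC.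
pose delta g := if (g <= J)%N then low_delta J g else dh (g - J.+1)%N.
pose K g := if (g <= J)%N then Num.truncn (C1 * H g / low_eps J g) else Kh (g - J.+1)%N.
pose b g := if (g <= J)%N then C4 * (D g * low_eps J g) else bh (g - J.+1)%N.
have delta0 g : 0 < delta g by rewrite /delta; case: ifP => // _; exact: low_delta_gt0.
have lb0 g : 0 < C4 * (D g * low_eps J g).
  by rewrite mulr_gt0 // mulr_gt0 ?D0 ?low_eps_gt0.
have b0 g : 0 < b g by rewrite /b; case: ifP.
have lbits0 g : 0 <= low_bits C2 J g.
  by rewrite mulr_ge0 ?mulr_ge0 ?powR_ge0 // ltW.
have gseq g : (g <= J)%N -> group_seq t grp Mx g = level_union t Mx (pred1 g).
  by move=> gJ; rewrite /group_seq /level_union; do 2 congr (_ _); apply: eq_filter => j; exact: grpE.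
have perm_g g : (g <= J)%N -> perm_eq (level_union t Mx (pred1 g)) (Lv t g).
  move=> gJ; apply: uniq_perm; rewrite ?level_union_uniq ?Lv_uniq // => x.
  rewrite mem_level_union mem_Lv /=; apply: andb_idl => /eqP ->.
  exact: leq_ltn_trans gJ JM.
apply: (@entropy_upper _ c H q u w c1 H0 q1 u0 w0 V t grp delta K Mx delta0 p W C0 _ (J.+1 + Gh)) => //.
- rewrite ltr_pwDl // mulr_gt0 ?D0 //; exact: addr_gt0.
- move=> j; rewrite /grp; case: (leqP j J) => [jJ _|Jj]; first exact: leq_ltn_trans jJ JM.
  by rewrite ltn_add2l; exact: ghM.
- move=> f fB g gG; rewrite /K /delta; case: (leqP g J) => [gJ|Jg].
    rewrite gseq // (perm_big _ (perm_g _ gJ)) /=; exact: h1.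
  have E1 := sub_pos _ Jg.
  rewrite {1}E1; apply: hK => //.
  by rewrite ltn_subLR // -addSnnS addSn addnS ltnS -addSn.
- move=> f x fB; rewrite {1}/grp; case: (leqP (lev t x) J) => [lJ|Jl].
    by move=> h; have := leq_trans h lJ; rewrite addSn ltnNge leq_addr.
  rewrite leq_add2l => h; rewrite /grp leqNgt Jl /= /delta leqNgt addSn ltnS leq_addr /=.
  by rewrite -addSn addKn; exact: hG.
- rewrite -(ler_nat R) natr_prod.
  pose bt g := if (g <= J)%N then low_bits C2 J g else bits (g - J.+1)%N.
  apply: (@le_trans _ _ (\prod_(g < J.+1 + Gh) expR (bt g))).
    apply: ler_prod => g _; rewrite ler0n /= /bt /K; case: (leqP g J) => [gJ|Jg].
      by rewrite gseq //; apply: h2 => //; exact: (perm_size (perm_g _ gJ)).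
    have E1 := sub_pos _ Jg; rewrite {1}E1; apply: hS.
    by rewrite ltn_subLR // ltn_ord.
  rewrite -expR_sum natrX -(@lnK _ (2 : R)) ?posrE // -expRM_natl ler_expR.
  have := @sum_piecewise R J (J.+1 + Gh) _ _ lbits0 bits0; rewrite addKn => /le_trans; apply.
  apply: le_trans _ hbits; apply: lerD => //; apply: le_trans (h3 J) _.
  by rewrite ler_pM2r // lerDl ltW.
move=> e eB ed.
apply: (psum_groups q1 u0 w0 (grp := grp) (b := b)) => // [j|G|g M].
- by rewrite /grp; case: (leqP j J) => // Jj; exact: ghle.
- have := @sum_piecewise R J G _ _ (fun g => ltW (lb0 g)) (fun g => ltW (bh0 g)).
  move=> /le_trans; apply; apply: lerD => //; apply: le_trans (h5 J) _.
  by rewrite ler_pM2r ?D0 // lerDr ltW.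
have [gJ|Jg] := leqP g J.
  rewrite /b gJ; under eq_fun do rewrite (psum_eq _ _ _ (fun j => grpE j g gJ)).
  apply: h4 => x xg; have := ed x.
  by rewrite /delta /grp xg gJ gJ.
rewrite /b leqNgt Jg /=.
have E1 := sub_pos _ Jg.
under eq_fun do rewrite {1}E1 (psum_eq _ _ _ (fun j => grpH j (g - J.+1)%N)).
apply: hB => // x Jx ghx; have := ed x.
have -> : grp (lev t x) = (J.+1 + (g - J.+1))%N by rewrite /grp leqNgt Jx /= ghx.
by rewrite /delta leqNgt addSn ltnS leq_addr /= -addSn addKn.
Qed.

End Upper.

(** * Upper bounds for p >= q *)

Lemma dyadic_group (J j i : nat) :
  ((J < j)%N && (trunc_log 2 (j %/ J.+1) == i)) =
  ((2 ^ i * J.+1 <= j) && (j < 2 ^ i.+1 * J.+1))%N.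
Proof.
apply/andP/andP => [[Jj /eqP <-]|[h1 h2]].
  have d0 : (0 < j %/ J.+1)%N by rewrite divn_gt0.
  by rewrite -leq_divRL // -ltn_divLR // trunc_logP //= trunc_log_ltn.
have Jj : (J < j)%N.
  by apply: leq_trans h1; rewrite -{1}(mul1n J.+1) leq_mul2r expn_gt0 orbT.
split => //; apply/eqP/trunc_log_eq => //.
by rewrite leq_divRL // h1 ltn_divLR.
Qed.

Lemma dyadic_group_le (J j : nat) : (J < j)%N -> (J.+1 + trunc_log 2 (j %/ J.+1) <= j)%N.
Proof.
move=> Jj; have := dyadic_group J j (trunc_log 2 (j %/ J.+1)).
rewrite Jj eqxx /= => /esym/andP[h _]; apply: leq_trans h.
move: (trunc_log _ _) => i; have : (i < 2 ^ i)%N by exact: ltn_expl.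
move: (2 ^ i)%N => x ix; nia.
Qed.

Section Upper.
Context {R : realType} (c : R) (H : nat -> R) (q : R) (u w W : nat -> R) (C0 : R) (p : \bar R).
Hypotheses (c1 : 1 <= c) (H0 : forall j, 0 < H j) (q1 : 1 <= q).
Hypothesis Hhomo : {homo H : i j / (i <= j)%N >-> i <= j}.
Hypotheses (u0 : forall j, 0 < u j) (w0 : forall j, 0 < w j) (W0 : forall j, 0 < W j).
Hypotheses (C00 : 0 < C0)
  (hW : forall j M, \sum_(j <= l < M) w l `^ q * H l <= C0 * W j `^ q * H j).
Hypothesis p1 : (1 < p)%E.
Context (kH kd : R).
Hypotheses (kH0 : 0 < kH) (HR : rate lin kH H).
Notation ip := (fine p^-1%E).
Hypothesis DR : rate lin kd (fun j => u j * W j * H j `^ (q^-1 - ip)).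

Let D j := u j * W j * H j `^ (q^-1 - ip).
Let q0 : 0 < q. Proof. exact: lt_le_trans ltr01 q1. Qed.
Let c0 : 0 < c. Proof. exact: lt_le_trans ltr01 c1. Qed.
Let D0 j : 0 < D j. Proof. by rewrite !mulr_gt0 // powR_gt0. Qed.

Lemma ln2_gt0 : 0 < ln 2 :> R.
Proof. by rewrite ln_gt0 // ltr1n. Qed.

(** The step 2 exceeds all values of a function of the ball, so that nothing is rounded
    above [J]. *)
Lemma upper_unrounded : exists2 C : R, 0 < C &
  forall (V : choiceType) (t : leveled c H V) (J n : nat) (gh : nat -> nat) (bh : nat -> R) (Bh : R),
  (forall j, (J < j)%N -> (J.+1 + gh j <= j)%N) ->
  (forall i, 0 < bh i) ->  0 <= Bh ->
  C * H J <= n.-1%:R ->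
  (forall e i M, in_ball t p e ->
     lsum t M (fun x => psum u w t (fun j => (J < j)%N && (gh j == i)) e x `^ q) <= bh i `^ q) ->
  (forall G, \sum_(i < G) bh i <= Bh) ->
  (entropy_number (lp_norm p) (lp_norm q%:E) (level_op u w t) n <= (C * D J + Bh)%:E)%E.
Proof.
have [C [C_0 hC]] := upper_assembly c1 H0 q1 Hhomo u0 w0 W0 C00 hW p1 kH0 HR DR.
have l2 := ln2_gt0.
exists (C + C / ln 2) => [|V t J n gh bh Bh ghle bh0 Bh0 hn hB hBh].
  by rewrite addr_gt0 // divr_gt0.
apply: le_trans (hC V t J n J.+1 0 gh (fun=> 2) (fun=> 0%N) (fun=> 0) bh Bh _ _ _ _ _ _ _ _ _ _ _ _ _) _ => //.
- move=> f x fB _ _; apply: le_lt_trans (in_ball_le1 x p1 fB) _; by rewrite ltr1n.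
- rewrite big_ord0 addr0; apply: le_trans _ (ler_wpM2r (ltW l2) hn).
  rewrite mulrAC; apply: ler_wpM2r; first exact: ltW.
  by rewrite mulrDl divfK ?gt_eqF // lerDr mulr_ge0 // ltW.
- by move=> e i M eB _; exact: hB.
- rewrite lee_fin lerD2r; apply: ler_wpM2r; first exact: ltW (D0 J).
  by rewrite lerDl divr_ge0 // ltW.
Qed.

Lemma upper_ge_geometric : (q%:E <= p)%E -> kd < 0 -> exists2 C : R, 0 < C &
  forall (V : choiceType) (t : leveled c H V) (J n : nat), C * H J <= n.-1%:R ->
  (entropy_number (lp_norm p) (lp_norm q%:E) (level_op u w t) n <= (C * D J)%:E)%E.
Proof.
move=> qp kd0; have [C C_0 hC] := upper_unrounded.
have [C1 C10 h1] := level_holder c1 H0 q1 qp.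
have [C2 C20 h2] := rate_sum_tail kd0 DR.
pose C3 := (c * C0 * C1) `^ q^-1.
have C30 : 0 < C3 by rewrite powR_gt0 // !mulr_gt0.
exists (C + C3 * C2) => [|V t J n hn]; first by rewrite addr_gt0 // mulr_gt0.
have C32 : 0 <= C3 * C2 by rewrite mulr_ge0 // ltW.
rewrite mulrDl; apply: (hC V t J n (fun j => (j - J.+1)%N) (fun i => C3 * D (J.+1 + i)%N)).
- by move=> j Jj; rewrite subnKC.
- by move=> i; rewrite mulr_gt0.
- by rewrite mulr_ge0 // ltW.
- apply: le_trans hn; apply: ler_wpM2r; first exact: ltW.
  by rewrite lerDl.
- move=> e i M eB; set j := (J.+1 + i)%N.
  have -> : (fun x => psum u w t (fun j => (J < j)%N && (j - J.+1 == i)%N) e x `^ q) =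
            (fun x => psum u w t (pred1 j) e x `^ q).
    apply/funext => x; congr (_ `^ _); apply: psum_eq => k /=.
    rewrite /j; apply/andP/eqP => [[Jk /eqP <-]|->]; first by rewrite subnKC.
    by rewrite addKn addSn ltnS leq_addr eqxx.
  apply: le_trans (psum_level c1 H0 q1 u0 w0 t e j (fun j => ltW (W0 j)) hW M) _.
  have p0 : 0 <= c * C0 * (u j * W j) `^ q by rewrite !mulr_ge0 ?powR_ge0 // ltW.
  apply: le_trans (ler_wpM2l p0 (h1 V t e j eB)) _; apply: eqW.
  rewrite /C3 -powR_absorb ?mulr_gt0 ?(ltW (D0 _)) //.
  rewrite /D [in RHS]powRM ?mulr_ge0 ?powR_ge0 ?(ltW (u0 _)) ?(ltW (W0 _)) // -powRrM.
  have -> : (q^-1 - ip) * q = 1 - q * ip by field; rewrite gt_eqF.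
  ring.
- move=> G; rewrite -mulr_sumr -mulrA; apply: ler_wpM2l; first exact: ltW.
  apply: le_trans (h2 J (J.+1 + G)%N); rewrite big_ltn; last by rewrite addSn ltnS leq_addr.
  rewrite -[X in X <= _]add0r; apply: lerD; first exact: ltW (D0 J).
  rewrite -[X in \sum_(X <= _ < _) _]add0n big_addn addKn big_mkord.
  by apply: eqW; apply: eq_bigr => i _; rewrite addnC.
Qed.

(** A regularly varying sequence of negative order is geometric along powers of 2. *)
Lemma dyadic_sum (k : R) (X : nat -> R) : k < 0 -> rate lg k X -> exists2 C, 0 < C &
  forall J G, \sum_(i < G) X (2 ^ i * J.+1)%N <= C * X J.
Proof.
move=> k0 XR; have X0 := XR.1.
have e0 : 0 < - k / 2 by lra.
have [C C_0 hC] := rate_le XR e0.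
pose a := - k / 2 * ln 2; have a0 : 0 < a by rewrite mulr_gt0 // ln2_gt0.
have q10 : 0 < (1 - expR (- a))^-1 by rewrite invr_gt0 subr_gt0 expR_lt1 oppr_lt0.
exists (C * (1 - expR (- a))^-1) => [|J G]; first exact: mulr_gt0.
apply: (@le_trans _ _ (\sum_(i < G) C * X J * expR (- a * i%:R))).
  apply: ler_sum => i _.
  have Jx : (J <= 2 ^ i * J.+1)%N.
    by apply: leq_trans (leqnSn J) _; rewrite -{1}(mul1n J.+1) leq_mul2r expn_gt0 orbT.
  have [h _] := hC _ _ Jx; apply: le_trans h _; rewrite mulrAC; apply: ler_wpM2l.
    by rewrite mulr_ge0 // ltW.
  rewrite ler_expR.
  have : i%:R * ln 2 <= lg (2 ^ i * J.+1) - lg J :> R.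
    rewrite lerBrDr /lg mulr_natl -lnXn // -[X in X <= _]lnM ?posrE ?exprn_gt0 // ler_ln ?posrE ?mulr_gt0 ?exprn_gt0 //.
    by rewrite -natrX -natrM ler_nat.
  rewrite /a; have -> : k + - k / 2 = - (- k / 2) by lra.
  move: (lg _ - lg J) => z hz; rewrite mulNr -mulrA mulNr lerN2 mulrA.
  have := ler_wpM2l (ltW e0) hz; lra.
rewrite -mulr_sumr [leRHS]mulrAC; apply: ler_wpM2l; first by rewrite mulr_ge0 // ltW.
exact: expR_sum_le.
Qed.

(** The block bounds decrease geometrically from one dyadic block to the next. *)
Lemma upper_ge_dyadic (Dm : nat -> R) (k Cb Cd : R) : (q%:E <= p)%E -> k < 0 -> rate lg k Dm ->
  0 < Cb ->
  (forall (V : choiceType) (t : leveled c H V) (e : V -> R) a b M,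
    in_ball t p e -> (b <= 2 * a.+1)%N ->
    lsum t M (fun x => psum u w t (block a b) e x `^ q) <= (Cb * Dm a) `^ q) ->
  (forall j, D j <= Cd * Dm j) ->
  exists2 C : R, 0 < C &
  forall (V : choiceType) (t : leveled c H V) (J n : nat), C * H J <= n.-1%:R ->
  (entropy_number (lp_norm p) (lp_norm q%:E) (level_op u w t) n <= (C * Dm J)%:E)%E.
Proof.
move=> qp k0 DmR Cb0 hb DDm; have Dm0 := DmR.1; have [C C_0 hC] := upper_unrounded.
have [C2 C20 h2] := dyadic_sum k0 DmR.
have Cd0 : 0 < Cd.
  have := DDm 0%N; have := D0 0%N; have := Dm0 0%N.
  move=> x0 y0 h; rewrite -(pmulr_lgt0 _ x0); exact: lt_le_trans h.
exists (C + C * Cd + Cb * C2) => [|V t J n hn].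
  by rewrite !addr_gt0 // mulr_gt0.
have Cb2 : 0 <= Cb * C2 by rewrite mulr_ge0 // ltW.
have CCd : 0 <= C * Cd by rewrite mulr_ge0 // ltW.
apply: le_trans (hC V t J n (fun j => trunc_log 2 (j %/ J.+1)) (fun i => Cb * Dm (2 ^ i * J.+1)%N)
  (Cb * C2 * Dm J) _ _ _ _ _ _) _.
- by move=> j; exact: dyadic_group_le.
- by move=> i; rewrite mulr_gt0.
- by rewrite mulr_ge0 // ltW.
- apply: le_trans hn; apply: ler_wpM2r; first exact: ltW.
  by rewrite -addrA lerDl addr_ge0.
- move=> e i M eB; set a := (2 ^ i * J.+1)%N.
  have -> : (fun x => psum u w t (fun j => (J < j)%N && (trunc_log 2 (j %/ J.+1) == i)) e x `^ q) =
            (fun x => psum u w t (block a (2 * a)) e x `^ q).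
    apply/funext => x; congr (_ `^ _); apply: psum_eq => j.
    by rewrite dyadic_group /block expnS -mulnA.
  by apply: hb => //; rewrite leq_mul2l leqnSn.
- by move=> G; rewrite -mulr_sumr -mulrA; apply: ler_wpM2l => //; exact: ltW.
rewrite lee_fin !mulrDl lerD2r -mulrA; apply: le_trans (ler_wpM2l (ltW C_0) (DDm J)) _.
by rewrite lerDr mulr_ge0 // ltW.
Qed.

End Upper.

(** * Upper bounds for p < q *)

Lemma ivectors0 (V : choiceType) (S : seq V) : size (ivectors S 0) = 1%N.
Proof. by elim: S => // x S IH; rewrite ivectors_cons /= cats0 size_map. Qed.

Lemma rate_unbounded (R : realType) (k : R) (H : nat -> R) : 0 < k -> rate lin k H ->
  forall X, exists j, X < H j.
Proof.
move=> k0 HR X; have H0 := HR.1; have k2 : 0 < k / 2 by lra.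
have [C C_0 hC] := rate_le HR k2.
have C1 : 0 < H 0 / C by apply: divr_gt0.
pose y := (`|X| + 1) / (H 0 / C) / (k / 2).
have y0 : 0 <= y.
  apply: divr_ge0; last exact: ltW.
  by apply: divr_ge0; [exact: addr_ge0|exact: ltW].
exists (Num.truncn y).+1; set j := (Num.truncn y).+1.
have yj : y < j%:R by have /andP[] := truncn_itv y0.
have [_ h] := hC 0%N j (leq0n _).
have e1 : - k + k / 2 = - (k / 2) by lra.
rewrite e1 /lin subr0 mulNr expRN in h.
have h2 : H 0 / C * expR (k / 2 * j%:R) <= H j.
  rewrite mulrAC ler_pdivrMr //; have E0 := expR_gt0 (k / 2 * j%:R).
  apply: le_trans (ler_wpM2r (ltW E0) h) _; apply: eqW.
  by field; rewrite gt_eqF.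
apply: lt_le_trans h2; apply: (@lt_le_trans _ _ (H 0 / C * (k / 2 * j%:R))).
  have : H 0 / C * (k / 2 * y) < H 0 / C * (k / 2 * j%:R) by rewrite !ltr_pM2l.
  apply: le_lt_trans; have -> : H 0 / C * (k / 2 * y) = `|X| + 1.
    by rewrite /y; field; rewrite !gt_eqF.
  have := ler_norm X; lra.
rewrite ler_pM2l //; have := expR_ge1Dx (k / 2 * j%:R); lra.
Qed.

Section Upper.
Context {R : realType} (c : R) (H : nat -> R) (q : R) (u w W : nat -> R) (C0 : R) (r : R).
Hypotheses (c1 : 1 <= c) (H0 : forall j, 0 < H j) (q1 : 1 <= q).
Hypothesis Hhomo : {homo H : i j / (i <= j)%N >-> i <= j}.
Hypotheses (u0 : forall j, 0 < u j) (w0 : forall j, 0 < w j) (W0 : forall j, 0 < W j).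
Hypotheses (C00 : 0 < C0)
  (hW : forall j M, \sum_(j <= l < M) w l `^ q * H l <= C0 * W j `^ q * H j).
Hypotheses (r1 : 1 < r) (rq : r < q).
Context (kH kd : R).
Hypotheses (kH0 : 0 < kH) (HR : rate lin kH H).
Hypothesis dR : rate lin kd (fun j => u j * W j).

Let d j := u j * W j.
Let beta := r^-1 - q^-1.
Let q0 : 0 < q. Proof. exact: lt_le_trans ltr01 q1. Qed.
Let c0 : 0 < c. Proof. exact: lt_le_trans ltr01 c1. Qed.
Let r0 : 0 < r. Proof. exact: lt_trans ltr01 r1. Qed.
Let d0 j : 0 < d j. Proof. by rewrite mulr_gt0. Qed.
Let beta0 : 0 < beta. Proof. by rewrite subr_gt0 ltf_pV2. Qed.

Lemma fine_inv : fine (r%:E)^-1%E = r^-1.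
Proof. by rewrite inver (gt_eqF r0). Qed.

Let DR : rate lin (kd + (q^-1 - r^-1) * kH) (fun j => u j * W j * H j `^ (q^-1 - fine (r%:E)^-1%E)).
Proof. by rewrite fine_inv; exact: rateM dR (rate_powR _ HR). Qed.

Let p1 : (1 < r%:E)%E. Proof. by rewrite lte_fin. Qed.

(** A value that is not rounded to zero has |f| ^ r >= 1 / s. *)
Lemma sparse_counts (V : choiceType) (t : leveled c H V) f M P (s : R) : 0 < s ->
  in_ball t r%:E f ->
  (\sum_(x <- level_union t M P) Num.truncn (`|f x| / s `^ (- r^-1)) <= Num.truncn s)%N.
Proof.
move=> s0 fB; rewrite truncn_ge_nat ?(ltW s0) // natr_sum.
have p0 : 0 < s `^ (- r^-1) by exact: powR_gt0.
apply: (@le_trans _ _ (\sum_(x <- level_union t M P) s * `|f x| `^ r)).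
  apply: ler_sum => x _; set y := `|f x| / _.
  have y0 : 0 <= y by rewrite divr_ge0 // ltW.
  have -> : s * `|f x| `^ r = y `^ r.
    rewrite /y powRM ?invr_ge0 ?(ltW p0) // -powRN opprK -powRrM mulVf ?gt_eqF //.
    by rewrite powRr1 ?(ltW s0) // mulrC.
  have [y1|y1] := ltP y 1.
    suff -> : Num.truncn y = 0%N by exact: powR_ge0.
    by apply/eqP; rewrite -leqn0 -ltnS truncn_lt_nat.
  apply: le_trans (_ : y <= _); first by rewrite truncn_le.
  by apply: le1r_powR => //; exact: ltW.
rewrite -mulr_sumr -[leRHS]mulr1; apply: ler_wpM2l; first exact: ltW.
exact: in_ball_level_union.
Qed.

Lemma sparse_lt1 (V : choiceType) (t : leveled c H V) f x (s : R) : 0 < s -> s < 1 ->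
  in_ball t r%:E f -> `|f x| < s `^ (- r^-1).
Proof.
move=> s0 s1 fB; apply: le_lt_trans (in_ball_le1 x p1 fB) _.
rewrite powRN -[X in X < _]invr1 ltf_pV2 ?posrE ?powR_gt0 //.
have <- : 1 `^ r^-1 = 1 :> R by rewrite powR1.
by apply: gt0_ltr_powR; rewrite ?nnegrE ?invr_gt0 ?(ltW s0).
Qed.

(** Level [j] above [J] is allowed the sparsity s_j = H_J (H_J / H_j) ^ eta.  It costs
    about s_j ln (H_j / s_j) bits, and the error u_j W_j s_j ^ (1 / q - 1 / r) still
    decays for a small eta, because u_j W_j does. *)
Lemma upper_lt_geometric : kd < 0 -> exists2 C : R, 0 < C &
  forall (V : choiceType) (t : leveled c H V) (J n : nat), C * H J <= n.-1%:R ->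
  (entropy_number (lp_norm r%:E) (lp_norm q%:E) (level_op u w t) n <=
     (C * (u J * W J * H J `^ (q^-1 - r^-1)))%:E)%E.
Proof.
move=> kd0; have l2 := @ln2_gt0 R.
have [C [C_0 hC]] := upper_assembly c1 H0 q1 Hhomo u0 w0 W0 C00 hW p1 kH0 HR DR.
(* with this eta, the factor s ^ (- beta) consumes half of the decay of u W *)
pose eta := - kd / 2 / (beta * kH).
have bk : 0 < beta * kH by exact: mulr_gt0.
have eta0 : 0 < eta by rewrite !divr_gt0 // oppr_gt0.
have e2 : 0 < eta / 2 by lra.
have k1 : - (eta / 2) * kH < 0 by rewrite mulNr oppr_lt0 mulr_gt0.
have [C1 C10 h1] := rate_sum_tail k1 (rate_powR (- (eta / 2)) HR).
pose N1 := c / H 0 + 1.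
have N10 : 0 < c / H 0 by rewrite divr_gt0.
have N11 : 1 <= N1 by rewrite lerDr ltW.
have N1p : 0 < N1 by exact: lt_le_trans N11.
have lN1 : 0 <= ln N1 by exact: ln_ge0.
pose Cb := 3 + ln N1 + (1 + eta) / (eta / 2).
have ee : 0 < (1 + eta) / (eta / 2) by rewrite divr_gt0 // addr_gt0.
have Cb0 : 0 < Cb by rewrite addr_gt0 // ltr_pwDl.
have k2 : kd + eta * beta * kH < 0.
  have -> : eta * beta * kH = - kd / 2 by rewrite /eta; field; rewrite !gt_eqF.
  lra.
have [C2 C20 h2] := rate_sum_tail k2 (rateM dR (rate_powR (eta * beta) HR)).
pose C3 := (c * C0) `^ q^-1.
have C30 : 0 < C3 by rewrite powR_gt0 // mulr_gt0.
exists (C + (C + Cb * C1) / ln 2 + C3 * C2) => [|V t J n hn].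
  by rewrite !addr_gt0 // ?mulr_gt0 ?invr_gt0 ?addr_gt0 // mulr_gt0.
pose s i := H J * (H J / H (J.+1 + i)%N) `^ eta.
have HJi i : H J <= H (J.+1 + i)%N by apply: Hhomo; rewrite addSn leqW // leq_addr.
have s0 i : 0 < s i by rewrite mulr_gt0 ?powR_gt0 // divr_gt0.
have s_le i : s i <= H J.
  rewrite -[leRHS]mulr1; apply: ler_wpM2l; first exact: ltW.
  have <- : 1 `^ eta = 1 :> R by rewrite powR1.
  apply: ler_powr; [exact: ltW|by rewrite divr_ge0 // ltW|].
  by rewrite ler_pdivrMr // mul1r.
have [G sG] : exists G, forall i, (G <= i)%N -> s i < 1.
  have [G hG] := rate_unbounded kH0 HR (H J * H J `^ eta^-1).
  exists G => i Gi; rewrite /s.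
  have h : H J * H J `^ eta^-1 < H (J.+1 + i)%N.
    by apply: lt_le_trans hG _; apply: Hhomo; apply: leq_trans Gi (leq_addl _ _).
  have -> : 1 = H J * (H J / (H J * H J `^ eta^-1)) `^ eta.
    rewrite invfM mulrA divff ?gt_eqF // mul1r -powRN -powRrM.
    have -> : - eta^-1 * eta = - 1 by field; rewrite gt_eqF.
    by rewrite powRN powRr1 ?(ltW (H0 _)) // divff // gt_eqF.
  rewrite ltr_pM2l //; apply: gt0_ltr_powR; rewrite ?nnegrE ?divr_ge0 ?mulr_ge0 ?powR_ge0 ?(ltW (H0 _)) //.
  by rewrite ltr_pM2l // ltf_pV2 ?posrE // mulr_gt0 // powR_gt0.
pose bits i := Cb * (H J * (H J / H (J.+1 + i)%N) `^ (eta / 2)).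
pose bh i := C3 * (d (J.+1 + i)%N * s i `^ (- beta)).
have shift (X : nat -> R) G' : (forall j, 0 < X j) ->
    \sum_(i < G') X (J.+1 + i)%N <= \sum_(J <= j < J.+1 + G') X j.
  move=> X0; rewrite [leRHS]big_ltn; last by rewrite addSn ltnS leq_addr.
  rewrite -[X in X <= _]add0r; apply: lerD; first exact: ltW.
  rewrite -[X in \sum_(X <= _ < _) _]add0n big_addn addKn big_mkord.
  by apply: eqW; apply: eq_bigr => i _; rewrite addnC.
have group_eq i : (fun j => (J < j)%N && (j - J.+1 == i)%N) =1 pred1 (J.+1 + i)%N.
  move=> k /=; apply/andP/eqP => [[Jk /eqP <-]|->]; first by rewrite subnKC.
  by rewrite addKn addSn ltnS leq_addr eqxx.
apply: le_trans (hC V t J n (J.+1 + G)%N G (fun j => (j - J.+1)%N) (fun i => s i `^ (- r^-1))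
  (fun i => Num.truncn (s i)) bits bh (C3 * C2 * (d J * H J `^ (- beta))) _ _ _ _ _ _ _ _ _ _ _ _ _) _.
- by move=> j Jj; rewrite subnKC.
- by move=> j Jj h; rewrite -ltn_subLR.
- by rewrite addSn ltnS leq_addr.
- by move=> i; exact: powR_gt0.
- by move=> i; rewrite !mulr_gt0 // powR_gt0.
- by apply: mulr_ge0; [rewrite mulr_ge0 // ltW|rewrite mulr_ge0 ?powR_ge0 // ltW].
- by move=> f i fB iG; exact: sparse_counts.
- by move=> f x fB Jx Gx; apply: (sparse_lt1 x (s0 _) _ fB); exact: sG.
- move=> i iG.
  have SH : (size (level_union t (J.+1 + G) (fun j => (if (j <= J)%N then j else (J.+1 + (j - J.+1))%N) == (J.+1 + i)%N)))%:R
      <= N1 * H (J.+1 + i)%N.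
    have /andP[_ h] := size_Lv t (J.+1 + i).
    apply: le_trans (_ : c * (H (J.+1 + i)%N / H 0) <= _); last first.
      by rewrite mulrCA mulrC /N1 [leRHS]mulrDl lerDl mul1r ltW.
    apply: le_trans h; rewrite ler_nat; apply: uniq_leq_size; first exact: level_union_uniq.
    move=> x; rewrite mem_level_union mem_Lv => /andP[_]; case: leqP => [xJ|Jx].
      by rewrite high_group_index.
    by rewrite subnKC.
  have sN : s i <= N1 * H (J.+1 + i)%N.
    apply: le_trans (s_le i) _; apply: le_trans (HJi i) _.
    by rewrite -{1}(mul1r (H _)) ler_pM2r.
  apply: le_trans (size_ivectors_sparse (s0 i) sN SH _) _; first by rewrite truncn_le ltW.
  rewrite ler_expR /bits.
  set y := H (J.+1 + i)%N; set x := H J; have x0 : 0 < x by exact: H0.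
  have y0 : 0 < y by exact: H0.
  have xy : x <= y by exact: HJi.
  pose L := ln y - ln x.
  have L0 : 0 <= L by rewrite subr_ge0 ler_ln ?posrE.
  have lnE : ln (N1 * y / s i) = ln N1 + (1 + eta) * L.
    rewrite /s -/x -/y ln_div ?posrE ?mulr_gt0 ?powR_gt0 ?divr_gt0 // !lnM ?posrE ?powR_gt0 ?divr_gt0 //.
    rewrite ln_powR ln_div ?posrE // /L; ring.
  have sE : s i = x * (x / y) `^ (eta / 2) * expR (- (eta / 2 * L)).
    rewrite /s -/x -/y -mulrA; congr (_ * _).
    have xy0 : 0 < x / y by exact: divr_gt0.
    have -> : expR (- (eta / 2 * L)) = (x / y) `^ (eta / 2).
      by rewrite /powR gt_eqF // ln_div ?posrE // /L; congr expR; ring.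
    rewrite -powRD; last by rewrite (gt_eqF xy0) implybT.
    by congr (_ `^ _); field.
  rewrite lnE sE -mulrA [leRHS]mulrC; apply: ler_wpM2l; first by rewrite mulr_ge0 ?powR_ge0 ?(ltW x0).
  have hE : expR (- (eta / 2 * L)) * (eta / 2 * L) <= 1.
    rewrite expRN mulrC ler_pdivrMr ?expR_gt0 // mul1r.
    have := expR_ge1Dx (eta / 2 * L); lra.
  have hE1 : expR (- (eta / 2 * L)) <= 1 by rewrite expR_le1 oppr_le0 mulr_ge0 // ltW.
  have hE0 := expR_ge0 (- (eta / 2 * L)).
  have h3 : expR (- (eta / 2 * L)) * (3 + ln N1) <= 3 + ln N1 by rewrite ler_piMl // addr_ge0.
  have h4 : expR (- (eta / 2 * L)) * ((1 + eta) * L) <= (1 + eta) / (eta / 2).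
    have -> : expR (- (eta / 2 * L)) * ((1 + eta) * L) =
      (1 + eta) / (eta / 2) * (expR (- (eta / 2 * L)) * (eta / 2 * L)).
      by field; rewrite gt_eqF.
    by rewrite -[leRHS]mulr1; apply: ler_wpM2l hE; exact: ltW.
  rewrite addrA mulrDr /Cb; exact: lerD.
- by move=> i; rewrite !mulr_ge0 ?powR_ge0 // ltW.
- apply: (@le_trans _ _ ((C + Cb * C1) * H J)).
    rewrite mulrDl lerD2l /bits -mulr_sumr -mulrA; apply: ler_wpM2l; first exact: ltW.
    have -> : \sum_(i < G) H J * (H J / H (J.+1 + i)%N) `^ (eta / 2) =
      H J * H J `^ (eta / 2) * \sum_(i < G) H (J.+1 + i)%N `^ (- (eta / 2)).
      rewrite mulr_sumr; apply: eq_bigr => i _.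
      rewrite powRM ?invr_ge0 ?(ltW (H0 _)) // -[X in _ * (_ * X `^ _)](powR_inv1 (ltW (H0 _))).
      by rewrite -powRrM mulN1r mulrA.
    have p0 : 0 <= H J * H J `^ (eta / 2) by rewrite mulr_ge0 ?powR_ge0 // ltW.
    have X0 j : 0 < H j `^ (- (eta / 2)) by exact: powR_gt0.
    apply: le_trans (ler_wpM2l p0 (le_trans (shift _ G X0) (h1 J _))) _.
    by apply: eqW; rewrite powRN; field; rewrite gt_eqF // powR_gt0.
  apply: le_trans _ (ler_wpM2r (ltW l2) hn); rewrite mulrAC; apply: ler_wpM2r; first exact: ltW.
  have -> : (C + (C + Cb * C1) / ln 2 + C3 * C2) * ln 2 =
      (C + Cb * C1) + (C * ln 2 + C3 * C2 * ln 2) by field; rewrite gt_eqF.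
  by rewrite lerDl addr_ge0 // !mulr_ge0 // ltW.
- move=> e i M eB he; set j := (J.+1 + i)%N.
  have -> : (fun x => psum u w t (fun j => (J < j)%N && (j - J.+1 == i)%N) e x `^ q) =
            (fun x => psum u w t (pred1 j) e x `^ q).
    by apply/funext => x; congr (_ `^ _); exact: psum_eq.
  apply: le_trans (psum_level c1 H0 q1 u0 w0 t e j (fun j => ltW (W0 j)) hW M) _.
  have pp : 0 <= c * C0 * (u j * W j) `^ q by rewrite !mulr_ge0 ?powR_ge0 // ltW.
  have hS : \sum_(y <- Lv t j) `|e y| `^ q <= (s i `^ (- r^-1)) `^ (q - r).
    apply: (@le_trans _ _ ((s i `^ (- r^-1)) `^ (q - r) * \sum_(y <- Lv t j) `|e y| `^ r)).
      rewrite mulr_sumr big_seq [leRHS]big_seq; apply: ler_sum => y; rewrite mem_Lv => /eqP yj.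
      have -> : `|e y| `^ q = `|e y| `^ (q - r) * `|e y| `^ r.
        by rewrite -powRD ?subrK // gt_eqF.
      apply: ler_wpM2r; first exact: powR_ge0.
      apply: ler_powr; [by rewrite subr_ge0 ltW|by []|apply: he].
        by rewrite yj /j addSn ltnS leq_addr.
      by rewrite yj /j addKn.
    rewrite -[leRHS]mulr1; apply: ler_wpM2l; first exact: powR_ge0.
    have := in_ball_level_union j.+1 (pred1 j) eB; rewrite big_level_union.
    rewrite (big_pred1 ord_max) // => k; by rewrite /= -(inj_eq val_inj).
  apply: le_trans (ler_wpM2l pp hS) _; apply: eqW.
  rewrite /bh /C3 -powR_absorb ?mulr_gt0 //; last by rewrite mulr_ge0 ?powR_ge0 // ltW.
  rewrite -[LHS]mulrA; congr (_ * _).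
  rewrite [RHS](powRM _ (ltW (d0 j)) (powR_ge0 _ _)) -!powRrM; congr (_ * _ `^ _).
  by rewrite /beta; field; rewrite !gt_eqF.
- move=> G'; rewrite /bh -mulr_sumr -mulrA; apply: ler_wpM2l; first exact: ltW.
  have -> : \sum_(i < G') d (J.+1 + i)%N * s i `^ (- beta) =
     H J `^ (- beta) * H J `^ (- (eta * beta)) * \sum_(i < G') d (J.+1 + i)%N * H (J.+1 + i)%N `^ (eta * beta).
    rewrite mulr_sumr; apply: eq_bigr => i _; rewrite /s.
    have i0 : 0 <= (H (J.+1 + i)%N)^-1 by rewrite invr_ge0 ltW.
    rewrite (powRM _ (ltW (H0 J)) (powR_ge0 _ _)) -powRrM (powRM _ (ltW (H0 J)) i0).
    rewrite -[X in _ * (_ * (_ * X `^ _))](powR_inv1 (ltW (H0 _))) -powRrM mulrN.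
    have -> : -1 * - (eta * beta) = eta * beta by ring.
    ring.
  have pp : 0 <= H J `^ (- beta) * H J `^ (- (eta * beta)) by rewrite mulr_ge0 ?powR_ge0.
  have X0 j : 0 < d j * H j `^ (eta * beta) by rewrite mulr_gt0 ?powR_gt0.
  apply: le_trans (ler_wpM2l pp (le_trans (shift _ G' X0) (h2 J _))) _.
  apply: eqW; rewrite (powRN _ (eta * beta)) -/(d J); field; rewrite gt_eqF // powR_gt0 //.
rewrite fine_inv lee_fin.
have -> : q^-1 - r^-1 = - beta by rewrite /beta opprB.
rewrite -/(d J) -mulrDl; apply: ler_wpM2r; first by rewrite mulr_ge0 ?powR_ge0 // ltW.
by rewrite lerD2r lerDl divr_ge0 ?addr_ge0 ?mulr_ge0 // ltW //.
Qed.

End Upper.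

Section Upper.
Context {R : realType} (c : R) (H : nat -> R) (q : R) (u w W : nat -> R) (C0 : R) (r : R).
Hypotheses (c1 : 1 <= c) (H0 : forall j, 0 < H j) (q1 : 1 <= q).
Hypothesis Hhomo : {homo H : i j / (i <= j)%N >-> i <= j}.
Hypotheses (u0 : forall j, 0 < u j) (w0 : forall j, 0 < w j) (W0 : forall j, 0 < W j).
Hypotheses (C00 : 0 < C0)
  (hW : forall j M, \sum_(j <= l < M) w l `^ q * H l <= C0 * W j `^ q * H j).
Hypotheses (r1 : 1 < r) (rq : r < q).
Context (kH kk : R).
Hypotheses (kH0 : 0 < kH) (HR : rate lin kH H).
Hypothesis dR : rate lg kk (fun j => u j * W j).
Context (Cb : R).
Hypotheses (Cb0 : 0 < Cb)
  (hb : forall (V : choiceType) (t : leveled c H V) (e : V -> R) a b M delta,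
    in_ball t r%:E e -> (b <= 2 * a.+1)%N -> 0 < delta ->
    (forall x, block a b (lev t x) -> `|e x| <= delta) ->
    lsum t M (fun x => psum u w t (block a b) e x `^ q) <=
    (Cb * (u a * W a * delta `^ (1 - r / q))) `^ q).

Let d j := u j * W j.
Let beta := r^-1 - q^-1.
Let q0 : 0 < q. Proof. exact: lt_le_trans ltr01 q1. Qed.
Let c0 : 0 < c. Proof. exact: lt_le_trans ltr01 c1. Qed.
Let r0 : 0 < r. Proof. exact: lt_trans ltr01 r1. Qed.
Let d0 j : 0 < d j. Proof. by rewrite mulr_gt0. Qed.
Let beta0 : 0 < beta. Proof. by rewrite subr_gt0 ltf_pV2. Qed.
Let DR : rate lin (0 + (q^-1 - r^-1) * kH) (fun j => u j * W j * H j `^ (q^-1 - fine (r%:E)^-1%E)).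
Proof. by rewrite (fine_inv r1); exact: rateM (rate_lg_lin dR) (rate_powR _ HR). Qed.
Let p1 : (1 < r%:E)%E. Proof. by rewrite lte_fin. Qed.

Definition dyad (J i : nat) : nat := (2 ^ i * J.+1)%N.

Lemma dyad_ge J i : (J.+1 <= dyad J i)%N.
Proof. by rewrite /dyad -{1}(mul1n J.+1) leq_mul2r expn_gt0 orbT. Qed.

(** A block of levels around x has at most exp (O (x)) vertices, so that each nonzero
    rounded value there costs O (x) bits. *)
Lemma level_sum_size : exists2 A : R, 1 <= A &
  forall (V : choiceType) (t : leveled c H V) J i M (P : pred nat),
   (forall j, P j -> (j < 2 * dyad J i)%N) ->
   (size (level_union t M P))%:R <= A * expR (4 * kH * (dyad J i)%:R) /\
   H J <= A * expR (4 * kH * (dyad J i)%:R).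
Proof.
have [C C_0 hC] := rate_sum_head kH0 HR; have [C' C'0 hC'] := rate_le HR kH0.
pose A := c / H 0 * C * C' * H 0 + C' * H 0 + 1.
have A1 : 0 < C' * H 0 by exact: mulr_gt0.
have A2 : 0 < c / H 0 * C * C' * H 0 by rewrite !mulr_gt0 // invr_gt0.
have Hx j x : (j <= 2 * x)%N -> H j <= C' * H 0 * expR (4 * kH * x%:R).
  move=> jx; have [h _] := hC' 0%N j (leq0n _); apply: le_trans h _.
  rewrite mulrAC; apply: ler_wpM2l; first exact: ltW.
  rewrite ler_expR /lin subr0; have : j%:R <= 2 * x%:R :> R by rewrite -natrM ler_nat.
  have k20 : 0 <= kH + kH by rewrite addr_ge0 // ltW.
  move=> /(ler_wpM2l k20); lra.
exists A => [|V t J i M P hP]; first by rewrite lerDr addr_ge0 // ltW.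
set x := dyad J i; have x0 : (0 < x)%N by apply: leq_trans (dyad_ge J i).
have E0 := expR_gt0 (4 * kH * x%:R).
split; last first.
  apply: le_trans (Hx J x _) _; first by apply: leq_trans (ltnW (dyad_ge J i)) _; exact: leq_pmull.
  apply: ler_wpM2r; first exact: ltW.
  by rewrite /A; lra.
have -> : (size (level_union t M P))%:R = \sum_(y <- level_union t M P) (1 : R).
  by rewrite big_const_seq count_predT iter_addr_0.
rewrite big_level_union.
apply: (@le_trans _ _ (\sum_(j < (2 * x).-1.+1) c * (H j / H 0))).
  have e : (2 * x).-1.+1 = (2 * x)%N by rewrite prednK // muln_gt0.
  rewrite e; pose f j := c * (H j / H 0).
  have f0 j : 0 <= f j by rewrite mulr_ge0 ?divr_ge0 // ltW.
  apply: (@le_trans _ _ (\sum_(j < M | P j) f j)).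
    apply: ler_sum => j _; have /andP[_] := size_Lv t j.
    by rewrite big_const_seq count_predT iter_addr_0.
  rewrite (big_ord_widen_cond (maxn M (2 * x)) P f) ?leq_maxl //.
  rewrite [leRHS](big_ord_widen (maxn M (2 * x)) f) ?leq_maxr //.
  rewrite [leLHS]big_mkcond [leRHS]big_mkcond; apply: ler_sum => j _ /=.
  case: ifP => [/andP[/hP -> _]//|_]; case: ifP => // _.
rewrite -mulr_sumr -mulr_suml.
apply: (@le_trans _ _ (c * (C * (C' * H 0 * expR (4 * kH * x%:R)) / H 0))).
  apply: ler_wpM2l; first exact: ltW.
  apply: ler_wpM2r; first by rewrite invr_ge0 ltW.
  apply: le_trans (hC _) _; apply: ler_wpM2l; first exact: ltW.
  by apply: Hx; exact: leq_pred.
have -> : c * (C * (C' * H 0 * expR (4 * kH * x%:R)) / H 0) =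
  c / H 0 * C * C' * H 0 * expR (4 * kH * x%:R) by ring.
apply: ler_wpM2r; first exact: ltW.
rewrite /A; lra.
Qed.

(** Here [sq i] is the sparsity of the i-th dyadic block above [J]. *)
Lemma upper_lt_dyadic : exists2 C : R, 0 < C &
  forall (V : choiceType) (t : leveled c H V) (J n G : nat) (sq : nat -> R) (Bh : R),
  (forall i, 0 < sq i) -> (forall i, sq i <= H J) -> (forall i, (G <= i)%N -> sq i < 1) ->
  C * (H J + \sum_(i < G | 1 <= sq i) sq i * (dyad J i)%:R) <= n.-1%:R ->
  (forall G', \sum_(i < G') d (dyad J i) * sq i `^ (- beta) <= Bh) ->
  (entropy_number (lp_norm r%:E) (lp_norm q%:E) (level_op u w t) n <=
     (C * (d J * H J `^ (- beta) + Bh))%:E)%E.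
Proof.
have l2 := @ln2_gt0 R.
have [C [C_0 hC]] := upper_assembly c1 H0 q1 Hhomo u0 w0 W0 C00 hW p1 kH0 HR DR.
have [A A1 hA] := level_sum_size.
have A0 : 0 < A := lt_le_trans ltr01 A1.
have lA : 0 <= ln A by exact: ln_ge0.
pose K := 3 + ln A + 4 * kH.
have k4 : 0 < 4 * kH by rewrite mulr_gt0.
have K0 : 0 < K by rewrite addr_gt0 // ltr_pwDl.
exists (C + (C + K) / ln 2 + Cb) => [|V t J n G sq Bh sq0 sqH sqG hn hBh].
  by rewrite !addr_gt0 // divr_gt0 // addr_gt0.
have Bh0 : 0 <= Bh by have := hBh 0%N; rewrite big_ord0.
pose bits i := if 1 <= sq i then K * (sq i * (dyad J i)%:R) else 0.
pose bh i := Cb * (d (dyad J i) * sq i `^ (- beta)).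
apply: le_trans (hC V t J n (2 ^ G * J.+1)%N G (fun j => trunc_log 2 (j %/ J.+1)) (fun i => sq i `^ (- r^-1))
  (fun i => Num.truncn (sq i)) bits bh (Cb * Bh) _ _ _ _ _ _ _ _ _ _ _ _ _) _.
- by move=> j; exact: dyadic_group_le.
- move=> j Jj; have := dyadic_group J j (trunc_log 2 (j %/ J.+1)).
  rewrite Jj eqxx /= => /esym/andP[_ h] hG; apply: leq_trans h _.
  by rewrite leq_mul2r leq_exp2l // hG orbT.
- exact: dyad_ge.
- by move=> i; exact: powR_gt0.
- by move=> i; rewrite !mulr_gt0 // powR_gt0.
- by rewrite mulr_ge0 // ltW.
- by move=> f i fB iG; exact: sparse_counts.
- by move=> f x fB Jx Gx; apply: (sparse_lt1 r1 x (sq0 _) _ fB); exact: sqG.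
- move=> i iG; rewrite /bits; case: ifPn => [s1|]; last first.
    rewrite -ltNge => s1.
    suff -> : Num.truncn (sq i) = 0%N by rewrite ivectors0 expR0.
    by apply/eqP; rewrite -leqn0 -ltnS truncn_lt_nat // ltW.
  set P := (fun j => _ == _).
  have hP j : P j -> (j < 2 * dyad J i)%N.
    rewrite /P; case: (leqP j J) => [jJ|Jj]; first by rewrite high_group_index.
    rewrite eqn_add2l => h; have := dyadic_group J j i; rewrite Jj h /= => /esym/andP[_].
    by rewrite expnS -mulnA.
  have [hS hH] := hA V t J i (2 ^ G * J.+1)%N P hP.
  apply: le_trans (size_ivectors_sparse (sq0 i) (le_trans (sqH i) hH) hS _) _.
    by rewrite truncn_le ltW.
  rewrite ler_expR mulrCA; apply: ler_wpM2l; first exact: ltW.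
  rewrite ln_div ?posrE ?mulr_gt0 ?expR_gt0 // lnM ?posrE ?expR_gt0 // expRK.
  have ls : 0 <= ln (sq i) by exact: ln_ge0.
  have x1 : 1 <= (dyad J i)%:R :> R by rewrite ler1n (leq_trans _ (dyad_ge J i)).
  have hh : 3 + ln A <= (3 + ln A) * (dyad J i)%:R by rewrite ler_peMr // addr_ge0.
  rewrite /K mulrDl; lra.
- move=> i; rewrite /bits; case: ifP => // _.
  by rewrite mulr_ge0 ?(ltW K0) // mulr_ge0 // ltW.
- have S0 : 0 <= \sum_(i < G | 1 <= sq i) sq i * (dyad J i)%:R.
    by apply: sumr_ge0 => i _; rewrite mulr_ge0 // ltW.
  have -> : \sum_(i < G) bits i = K * \sum_(i < G | 1 <= sq i) sq i * (dyad J i)%:R.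
    rewrite mulr_sumr [RHS]big_mkcond; apply: eq_bigr => i _; rewrite /bits.
    by case: ifP.
  apply: le_trans _ (ler_wpM2r (ltW l2) hn).
  move: (\sum_(i < G | _) _) S0 => S S0.
  have -> : (C + (C + K) / ln 2 + Cb) * (H J + S) * ln 2 =
     (C + K) * (H J + S) + (C + Cb) * (H J + S) * ln 2 by field; rewrite gt_eqF.
  have X1 : 0 <= (C + Cb) * (H J + S) * ln 2.
    by rewrite mulr_ge0 ?(ltW l2) // mulr_ge0 // ?addr_ge0 // ltW.
  have X2 : 0 <= K * H J by rewrite mulr_ge0 // ltW.
  have X3 : 0 <= C * S by rewrite mulr_ge0 // ltW.
  lra.
- move=> e i M eB he; set a := dyad J i.
  have -> : (fun x => psum u w t (fun j => (J < j)%N && (trunc_log 2 (j %/ J.+1) == i)) e x `^ q) =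
            (fun x => psum u w t (block a (2 * a)) e x `^ q).
    apply/funext => x; congr (_ `^ _); apply: psum_eq => j.
    by rewrite dyadic_group /block /a /dyad expnS -mulnA.
  have -> : bh i = Cb * (u a * W a * (sq i `^ (- r^-1)) `^ (1 - r / q)).
    rewrite /bh -/a -powRrM; congr (_ * (_ * _ `^ _)).
    by rewrite /beta; field; rewrite !gt_eqF.
  apply: hb => //; first by rewrite leq_mul2l leqnSn.
    exact: powR_gt0.
  move=> x xa; have : (J < lev t x)%N && (trunc_log 2 (lev t x %/ J.+1) == i).
    by rewrite dyadic_group expnS -mulnA.
  by move=> /andP[h1 /eqP h2]; exact: he.
- by move=> G'; rewrite /bh -mulr_sumr; apply: ler_wpM2l => //; exact: ltW.
rewrite (fine_inv r1) lee_fin.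
have -> : q^-1 - r^-1 = - beta by rewrite /beta opprB.
rewrite -/(d J) [leRHS]mulrDr.
have X1 : 0 <= d J * H J `^ (- beta) by rewrite mulr_ge0 ?powR_ge0 // ltW.
have X2 : 0 <= (C + K) / ln 2 by rewrite divr_ge0 ?addr_ge0 // ltW.
apply: lerD; apply: ler_wpM2r => //; have := ltW Cb0; have := ltW C_0; lra.
Qed.

Lemma lg_dyad J i : i%:R * ln 2 <= lg (dyad J i) - lg J :> R.
Proof.
rewrite lerBrDr /lg mulr_natl -lnXn // -[X in X <= _]lnM ?posrE ?exprn_gt0 //.
by rewrite ler_ln ?posrE ?mulr_gt0 ?exprn_gt0 // -natrX -natrM ler_nat.
Qed.

Lemma dyad_large (X : R) J i : ((Num.truncn X).+1 <= i)%N -> X < (dyad J i)%:R.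
Proof.
move=> Xi; have [X0|X0] := ltP X 0; first exact: lt_le_trans X0 _.
have /andP[_ h] := truncn_itv X0; apply: lt_le_trans h _; rewrite ler_nat.
apply: leq_trans Xi _; apply: leq_trans (ltnW (ltn_expl i (ltnSn 1))) _.
by rewrite /dyad leq_pmulr.
Qed.

(** The sparsities H_J / (J + 1) 2 ^ (- (1 + eta) i) use H_J bits altogether.  The
    first block dominates the error, since the order of u W is below - beta. *)
Lemma upper_lt_dyadic_head : kk + beta < 0 -> exists2 C : R, 0 < C &
  forall (V : choiceType) (t : leveled c H V) (J n : nat), C * H J <= n.-1%:R ->
  (entropy_number (lp_norm r%:E) (lp_norm q%:E) (level_op u w t) n <=
     (C * (d J * H J `^ (- beta) * J.+1%:R `^ beta))%:E)%E.
Proof.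
move=> kb; have l2 := @ln2_gt0 R; have [C C_0 hC] := upper_lt_dyadic.
pose d1 := - (kk + beta); have d10 : 0 < d1 by rewrite oppr_gt0.
have d4 : 0 < d1 / 4 by lra.
pose eta := d1 / 4 / beta; have eta0 : 0 < eta by exact: divr_gt0.
have [C1 C10 h1] := rate_le dR d4.
pose g a : R := (1 - expR (- a))^-1.
have g0 a : 0 < a -> 0 < g a by move=> a0; rewrite invr_gt0 subr_gt0 expR_lt1 oppr_lt0.
have a10 : 0 < eta * ln 2 by exact: mulr_gt0.
have a20 : 0 < d1 / 2 * ln 2 by rewrite mulr_gt0 //; lra.
pose C2 := C1 * g (d1 / 2 * ln 2).
have C20 : 0 < C2 by rewrite mulr_gt0 // g0.
exists (C * (1 + g (eta * ln 2)) + C * (1 + C2)) => [|V t J n hn].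
  by rewrite addr_gt0 // mulr_gt0 // addr_gt0 // g0.
pose x0 := J.+1%:R : R.
have x00 : 0 < x0 by [].
have x01 : 1 <= x0 by rewrite ler1n.
(* the surplus eta makes the number of bits summable over the blocks *)
pose sq i := H J / x0 * expR (- (1 + eta) * ln 2 * i%:R).
have HJ := H0 J.
have sq0 i : 0 < sq i by rewrite mulr_gt0 ?expR_gt0 // divr_gt0.
have eta1 : 0 <= eta * ln 2 by exact: ltW.
have sqE i : sq i * (dyad J i)%:R = H J * expR (- (eta * ln 2) * i%:R).
  rewrite /sq /dyad natrM natrX.
  have -> : 2 ^+ i = expR (ln 2 * i%:R) :> R by rewrite expRM_natr lnK ?posrE.
  have -> : - (eta * ln 2) * i%:R = - (1 + eta) * ln 2 * i%:R + ln 2 * i%:R by ring.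
  by rewrite expRD -/x0; field; rewrite gt_eqF.
have dx i : 1 <= (dyad J i)%:R :> R by rewrite ler1n (leq_trans _ (dyad_ge J i)).
have sqx i : sq i * (dyad J i)%:R <= H J.
  rewrite sqE ler_piMr ?(ltW HJ) // expR_le1 mulNr oppr_le0 mulr_ge0 //.
have hs := hC V t J n (Num.truncn (H J)).+1 sq (C2 * (d J * H J `^ (- beta) * x0 `^ beta)) sq0.
have P0 : 0 <= d J * H J `^ (- beta) by rewrite mulr_ge0 ?powR_ge0 // ltW.
have P1 : d J * H J `^ (- beta) <= d J * H J `^ (- beta) * x0 `^ beta.
  rewrite ler_peMr //; have <- : 1 `^ beta = 1 :> R by rewrite powR1.
  by apply: ler_powr => //; exact: ltW.
have Pb : 0 <= d J * H J `^ (- beta) * x0 `^ beta by rewrite mulr_ge0 ?powR_ge0.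
apply: le_trans (hs _ _ _ _) _.
- move=> i; apply: le_trans (sqx i); rewrite ler_peMr // ltW //.
- move=> i iG; have hx : H J < (dyad J i)%:R by exact: dyad_large.
  have dp : 0 < (dyad J i)%:R :> R by exact: lt_le_trans ltr01 (dx i).
  rewrite -(ltr_pM2r dp) mul1r; exact: le_lt_trans (sqx i) hx.
- apply: le_trans hn; rewrite mulrDl -[leLHS]addr0; apply: lerD; last first.
    by rewrite !mulr_ge0 ?addr_ge0 // ltW.
  rewrite -mulrA; apply: ler_wpM2l; first exact: ltW.
  rewrite mulrDl mul1r lerD2l.
  apply: (@le_trans _ _ (\sum_(i < (Num.truncn (H J)).+1) H J * expR (- (eta * ln 2) * i%:R))).
    rewrite [leLHS]big_mkcond; apply: ler_sum => i _; rewrite sqE; case: ifP => // _.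
    by rewrite mulr_ge0 ?expR_ge0 // ltW.
  rewrite -mulr_sumr mulrC; apply: ler_wpM2r; first exact: ltW.
  exact: expR_sum_le.
- move=> G'.
  apply: (@le_trans _ _ (\sum_(i < G') C1 * (d J * H J `^ (- beta) * x0 `^ beta) *
     expR (- (d1 / 2 * ln 2) * i%:R))).
    apply: ler_sum => i _.
    have [h _] := h1 J (dyad J i) (ltnW (dyad_ge J i)); rewrite -!/(d _) in h.
    have -> : sq i `^ (- beta) = H J `^ (- beta) * x0 `^ beta * expR ((beta + d1 / 4) * ln 2 * i%:R).
      rewrite /sq powRM ?expR_ge0 ?divr_ge0 ?(ltW HJ) // powRM ?invr_ge0 ?(ltW HJ) //.
      rewrite -{1}(powR_inv1 (ltW x00)) -powRrM mulrNN mul1r -expRM; congr (_ * expR _).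
      by rewrite /eta; field; rewrite gt_eqF.
    have h2 : d (dyad J i) <= C1 * expR ((kk + d1 / 4) * ln 2 * i%:R) * d J.
      apply: le_trans h _; apply: ler_wpM2r; first exact: ltW.
      apply: ler_wpM2l; first exact: ltW.
      rewrite ler_expR; have kneg : kk + d1 / 4 <= 0 by rewrite /d1; move: kb (ltW beta0); lra.
      by rewrite -mulrA [ln 2 * _]mulrC; apply: ler_wnM2l => //; exact: lg_dyad.
    have p0 : 0 <= H J `^ (- beta) * x0 `^ beta * expR ((beta + d1 / 4) * ln 2 * i%:R).
      by rewrite !mulr_ge0 ?powR_ge0 ?expR_ge0.
    apply: le_trans (ler_wpM2r p0 h2) _; apply: eqW.
    have -> : - (d1 / 2 * ln 2) * i%:R = (kk + d1 / 4) * ln 2 * i%:R + (beta + d1 / 4) * ln 2 * i%:R.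
      by rewrite /d1; field.
    rewrite expRD; ring.
  rewrite -mulr_sumr /C2 [leRHS]mulrAC; apply: ler_wpM2l; last exact: expR_sum_le.
  by rewrite mulr_ge0 // ltW.
rewrite lee_fin -/x0 [leRHS]mulrDl; apply: ler_wpDl.
  by rewrite mulr_ge0 // mulr_ge0 ?(ltW C_0) // addr_ge0 // ltW // g0.
rewrite -[leRHS]mulrA; apply: ler_wpM2l; first exact: ltW.
by rewrite [leRHS]mulrDl mul1r; apply: lerD.
Qed.

(** The bits are distributed so that the blocks near level H_J get the largest share:
    the error increases up to that level.  Beyond it nothing is rounded, and the
    decay of u W bounds the error. *)
Lemma upper_lt_dyadic_tail : 0 < kk + beta -> kk < 0 -> exists2 C : R, 0 < C &
  forall (V : choiceType) (t : leveled c H V) (J n : nat), C * H J <= n.-1%:R ->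
  J.+1%:R <= H J ->
  (entropy_number (lp_norm r%:E) (lp_norm q%:E) (level_op u w t) n <=
     (C * d (Num.truncn (H J)))%:E)%E.
Proof.
move=> kb kk0; have l2 := @ln2_gt0 R; have [C C_0 hC] := upper_lt_dyadic.
pose d1 := kk + beta; have d4 : 0 < d1 / 4 by rewrite /d1; lra.
pose eta := d1 / 4 / beta; have eta0 : 0 < eta by exact: divr_gt0.
have eta1 : eta < 1 by rewrite /eta ltr_pdivrMr // mul1r /d1; lra.
have kb2 : 0 < - kk / 2 by lra.
have [C1 C10 h1] := rate_le dR d4; have [C2 C20 h2] := rate_le dR kb2.
(* powers of the dyadic points, up to the factor x0 ^ a, as sequences in i *)
pose X a (i : nat) : R := expR (a * lin i).
have XR a : rate lin a (X a) by apply: rate_gauge; exact: lin_homo.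
have a1n : eta * ln 2 != 0 by rewrite gt_eqF // mulr_gt0.
have a2n : d1 / 2 * ln 2 != 0 by rewrite gt_eqF // mulr_gt0 //; lra.
have a3n : kk / 2 * ln 2 != 0 by rewrite lt_eqF // nmulr_rlt0 //; lra.
have [B1 B10 hB1] := rate_sum_bounded a1n (XR _).
have [B2 B20 hB2] := rate_sum_bounded a2n (XR _).
have [B3 B30 hB3] := rate_sum_bounded a3n (XR _).
pose K3 := C2 * 2 `^ (- (kk / 2)) * 2 `^ beta * B3.
have K30 : 0 < K3 by rewrite !mulr_gt0 ?powR_gt0.
pose K2 := C1 * B2; have K20 : 0 < K2 by exact: mulr_gt0.
pose K1 := C1 * 2 `^ beta; have K10 : 0 < K1 by rewrite mulr_gt0 ?powR_gt0.
exists (C * (1 + B1) + C * (K1 + (K2 + K3))) => [|V t J n hn JH].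
  by rewrite addr_gt0 // mulr_gt0 // addr_gt0 // addr_gt0.
pose N := H J; have N0 : 0 < N by exact: H0.
have N1 : 1 <= N by apply: le_trans JH; rewrite ler1n.
pose nu := Num.truncn N.
have /andP[nuN Nnu] := truncn_itv (ltW N0); rewrite -/nu in nuN Nnu.
pose x0 := J.+1%:R : R.
have x00 : 0 < x0 by [].
pose x i : R := (dyad J i)%:R.
have xp i : 0 < x i by rewrite /x ltr0n (leq_trans _ (dyad_ge J i)).
have x1 i : 1 <= x i by rewrite /x ler1n (leq_trans _ (dyad_ge J i)).
have xE a i : x i `^ a = x0 `^ a * X (a * ln 2) i.
  rewrite /x /dyad natrM natrX mulrC powRM // /X; congr (_ * _).
  by rewrite /powR gt_eqF ?exprn_gt0 // lnXn // /lin -mulrA mulr_natr.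
have X_le a Y i : x i `^ a <= Y -> X (a * ln 2) i <= Y / x0 `^ a.
  by rewrite xE ler_pdivlMr ?powR_gt0 // mulrC.
have sum_x a B (Q : pred nat) G Y : 0 < B ->
    (forall b (Q' : pred nat) Y', 0 <= Y' -> (forall j, (j < b)%N -> Q' j -> X (a * ln 2) j <= Y') ->
      \sum_(j < b | Q' j) X (a * ln 2) j <= B * Y') ->
    0 <= Y -> (forall i, Q i -> x i `^ a <= Y) ->
    \sum_(i < G | Q i) x i `^ a <= B * Y.
  move=> B0 hB Y0 hY; under eq_bigr do rewrite xE.
  rewrite -mulr_sumr.
  apply: le_trans (ler_wpM2l (powR_ge0 _ _) (hB G Q (Y / x0 `^ a) _ _)) _.
  - by rewrite divr_ge0 ?powR_ge0.
  - by move=> j _ Qj; apply: X_le; exact: hY.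
  - by apply: eqW; field; rewrite gt_eqF // powR_gt0.
(* the sparsity equals 1 at level N; any value below 1 means no rounding *)
pose sq i := if x i <= N then N `^ (1 - eta) * x i `^ (eta - 1) else 2^-1.
have sq0 i : 0 < sq i by rewrite /sq; case: ifP => _; rewrite ?mulr_gt0 ?powR_gt0 ?invr_gt0.
have pow1 a : 0 <= a -> a <= 1 -> N `^ a <= N.
  by move=> a0 a1; exact: ler1_powR.
have sq_le i : sq i <= N.
  rewrite /sq; case: ifP => _; last by apply: le_trans N1; rewrite invf_le1 // ler1n.
  apply: le_trans (pow1 (1 - eta) _ _); [|lra|lra].
  rewrite ler_piMr ?powR_ge0 //.
  have -> : eta - 1 = - (1 - eta) by ring.
  rewrite powRN invf_le1 ?powR_gt0 //.
  have e1 : 1 `^ (1 - eta) = 1 :> R by rewrite powR1.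
  by rewrite -[leLHS]e1; apply: ler_powr => //; lra.
have sqG i : ((Num.truncn N).+1 <= i)%N -> sq i < 1.
  move=> iG; have : N < x i by exact: dyad_large.
  rewrite /sq ltNge => /negbTE ->; rewrite invf_lt1 // ltr1n //.
have lgle i a : 0 <= a -> x i <= N -> a * (lg nu - lg (dyad J i)) <= a * (ln N - ln (x i)).
  move=> a0 xN; apply: ler_wpM2l => //; rewrite /lg -!ln_div ?posrE //.
  rewrite ler_ln ?posrE ?divr_gt0 // ler_pdivrMr // mulrAC ler_pdivlMr //.
  rewrite -!natr1 -/(x i) mulrDr mulr1 mulrDl mul1r; apply: lerD => //.
  by apply: ler_wpM2r => //; exact: ltW.
have dlow i : x i <= N -> d (dyad J i) <= C1 * N `^ (- kk + d1 / 4) * x i `^ (- (- kk + d1 / 4)) * d nu.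
  move=> xN; have xnu : (dyad J i <= nu)%N by rewrite -ltnS -(ltr_nat R); exact: le_lt_trans xN Nnu.
  have [_ h] := h1 _ _ xnu; rewrite -!/(d _) in h; apply: le_trans h _.
  apply: ler_wpM2r; first exact: ltW.
  rewrite -mulrA; apply: ler_wpM2l; first exact: ltW.
  rewrite /powR !gt_eqF // -expRD ler_expR mulNr -mulrBr; apply: lgle => //; lra.
have dhigh i : N < x i -> d (dyad J i) <= C2 * (2 `^ (- (kk / 2)) * (x i `^ (kk / 2) * N `^ (- (kk / 2)))) * d nu.
  move=> Nx; have xnu : (nu <= dyad J i)%N.
    by rewrite -(ler_nat R); apply: le_trans nuN _; exact: ltW.
  have [h _] := h2 _ _ xnu; rewrite -!/(d _) in h; apply: le_trans h _.
  apply: ler_wpM2r; first exact: ltW.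
  apply: ler_wpM2l; first exact: ltW.
  rewrite /powR !gt_eqF // -!expRD ler_expR.
  have -> : kk + - kk / 2 = kk / 2 by field.
  have -> : - (kk / 2) * ln 2 + (kk / 2 * ln (x i) + - (kk / 2) * ln N) =
    kk / 2 * (ln (x i) - (ln 2 + ln N)) by ring.
  apply: ler_wnM2l; first lra.
  rewrite /lg -(@lnM _ 2 N) ?posrE // -!ln_div ?posrE ?mulr_gt0 //.
  rewrite ler_ln ?posrE ?divr_gt0 ?mulr_gt0 //.
  rewrite ler_pdivrMr ?mulr_gt0 // mulrAC ler_pdivlMr //.
  rewrite -!natr1 -/(x i); apply: ler_pM; rewrite ?ler0n ?(ltW (xp i)) ?lerDl // ?addr_ge0 //.
  lra.
have dJ : d J <= K1 * N `^ beta * d nu.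
  have Jnu : (J <= nu)%N.
    by rewrite -ltnS -(ltr_nat R); apply: le_lt_trans _ Nnu; apply: le_trans JH; rewrite ler_nat.
  have [_ h] := h1 _ _ Jnu; rewrite -!/(d _) in h; apply: le_trans h _.
  apply: ler_wpM2r; first exact: ltW.
  rewrite /K1 -mulrA; apply: ler_wpM2l; first exact: ltW.
  rewrite -powRM ?(ltW N0) // /powR gt_eqF ?mulr_gt0 // ler_expR.
  apply: (@le_trans _ _ (beta * lg nu)).
    have l0 : 0 <= lg J :> R by rewrite ln_ge0 // ler1n.
    have l1 : 0 <= lg nu - lg J :> R by rewrite subr_ge0 lg_homo.
    apply: (@le_trans _ _ (beta * (lg nu - lg J))).
      by apply: ler_wpM2r => //; rewrite /d1; lra.
    apply: ler_wpM2l; first exact: ltW.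
    by rewrite lerBlDr lerDl.
  apply: ler_wpM2l; first exact: ltW.
  rewrite /lg ler_ln ?posrE ?mulr_gt0 // -natr1; lra.
have dnu0 : 0 <= d nu by exact: ltW.
apply: le_trans (hC V t J n (Num.truncn N).+1 sq ((K2 + K3) * d nu) sq0 sq_le sqG _ _) _.
- apply: le_trans hn; rewrite [leRHS]mulrDl -[leLHS]addr0; apply: lerD; last first.
    by rewrite !mulr_ge0 ?addr_ge0 // ltW.
  rewrite -mulrA; apply: ler_wpM2l; first exact: ltW.
  rewrite mulrDl mul1r lerD2l -/N.
  apply: (@le_trans _ _ (\sum_(i < (Num.truncn N).+1 | x i <= N) N `^ (1 - eta) * x i `^ eta)).
    rewrite [leLHS]big_mkcond [leRHS]big_mkcond; apply: ler_sum => i _; rewrite /sq.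
    case: ifPn => [|_]; last by case: ifP => // _; rewrite mulr_ge0 ?powR_ge0.
    case: ifPn => [xN _|_]; last by rewrite invf_ge1 // lern1.
    rewrite -mulrA -/(x i) -{2}(powRr1 (ltW (xp i))) -powRD; last by rewrite (gt_eqF (xp i)) implybT.
    by rewrite subrK.
  rewrite -mulr_sumr.
  have h := sum_x eta B1 (fun i => x i <= N) (Num.truncn N).+1 (N `^ eta) B10 hB1 (powR_ge0 _ _).
  apply: le_trans (ler_wpM2l (powR_ge0 _ _) (h _)) _.
    by move=> i xN; apply: ler_powr => //; exact: ltW.
  rewrite mulrCA -powRD; last by rewrite (gt_eqF N0) implybT.
  by rewrite subrK powRr1 // ltW.
- move=> G'; rewrite (bigID (fun i : 'I_G' => x i <= N)) /= mulrDl; apply: lerD.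
    pose a := d1 / 2.
    apply: (@le_trans _ _ (\sum_(i < G' | x i <= N) C1 * N `^ (- a) * d nu * x i `^ a)).
      apply: ler_sum => i xN; rewrite /sq xN.
      apply: le_trans (ler_wpM2r (powR_ge0 _ _) (dlow i xN)) _.
      rewrite powRM ?powR_ge0 // -!powRrM; apply: eqW.
      have e1 : N `^ (- a) = N `^ (- kk + d1 / 4) * N `^ ((1 - eta) * - beta).
        rewrite -powRD; last by rewrite (gt_eqF N0) implybT.
        by congr (_ `^ _); rewrite /a /eta /d1; field; rewrite gt_eqF.
      have e2 : x i `^ a = x i `^ (- (- kk + d1 / 4)) * x i `^ ((eta - 1) * - beta).
        rewrite -powRD; last by rewrite (gt_eqF (xp i)) implybT.
        by congr (_ `^ _); rewrite /a /eta /d1; field; rewrite gt_eqF.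
      rewrite e1 e2; ring.
    rewrite -mulr_sumr.
    have h := sum_x a B2 (fun i => x i <= N) G' (N `^ a) B20 hB2 (powR_ge0 _ _).
    have p0 : 0 <= C1 * N `^ (- a) * d nu by rewrite !mulr_ge0 ?powR_ge0 // ltW.
    apply: le_trans (ler_wpM2l p0 (h _)) _.
      move=> i xN; apply: ler_powr => //.
      by rewrite /a; lra.
    by apply: eqW; rewrite /K2 powRN; field; rewrite gt_eqF // powR_gt0.
  apply: (@le_trans _ _ (\sum_(i < G' | ~~ (x i <= N))
     C2 * 2 `^ (- (kk / 2)) * 2 `^ beta * N `^ (- (kk / 2)) * d nu * x i `^ (kk / 2))).
    apply: ler_sum => i xN; rewrite /sq (negbTE xN); rewrite -ltNge in xN.
    apply: le_trans (ler_wpM2r (powR_ge0 _ _) (dhigh i xN)) _; apply: eqW.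
    have -> : (2^-1 : R) `^ (- beta) = 2 `^ beta.
      by rewrite -(powR_inv1 (ler0n _ 2)) -powRrM mulrNN mul1r.
    ring.
  rewrite -mulr_sumr.
  have h := sum_x (kk / 2) B3 (fun i => ~~ (x i <= N)) G' (N `^ (kk / 2)) B30 hB3 (powR_ge0 _ _).
  have p0 : 0 <= C2 * 2 `^ (- (kk / 2)) * 2 `^ beta * N `^ (- (kk / 2)) * d nu.
    by rewrite !mulr_ge0 ?powR_ge0 // ltW.
  apply: le_trans (ler_wpM2l p0 (h _)) _.
    move=> i; rewrite -ltNge => Nx.
    have -> : kk / 2 = - (- (kk / 2)) by ring.
    rewrite !(powRN _ (- (kk / 2))) lef_pV2 ?posrE ?powR_gt0 //.
    apply: ler_powr; [lra|exact: ltW|exact: ltW].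
  by apply: eqW; rewrite /K3 (powRN N); field; rewrite gt_eqF // powR_gt0.
rewrite lee_fin -/N -/nu [leRHS]mulrDl; apply: ler_wpDl.
  by rewrite !mulr_ge0 ?addr_ge0 // ltW.
rewrite -[leRHS]mulrA; apply: ler_wpM2l; first exact: ltW.
rewrite [leRHS]mulrDl; apply: lerD => //.
rewrite powRN ler_pdivrMr ?powR_gt0 //.
by apply: le_trans dJ _; rewrite mulrAC.
Qed.

End Upper.

(** * Lower bounds *)

Section Lower.
Context {R : realType} (c : R) (H : nat -> R) (q : R) (u w W : nat -> R) (p : \bar R).
Hypotheses (c1 : 1 <= c) (H0 : forall j, 0 < H j) (q1 : 1 <= q).
Hypotheses (u0 : forall j, 0 < u j) (w0 : forall j, 0 < w j) (W0 : forall j, 0 < W j).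
Hypothesis p1 : (1 < p)%E.
Notation ip := (fine p^-1%E).

Let q0 : 0 < q. Proof. exact: lt_le_trans ltr01 q1. Qed.
Let c0 : 0 < c. Proof. exact: lt_le_trans ltr01 c1. Qed.

(** The normalisation of a radial function in l_p, uniformly in p, where the case
    p = +oo is a pointwise statement. *)
Lemma sum_pow_inv_exponent (K : R) (M J : nat) (X : nat -> R) : 0 < K ->
  (forall l, 0 < X l) ->
  match p return Prop with
  | r%:E => \sum_(J <= l < M) X l * ((K * X l) `^ (- ip)) `^ r = \sum_(J <= l < M) K^-1
  | _ => forall l, (K * X l) `^ (- ip) = 1
  end.
Proof.
move=> K0 X0; case: p p1 => [r| |] //= r1; last first.
  by move=> l; rewrite ?invey /= oppr0 powRr0.
have r0 : r != 0 by rewrite gt_eqF // (lt_trans ltr01) // -lte_fin.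
apply: eq_bigr => l _; rewrite -powRrM inver (negbTE r0) /= mulNr mulVf //.
by rewrite powR_inv1 ?mulr_ge0 ?ltW // invfM mulrCA divff ?mulr1 // gt_eqF.
Qed.

(** The radial function lives on level [J] only.  With k = 1 this is the bound at a
    level of about n vertices; a larger k trades the number s of selected vertices
    for a deeper level. *)
Lemma lower_single (C0 : R) : 0 < C0 ->
  (forall J, exists2 M, (J < M)%N &  W J `^ q * H J <= C0 * \sum_(J <= l < M) w l `^ q * H l) ->
  exists2 C : R, 0 < C &
  forall (V : choiceType) (t : leveled c H V) (J s k n : nat),
  (0 < s)%N -> (n <= k * s)%N -> (0 < n)%N -> (s * 4 ^ k.+1 <= size (Lv t J))%N ->
  ((C * (u J * W J * s%:R `^ (q^-1 - ip)))%:E <=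
    entropy_number (lp_norm p) (lp_norm q%:E) (level_op u w t) n)%E.
Proof.
move=> C00 hW.
pose C := (c^-1 / 2 / C0) `^ q^-1 * c `^ (- ip) / 2.
have Cp : 0 < c^-1 / 2 / C0 by rewrite !divr_gt0 // invr_gt0.
exists C => [|V t J s k n s0 nks n0 sJ].
  by rewrite /C divr_gt0 // mulr_gt0 // powR_gt0.
have [M JM hM] := hW J.
have sp : 0 < s%:R :> R by rewrite ltr0n.
(* normalised by s c a ^ p = 1 *)
pose a := (s%:R * c) `^ (- ip).
have a0 : 0 < a by rewrite powR_gt0 // mulr_gt0.
pose g l := if l == J then a else 0.
have g0 l : 0 <= g l by rewrite /g; case: ifP => // _; exact: ltW.
have inner l : (J <= l)%N -> \sum_(J <= j < l.+1) u j * g j = u J * a.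
  move=> Jl; rewrite big_ltn // big_nat_cond big1 ?addr0; first by rewrite /g eqxx.
  by move=> j /andP[/andP[Jj _] _]; rewrite /g gtn_eqF // mulr0.
pose S := \sum_(J <= l < M) H l / H J * (w l * \sum_(J <= j < l.+1) u j * g j) `^ q.
have SE : S = (u J * a) `^ q / H J * \sum_(J <= l < M) w l `^ q * H l.
  rewrite /S mulr_sumr; apply: eq_big_nat => l /andP[Jl _]; rewrite inner //.
  rewrite powRM ?(ltW (w0 _)) ?mulr_ge0 ?(ltW (u0 _)) ?(ltW a0) //; ring.
have S_ge : (u J * a * W J) `^ q / C0 <= S.
  rewrite SE ler_pdivrMr // powRM ?mulr_ge0 ?(ltW (W0 _)) ?(ltW (u0 _)) ?(ltW a0) //.
  have pp : 0 <= (u J * a) `^ q / H J by rewrite mulr_ge0 ?powR_ge0 // invr_ge0 ltW.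
  have := ler_wpM2l pp hM.
  have -> : (u J * a) `^ q / H J * (W J `^ q * H J) = (u J * a) `^ q * W J `^ q.
    by field; rewrite gt_eqF.
  by move=> /le_trans; apply; apply: eqW; ring.
have S0 : 0 < S.
  by apply: lt_le_trans S_ge; rewrite divr_gt0 // powR_gt0 // !mulr_gt0.
have := @entropy_lower_radial R c H q u w c1 H0 q1 u0 w0 V t p J s k n M g p1 s0 nks n0 sJ g0 _ _ S0.
move=> h; apply: le_trans (h _ _) => {h}; last first.
- have := @sum_pow_inv_exponent (s%:R * c) J.+1 J (fun=> 1); rewrite /g /a.
  case: p p1 => [r| |] //= r1 h; last first.
    move=> l; case: ifP => // _; rewrite -[X in X `^ _]mulr1 h ?mulr_gt0 // => _; exact: ltr01.
  have rr : r != 0 by rewrite gt_eqF // (lt_trans ltr01) // -lte_fin.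
  have := h (mulr_gt0 sp c0) (fun=> ltr01); rewrite !big_nat1 mul1r mulr1 => h1.
  rewrite big_ltn // eqxx h1 divff ?mul1r ?gt_eqF // big_nat_cond big1.
    by rewrite addr0 divff // gt_eqF // mulr_gt0.
  by move=> l /andP[/andP[Jl _] _]; rewrite gtn_eqF // powR0 ?mulr0.
- by move=> l Ml; rewrite /g gtn_eqF // (leq_trans JM).
rewrite lee_fin -/S /C.
have -> : (c^-1 / 2 / C0) `^ q^-1 * c `^ (- ip) / 2 * (u J * W J * s%:R `^ (q^-1 - ip)) =
  (c^-1 * (s%:R / 2) * ((u J * a * W J) `^ q / C0)) `^ q^-1 / 2.
  have -> : c^-1 * (s%:R / 2) * ((u J * a * W J) `^ q / C0) =
    c^-1 / 2 / C0 * (s%:R * (u J * a * W J) `^ q) by ring.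
  rewrite [X in _ = X / 2]powRM ?(ltW Cp) ?mulr_ge0 ?powR_ge0 ?ler0n //.
  rewrite [X in _ = _ * X / 2]powRM ?powR_ge0 ?ler0n // -powRrM divff ?gt_eqF // powRr1; last first.
    by rewrite !mulr_ge0 // ltW.
  rewrite /a powRM ?ler0n ?(ltW c0) // powRD; last by rewrite (gt_eqF sp) implybT.
  ring.
rewrite ler_pM2r ?invr_gt0 //; apply: ler_powr; first by rewrite invr_ge0 ltW.
  by rewrite !mulr_ge0 ?powR_ge0 ?invr_ge0 ?(ltW c0) ?(ltW C00).
apply: ler_wpM2l S_ge; by rewrite !mulr_ge0 ?invr_ge0 ?(ltW c0).
Qed.

(** The power mean of 1, ..., K is at least their mean. *)
Lemma sum_pow_ge (K : nat) : K%:R `^ (q + 1) / 2 `^ q <= \sum_(i < K) i.+1%:R `^ q :> R.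
Proof.
have [->|K0] := posnP K.
  by rewrite big_ord0 powR0 ?mul0r // gt_eqF // addr_gt0.
have Kp : 0 < K%:R :> R by rewrite ltr0n.
have := @power_mean R 'I_K (index_enum 'I_K) predT q (fun=> 1) (fun i : 'I_K => i.+1%:R) q1 (fun _ _ => ler01) (fun _ _ => ler0n _ _).
under eq_bigr do rewrite mul1r.
under [X in _ <= _ * X -> _]eq_bigr do rewrite mul1r.
have -> : \sum_(i < K) (1 : R) = K%:R by rewrite sumr_const card_ord.
have -> : \sum_(i < K) (i.+1%:R : R) = K%:R * (K%:R + 1) / 2.
  elim: (K) => [|n IH]; first by rewrite big_ord0 !mul0r.
  by rewrite big_ord_recr /= IH -!natr1; field.
move=> h; have h2 : (K%:R * K%:R / 2) `^ q <= (K%:R * (K%:R + 1) / 2) `^ q :> R.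
  apply: ler_powr; [exact: ltW|by rewrite !mulr_ge0|].
  by rewrite ler_pM2r ?invr_gt0 // ler_pM2l // lerDl.
have {h h2} := le_trans h2 h.
have -> : (K%:R * K%:R / 2) `^ q = K%:R `^ (q - 1) * (K%:R `^ (q + 1) / 2 `^ q) :> R.
  rewrite [LHS]powRM ?mulr_ge0 ?invr_ge0 ?ler0n // -(powR_inv1 (ler0n _ 2)) -powRrM mulN1r powRN.
  rewrite mulrA powRM ?ler0n // -!powRD; try by rewrite (gt_eqF Kp) implybT.
  by congr (_ `^ _ / _); ring.
by rewrite ler_pM2l // powR_gt0.
Qed.

(** The radial function is H_j ^ (- 1 / p) on the levels j = J, ..., 2 J + 1, up to
    normalisation. *)
Lemma lower_spread (Psi : nat -> R) (C0 : R) : 0 < C0 -> (forall J, 0 < Psi J) ->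
  (forall J, Psi J `^ q <= C0 * \sum_(J <= l < 2 * J.+1)
     H l * (w l * \sum_(J <= j < l.+1) u j * H j `^ (- ip)) `^ q) ->
  exists2 C : R, 0 < C &
  forall (V : choiceType) (t : leveled c H V) (J s n : nat),
  (0 < s)%N -> (n <= s)%N -> (0 < n)%N -> (s * 16 <= size (Lv t J))%N ->
  ((C * (Psi J * J.+1%:R `^ (- ip) * (s%:R / H J) `^ (q^-1 - ip)))%:E <=
    entropy_number (lp_norm p) (lp_norm q%:E) (level_op u w t) n)%E.
Proof.
move=> C00 Psi0 hPsi.
pose C := (c^-1 / 2 / C0) `^ q^-1 * (c * 2) `^ (- ip) / 2.
have Cp : 0 < c^-1 / 2 / C0 by rewrite !divr_gt0 // invr_gt0.
exists C => [|V t J s n s0 ns n0 sJ].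
  by rewrite /C divr_gt0 // mulr_gt0 // powR_gt0 // mulr_gt0.
have sp : 0 < s%:R :> R by rewrite ltr0n.
set M := (2 * J.+1)%N; have JM : (J < M)%N by rewrite /M mul2n -addnn addSn ltnS leq_addr.
pose K := s%:R * c * (2 * J.+1%:R).
have K0 : 0 < K by rewrite !mulr_gt0.
pose g l := if (l < M)%N then (K * (H l / H J)) `^ (- ip) else 0.
have HH l : 0 < H l / H J by rewrite divr_gt0.
have g0 l : 0 <= g l by rewrite /g; case: ifP => // _; exact: powR_ge0.
pose S := \sum_(J <= l < M) H l / H J * (w l * \sum_(J <= j < l.+1) u j * g j) `^ q.
have in0 l : 0 <= \sum_(J <= j < l.+1) u j * H j `^ (- ip).
  by apply: sumr_ge0 => j _; rewrite mulr_ge0 ?powR_ge0 // ltW.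
pose L := K / H J; have L0 : 0 < L by rewrite divr_gt0.
have SE : S = (L `^ (- ip)) `^ q / H J * \sum_(J <= l < M)
     H l * (w l * \sum_(J <= j < l.+1) u j * H j `^ (- ip)) `^ q.
  rewrite /S mulr_sumr; apply: eq_big_nat => l /andP[Jl lM].
  have -> : \sum_(J <= j < l.+1) u j * g j = L `^ (- ip) * \sum_(J <= j < l.+1) u j * H j `^ (- ip).
    rewrite mulr_sumr; apply: eq_big_nat => j /andP[_ jl].
    rewrite /g (leq_ltn_trans _ lM) // (_ : K * (H j / H J) = L * H j); last by rewrite /L; ring.
    by rewrite powRM ?(ltW L0) ?(ltW (H0 _)) // mulrCA.
  rewrite mulrCA [X in _ * X]powRM ?powR_ge0 ?mulr_ge0 ?(ltW (w0 _)) //; ring.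
have S_ge : (L `^ (- ip) * Psi J) `^ q / H J / C0 <= S.
  rewrite SE ler_pdivrMr // powRM ?powR_ge0 ?(ltW (Psi0 _)) //.
  have pp : 0 <= (L `^ (- ip)) `^ q / H J by rewrite mulr_ge0 ?powR_ge0 // invr_ge0 ltW.
  have := ler_wpM2l pp (hPsi J); rewrite -/M.
  rewrite mulrAC => /le_trans; apply; apply: eqW; ring.
have S0 : 0 < S.
  by apply: lt_le_trans S_ge; rewrite !divr_gt0 // powR_gt0 // !mulr_gt0 // powR_gt0.
have ns1 : (n <= 1 * s)%N by rewrite mul1n.
have := @entropy_lower_radial R c H q u w c1 H0 q1 u0 w0 V t p J s 1 n M g p1 s0 ns1 n0 sJ g0 _ _ S0.
move=> h; apply: le_trans (h _ _) => {h}; last first.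
- have := @sum_pow_inv_exponent K M J (fun l => H l / H J) K0 HH.
  rewrite /g; case: p p1 => [r| |] //= r1 h; last first.
    by move=> l; case: ifP => // _; rewrite h.
  have -> : \sum_(J <= l < M) H l / H J * (if (l < M)%N then (K * (H l / H J)) `^ (- fine (r%:E)^-1%E) else 0) `^ r =
      \sum_(J <= l < M) H l / H J * ((K * (H l / H J)) `^ (- fine (r%:E)^-1%E)) `^ r.
    by apply: eq_big_nat => l /andP[_ ->].
  rewrite h big_const_nat iter_addr_0 -[_ *+ (M - J)]mulr_natr.
  rewrite mulrCA mulrC ler_pdivrMr // mul1r /K; apply: ler_wpM2l; first by rewrite mulr_ge0 // ltW.
  by rewrite -natrM ler_nat leq_subr.
- by move=> l Ml; rewrite /g ltnNge Ml.
rewrite lee_fin -/S /C.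
have -> : (c^-1 / 2 / C0) `^ q^-1 * (c * 2) `^ (- ip) / 2 *
   (Psi J * J.+1%:R `^ (- ip) * (s%:R / H J) `^ (q^-1 - ip)) =
  (c^-1 * (s%:R / 2) * ((L `^ (- ip) * Psi J) `^ q / H J / C0)) `^ q^-1 / 2.
  have -> : c^-1 * (s%:R / 2) * ((L `^ (- ip) * Psi J) `^ q / H J / C0) =
    c^-1 / 2 / C0 * (s%:R / H J * (L `^ (- ip) * Psi J) `^ q) by ring.
  have sH : 0 < s%:R / H J by rewrite divr_gt0.
  rewrite [X in _ = X / 2]powRM ?(ltW Cp) ?mulr_ge0 ?powR_ge0 ?ler0n ?(ltW sH) ?invr_ge0 ?(ltW (H0 _)) //.
  rewrite [X in _ = _ * X / 2]powRM ?powR_ge0 ?(ltW sH) // -powRrM divff ?gt_eqF // powRr1; last first.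
    by rewrite !mulr_ge0 ?powR_ge0 // ltW.
  have -> : L = c * 2 * (J.+1%:R * (s%:R / H J)) by rewrite /L /K; ring.
  rewrite (@powRM _ (c * 2)) ?mulr_ge0 ?ler0n ?(ltW c0) ?invr_ge0 ?(ltW (H0 _)) //.
  rewrite (@powRM _ J.+1%:R) ?ler0n ?(ltW sH) //.
  rewrite powRD; last by rewrite (gt_eqF sH) implybT.
  ring.
rewrite ler_pM2r ?invr_gt0 //; apply: ler_powr; first by rewrite invr_ge0 ltW.
  by rewrite !mulr_ge0 ?powR_ge0 ?invr_ge0 ?(ltW c0) ?(ltW C00) ?(ltW (H0 _)).
apply: ler_wpM2l S_ge; by rewrite !mulr_ge0 ?invr_ge0 ?(ltW c0).
Qed.

(** In the inner sum the term j = l suffices, and the J + 1 levels of the block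
    contribute equally. *)
Lemma spread_noncritical (k1 : R) :
  rate lg k1 (fun j => u j * w j * H j `^ (q^-1 - ip)) ->
  exists2 C0, 0 < C0 & forall J,
   (u J * w J * H J `^ (q^-1 - ip) * J.+1%:R `^ q^-1) `^ q <= C0 * \sum_(J <= l < 2 * J.+1)
     H l * (w l * \sum_(J <= j < l.+1) u j * H j `^ (- ip)) `^ q.
Proof.
pose D j := u j * w j * H j `^ (q^-1 - ip).
move=> DR; have D0 j : 0 < D j by exact: DR.1.
have [C C_0 hC] := rate_block 2 DR; exists (C `^ q) => [|J]; first exact: powR_gt0.
rewrite -/(D J) powRM ?powR_ge0 ?(ltW (D0 _)) // -powRrM mulVf ?gt_eqF // powRr1 ?ler0n //.
apply: (@le_trans _ _ (C `^ q * \sum_(J <= l < 2 * J.+1) (D J / C) `^ q)).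
  rewrite big_const_nat iter_addr_0 -[_ *+ (_ - J)]mulr_natr mulrA -powRM ?divr_ge0 ?(ltW C_0) ?(ltW (D0 _)) //.
  rewrite mulrCA divff ?gt_eqF // mulr1; apply: ler_wpM2l; first exact: powR_ge0.
  by rewrite ler_nat mul2n -addnn -addnBA // (leq_trans _ (leq_addr _ _)).
apply: ler_wpM2l; first exact: powR_ge0.
apply: ler_sum_nat => l /andP[Jl lM].
apply: (@le_trans _ _ (D l `^ q)).
  apply: ler_powr; [exact: ltW|by rewrite divr_ge0 // ltW|].
  by rewrite ler_pdivrMr // mulrC; have [] := hC _ _ Jl lM.
have -> : D l `^ q = H l * (w l * (u l * H l `^ (- ip))) `^ q.
  have -> : D l = H l `^ q^-1 * (w l * (u l * H l `^ (- ip))).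
    rewrite /D powRD; last by rewrite (gt_eqF (H0 _)) implybT.
    ring.
  rewrite [LHS]powRM ?powR_ge0 //; last by rewrite !mulr_ge0 ?powR_ge0 // ltW.
  by rewrite -powRrM mulVf ?gt_eqF // powRr1 // ltW.
apply: ler_wpM2l; first exact: ltW.
apply: ler_powr; [exact: ltW|by rewrite !mulr_ge0 ?powR_ge0 // ltW|].
apply: ler_wpM2l; first exact: ltW.
rewrite big_nat_recr //= lerDr; apply: sumr_ge0 => j _.
by rewrite mulr_ge0 ?powR_ge0 // ltW.
Qed.

(** The inner sum has l - J + 1 comparable terms, so that its q-th powers add up to
    the power q + 1 of the length of the block. *)
Lemma spread_critical (k1 k2 : R) :
  rate lg k1 (fun j => u j * H j `^ (- ip)) -> rate lg k2 (fun j => w j `^ q * H j) ->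
  exists2 C0, 0 < C0 & forall J,
   (u J * w J * H J `^ (q^-1 - ip) * J.+1%:R `^ (1 + q^-1)) `^ q <= C0 * \sum_(J <= l < 2 * J.+1)
     H l * (w l * \sum_(J <= j < l.+1) u j * H j `^ (- ip)) `^ q.
Proof.
pose v j := u j * H j `^ (- ip); pose z j := w j `^ q * H j.
move=> vR zR; have v0 j : 0 < v j by exact: vR.1.
have z0 j : 0 < z j by exact: zR.1.
have [C C_0 hC] := rate_block 2 vR; have [B B_0 hB] := rate_block 2 zR.
exists (B * C `^ q * 2 `^ q) => [|J]; first by rewrite !mulr_gt0 ?powR_gt0.
have -> : (u J * w J * H J `^ (q^-1 - ip) * J.+1%:R `^ (1 + q^-1)) `^ q =
   z J * v J `^ q * J.+1%:R `^ (q + 1).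
  have -> : u J * w J * H J `^ (q^-1 - ip) * J.+1%:R `^ (1 + q^-1) =
     v J * (w J * (H J `^ q^-1 * J.+1%:R `^ (1 + q^-1))).
    rewrite /v powRD; last by rewrite (gt_eqF (H0 _)) implybT.
    ring.
  rewrite (powRM _ (ltW (v0 J))) ?mulr_ge0 ?powR_ge0 ?(ltW (w0 _)) //.
  rewrite (powRM _ (ltW (w0 J))) ?mulr_ge0 ?powR_ge0 // powRM ?powR_ge0 // -!powRrM mulVf ?gt_eqF //.
  rewrite powRr1 ?(ltW (H0 _)) // mulrDl mul1r mulVf ?gt_eqF // /z; ring.
pose F l := (l - J).+1%:R `^ q : R.
apply: (@le_trans _ _ (z J * v J `^ q * (2 `^ q * \sum_(J <= l < 2 * J.+1) F l))).
  apply: ler_wpM2l; first by rewrite mulr_ge0 ?powR_ge0 // ltW.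
  rewrite -ler_pdivrMl ?powR_gt0 // mulrC; apply: le_trans (sum_pow_ge J.+1) _.
  rewrite -[X in \sum_(X <= _ < _) _]add0n big_addn big_mkord.
  have e : (J.+1 <= 2 * J.+1 - J)%N by rewrite mul2n -addnn -addnBA // ?leqnSn // leq_addr.
  rewrite (big_ord_widen _ (fun i => i.+1%:R `^ q) e) /= big_mkcond /=; apply: ler_sum => i _.
  rewrite /F addnK; case: ifP => // _; exact: powR_ge0.
have -> : z J * v J `^ q * (2 `^ q * \sum_(J <= l < 2 * J.+1) F l) =
   B * C `^ q * 2 `^ q * \sum_(J <= l < 2 * J.+1) z J / B * ((v J / C) `^ q * F l).
  rewrite !mulr_sumr; apply: eq_bigr => l _.
  rewrite (@powRM _ (v J)) ?invr_ge0 ?(ltW C_0) ?(ltW (v0 _)) //.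
  rewrite -(powR_inv1 (ltW C_0)) -powRrM mulN1r powRN; field.
  by rewrite !gt_eqF // powR_gt0.
apply: ler_wpM2l; first by rewrite !mulr_ge0 ?powR_ge0 // ltW.
apply: ler_sum_nat => l /andP[Jl lM].
have -> : H l * (w l * \sum_(J <= j < l.+1) u j * H j `^ (- ip)) `^ q =
   z l * (\sum_(J <= j < l.+1) v j) `^ q.
  rewrite powRM ?(ltW (w0 _)) //; first by rewrite /z; ring.
  by apply: sumr_ge0 => j _; exact: ltW (v0 j).
apply: ler_pM.
- by rewrite divr_ge0 // ltW.
- by rewrite mulr_ge0 ?powR_ge0.
- by rewrite ler_pdivrMr // mulrC; have [] := hB _ _ Jl lM.
rewrite /F -powRM ?divr_ge0 ?(ltW C_0) ?(ltW (v0 _)) //; apply: ler_powr; first exact: ltW.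
  by rewrite mulr_ge0 ?divr_ge0 ?(ltW C_0) ?(ltW (v0 _)).
apply: (@le_trans _ _ (\sum_(J <= j < l.+1) v J / C)).
  by rewrite big_const_nat iter_addr_0 -[leRHS]mulr_natr subSn.
apply: ler_sum_nat => j /andP[Jj jl].
rewrite ler_pdivrMr // mulrC.
have jM : (j.+1 <= 2 * J.+1)%N by exact: leq_trans jl lM.
by have [] := hC _ _ Jj jM.
Qed.

End Lower.

(** * Sequences regular on two scales *)

Section Reg.
Context {R : realType}.
Implicit Types (a b al be : R) (X Y : nat -> R).

(** The two scales of the weights: an exponential, times a regularly varying factor. *)
Definition reg a al X := rate lg al (fun j => X j * expR (- (a * lin j))).

Lemma reg_gt0 a al X : reg a al X -> forall j, 0 < X j.
Proof. by move=> [h _] j; have := h j; rewrite pmulr_lgt0 // expR_gt0. Qed.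

Lemma regM a al b be X Y : reg a al X -> reg b be Y ->
  reg (a + b) (al + be) (fun j => X j * Y j).
Proof.
move=> hX hY; have := rateM hX hY; rewrite /reg.
congr rate; apply/funext => j.
by rewrite [(a + b) * _]mulrDl opprD expRD; ring.
Qed.

Lemma reg_powR a al X r : reg a al X -> reg (r * a) (r * al) (fun j => X j `^ r).
Proof.
move=> hX; have X0 := reg_gt0 hX; have := rate_powR r hX; rewrite /reg.
congr rate; apply/funext => j.
rewrite powRM ?expR_ge0 ?(ltW (X0 _)) // -expRM; congr (_ * expR _); ring.
Qed.

Lemma reg0 al X : rate lg al X -> reg 0 al X.
Proof.
by rewrite /reg; congr rate; apply/funext => j; rewrite mul0r oppr0 expR0 mulr1.
Qed.

Lemma reg_lg a al X : a = 0 -> reg a al X -> rate lg al X.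
Proof.
by move=> ->; rewrite /reg; congr rate; apply/funext => j; rewrite mul0r oppr0 expR0 mulr1.
Qed.

Lemma reg_lin a al X : reg a al X -> rate lin a X.
Proof.
move=> hX; have := rateM (rate_lg_lin hX) (rate_gauge a lin_homo).
rewrite add0r; congr rate; apply/funext => j.
by rewrite -mulrA -expRD addNr expR0 mulr1.
Qed.

Lemma reg_weight m kappa alpha rho : (0 < m)%N -> slowly_varying rho ->
  reg (- kappa * (m%:R * ln 2)) (- alpha) (weight_seq m kappa alpha rho).
Proof.
move=> m0 sv; have := rateM (rate_powR (- alpha) (rate_arith m0)) (rate_slowly_varying m0 sv).
rewrite mulr1 addr0 /reg; congr rate; apply/funext => j.
set z := (m * j).+1%:R; rewrite /weight_seq -/z.
have -> : 2 `^ (- (kappa * (m * j)%:R)) = expR (- kappa * (m%:R * ln 2) * lin j) :> R.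
  by rewrite {1}/powR gt_eqF // /lin natrM; congr expR; ring.
set E := expR (- kappa * _ * _).
have -> : expR (- (- kappa * (m%:R * ln 2) * lin j)) = E^-1 by rewrite expRN.
have E0 : E != 0 by rewrite gt_eqF // expR_gt0.
by field.
Qed.

End Reg.

Section Levels.
Context {R : realType} (kH : R) (H : nat -> R).
Hypotheses (kH0 : 0 < kH) (HR : rate lin kH H).
Hypothesis Hhomo : {homo H : i j / (i <= j)%N >-> i <= j}.

Let H0 j : 0 < H j. Proof. exact: HR.1. Qed.

Lemma rate_succ : exists2 C, 1 <= C & forall j, H j.+1 <= C * H j.
Proof.
have [C C_0 hC] := rate_le HR kH0.
exists (C * expR (kH + kH) + 1) => [|j]; first by rewrite lerDr mulr_ge0 ?expR_ge0 // ltW.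
have [h _] := hC j j.+1 (leqnSn j); apply: le_trans h _.
rewrite /lin -natr1 [j%:R + 1]addrC addrK mulr1; apply: ler_wpM2r; first exact: ltW.
by rewrite lerDl.
Qed.

(** H increases at most by a constant factor from one level to the next. *)
Lemma level_between : exists2 C, 1 <= C & forall X, H 0 <= X ->
  exists J, H J <= X /\ X <= C * H J.
Proof.
have [C C1 hC] := rate_succ; exists C => // X H0X.
have [j0 hj0] := rate_unbounded kH0 HR X.
have ex : exists j, X < H j by exists j0.
case: (ex_minnP ex) => j jX jmin.
case: j jX jmin => [|j] jX jmin; first by rewrite ltNge H0X in jX.
exists j; split; first by rewrite leNgt; apply/negP => /jmin; rewrite ltnn.
exact: le_trans (ltW jX) (hC j).
Qed.

Lemma ln_le_bound (B x y : R) : 0 < x -> 0 < y -> x <= expR B * y -> y <= expR B * x ->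
  `|ln x - ln y| <= B.
Proof.
have key a b : 0 < a -> 0 < b -> a <= expR B * b -> ln a <= B + ln b.
  move=> a0 b0 h; rewrite -{1}(expRK B) -lnM ?posrE ?expR_gt0 //.
  by rewrite ler_ln // posrE mulr_gt0 ?expR_gt0.
move=> x0 y0 /(key _ _ x0 y0) h1 /(key _ _ y0 x0) h2.
by rewrite ler_norml; apply/andP; split; lra.
Qed.

Lemma pick_upper (a : R) : 0 < a -> exists B, exists n0 : nat, forall n, (n0 <= n)%N ->
  exists J, a * H J <= n.-1%:R /\ `|ln (H J) - ln n%:R| <= B.
Proof.
move=> a0; have [C C1 hC] := level_between; have C0 : 0 < C := lt_le_trans ltr01 C1.
pose K := 2 * a * C + a^-1; have K0 : 0 < K by rewrite addr_gt0 ?invr_gt0 // !mulr_gt0.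
exists (ln K), (Num.truncn (a * H 0) + 3)%N => n nn0.
have n1 : (1 < n)%N by apply: leq_trans nn0; rewrite addn3.
have e : n%:R = n.-1%:R + 1 :> R by rewrite natr1 prednK // ltnW.
have np : 1 <= n.-1%:R :> R by rewrite ler1n -ltnS prednK // ltnW.
have h0 : H 0 <= n.-1%:R / a.
  rewrite ler_pdivlMr // mulrC.
  have /andP[_ h] := truncn_itv (mulr_ge0 (ltW a0) (ltW (H0 0))).
  apply: le_trans (ltW h) _; rewrite ler_nat -ltnS prednK; last exact: ltnW.
  by apply: leq_trans nn0; rewrite addn3 !ltnS leqW.
have [J [hJ1 hJ2]] := hC _ h0; exists J.
have hJ3 : a * H J <= n.-1%:R by rewrite mulrC -ler_pdivlMr.
split => //.
have n0 : 0 < n%:R :> R by rewrite ltr0n ltnW.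
apply: ln_le_bound; rewrite ?H0 // lnK //.
  have : H J <= a^-1 * n%:R.
    rewrite mulrC ler_pdivlMr // mulrC; apply: le_trans hJ3 _; rewrite e; lra.
  move=> /le_trans; apply; apply: ler_wpM2r; first exact: ltW.
  by rewrite lerDr !mulr_ge0 // ltW.
have h4 : n.-1%:R <= a * (C * H J) by rewrite [a * _]mulrC -ler_pdivrMr.
have h5 : n%:R <= 2 * a * C * H J by rewrite e; lra.
apply: le_trans h5 _; apply: ler_wpM2r; first exact: ltW.
by rewrite lerDl invr_ge0 ltW.
Qed.

Lemma pick_lower (a : R) : 0 < a -> exists B, exists n0 : nat, forall n, (n0 <= n)%N ->
  exists J, a * n%:R <= H J /\ `|ln (H J) - ln n%:R| <= B.
Proof.
move=> a0; have [C C1 hC] := level_between; have C0 : 0 < C := lt_le_trans ltr01 C1.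
have aC : 0 < a * C by exact: mulr_gt0.
pose K := a * C + a^-1; have K0 : 0 < K by rewrite addr_gt0 ?invr_gt0.
exists (ln K), (Num.truncn (H 0 / (a * C))).+1 => n nn0.
have n0 : 0 < n%:R :> R by rewrite ltr0n (leq_trans _ nn0).
have h0 : H 0 <= a * C * n%:R.
  rewrite mulrC -ler_pdivrMr //.
  have /andP[_ h] := truncn_itv (divr_ge0 (ltW (H0 0)) (ltW aC)).
  by apply: le_trans (ltW h) _; rewrite ler_nat.
have [J [hJ1 hJ2]] := hC _ h0; exists J.
have h3 : a * n%:R <= H J.
  by rewrite -(ler_pM2l C0); apply: le_trans hJ2; apply: eqW; ring.
split => //; apply: ln_le_bound; rewrite ?H0 // lnK //.
  apply: le_trans hJ1 _; apply: ler_wpM2r; first exact: ltW.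
  by rewrite lerDl invr_ge0 ltW.
have : n%:R <= a^-1 * H J by rewrite mulrC ler_pdivlMr // mulrC.
move=> /le_trans; apply; apply: ler_wpM2r; first exact: ltW.
by rewrite lerDr ltW.
Qed.

(** H grows exponentially, so that J is comparable with ln H_J. *)
Lemma level_log (m : nat) (B : R) : (0 < m)%N -> exists B' : R, exists n0 : nat,
  forall J n, (n0 <= n)%N ->
  `|ln (H J) - ln n%:R| <= B ->
  [/\ 0 < ln n%:R :> R, `|ln (m * J).+1%:R - ln (log2 n%:R)| <= B' &
   `|ln J.+1%:R - ln (log2 n%:R)| <= B'].
Proof.
move=> m0; have k2 : 0 < kH / 2 by rewrite divr_gt0.
have [_ /(_ _ k2)[C hC]] := HR.
have l2 := @ln2_gt0 R.
pose A := `|C| + `|B| + `|ln (H 0)|.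
have A0 : 0 <= A by rewrite !addr_ge0.
pose K1 := 2 * (1 + A) / kH + 1.
pose K2 := 2 * kH + A.
have K10 : 0 < K1 by rewrite ltr_wpDl // divr_ge0 ?mulr_ge0 ?addr_ge0 // ltW.
have K20 : 0 < K2 by rewrite ltr_pwDl // mulr_gt0.
have mp : 1 <= m%:R :> R by rewrite ler1n.
have Kp : 0 < K1 * ln 2 + K2 / ln 2 by rewrite addr_gt0 ?mulr_gt0 ?invr_gt0.
pose K := m%:R * (K1 * ln 2 + K2 / ln 2).
have K0 : 0 < K by rewrite mulr_gt0 ?ltr0n.
exists (ln K), (Num.truncn (expR 1 : R)).+1 => J n nn0 HB.
have lnn : 1 <= ln n%:R :> R.
  have /andP[_ h] := truncn_itv (expR_ge0 (1 : R)).
  have h' : expR 1 <= n%:R :> R by apply: le_trans (ltW h) _; rewrite ler_nat.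
  by rewrite -[leLHS]expRK ler_ln ?posrE ?expR_gt0 // (lt_le_trans (expR_gt0 _) h').
have x0 : 0 < ln n%:R :> R := lt_le_trans ltr01 lnn.
have hJ := hC 0%N J (leq0n J); rewrite /lin subr0 in hJ.
have hx : `|ln n%:R - kH * J%:R| <= A + kH / 2 * J%:R.
  have -> : ln n%:R - kH * J%:R = (ln (H J) - ln (H 0%N) - kH * J%:R)
     - (ln (H J) - ln n%:R) + ln (H 0%N) by ring.
  apply: le_trans (ler_normD _ _) _; apply: le_trans (lerD (ler_normB _ _) (lexx _)) _.
  have h1 := ler_norm C; have h2 := ler_norm B; rewrite /A; lra.
move: hx; rewrite ler_norml => /andP[hx1 hx2].
have J0 : 0 <= J%:R :> R by [].
have Jx : J.+1%:R <= K1 * ln n%:R.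
  rewrite -natr1; have h : J%:R * kH <= 2 * (1 + A) * ln n%:R.
    have := ler_wpM2l A0 lnn; lra.
  by rewrite mulrDl mul1r lerD // mulrAC ler_pdivlMr.
have xJ : ln n%:R <= K2 * J.+1%:R.
  rewrite -natr1 /K2; have h := mulr_ge0 A0 J0; have h2 := mulr_ge0 (ltW kH0) J0; lra.
have Jy : J.+1%:R <= (m * J).+1%:R :> R by rewrite ler_nat ltnS leq_pmull.
have yJ : (m * J).+1%:R <= m%:R * J.+1%:R :> R.
  by rewrite -natrM ler_nat mulnS -add1n leq_add2r.
have e1 : ln n%:R = ln 2 * log2 n%:R :> R by rewrite /log2 mulrC divfK // gt_eqF.
have L0 : 0 < log2 n%:R :> R by rewrite divr_gt0.
have P1 : m%:R * (K1 * ln 2) <= K.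
  by rewrite ler_pM2l ?ltr0n // lerDl divr_ge0 // ltW.
have P2 : K2 / ln 2 <= K.
  apply: le_trans (_ : 1 * (K1 * ln 2 + K2 / ln 2) <= _).
    by rewrite mul1r lerDr mulr_ge0 // ltW.
  by apply: ler_wpM2r => //; exact: ltW.
have Q1 : m%:R * J.+1%:R <= K * log2 n%:R.
  apply: le_trans (_ : m%:R * (K1 * ln 2) * log2 n%:R <= _).
    by rewrite -!mulrA -e1; apply: ler_wpM2l => //; apply: le_trans mp.
  by apply: ler_wpM2r => //; exact: ltW.
have Q2 : log2 n%:R <= K * J.+1%:R.
  apply: le_trans (_ : K2 / ln 2 * J.+1%:R <= _).
    by rewrite mulrAC ler_pdivlMr // mulrC -e1.
  exact: ler_wpM2r.
have JmJ : J.+1%:R <= m%:R * J.+1%:R :> R by rewrite ler_peMl.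
split => //; apply: ln_le_bound; rewrite ?ltr0n // lnK ?posrE //.
- exact: le_trans yJ Q1.
- by apply: le_trans Q2 _; apply: ler_wpM2l => //; exact: ltW.
- exact: le_trans JmJ Q1.
Qed.

End Levels.

(** * The cardinality of the levels *)

Section Bounded.
Context {R : realType} {T : Type} (P : T -> Prop).
Implicit Types f g : T -> R.

(** Uniform boundedness; applied to differences of logarithms it expresses two-sided
    estimates up to constants, in a form that is stable under linear combinations. *)
Definition bounded_on f := exists B, forall i, P i -> `|f i| <= B.

Lemma bounded_onD f g : bounded_on f -> bounded_on g -> bounded_on (fun i => f i + g i).
Proof.
move=> [A hA] [B hB]; exists (A + B) => i Pi.
exact: le_trans (ler_normD _ _) (lerD (hA _ Pi) (hB _ Pi)).
Qed.

Lemma bounded_onZ k f : bounded_on f -> bounded_on (fun i => k * f i).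
Proof.
by move=> [A hA]; exists (`|k| * A) => i Pi; rewrite normrM ler_wpM2l // hA.
Qed.

Lemma bounded_on_eq f g : (forall i, P i -> f i = g i) -> bounded_on f -> bounded_on g.
Proof. by move=> fg [A hA]; exists A => i Pi; rewrite -fg // hA. Qed.

Lemma bounded_on_sv (s : R -> R) (x y : T -> R) : slowly_varying s ->
  (forall i, P i -> 1 <= x i) -> (forall i, P i -> 1 <= y i) ->
  bounded_on (fun i => ln (x i) - ln (y i)) ->
  bounded_on (fun i => ln (s (x i)) - ln (s (y i))).
Proof.
move=> sv x1 y1 [B hB]; have [C _ hC] := slowly_varying_near B sv.
by exists C => i Pi; apply: hC; [exact: x1|exact: y1|exact: hB].
Qed.

End Bounded.

Section Counting.
Context {R : realType} (theta gamma : R) (tau h : R -> R) (m : nat).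
Hypotheses (htau : slowly_varying tau) (h_pos : forall t, 0 < t <= 1 -> 0 < h t).
Hypothesis h_mono : forall s t, 0 < s -> s <= t -> t <= 1 -> h s <= h t.
Hypothesis h_near0 : \forall t \near 0^'+,
       h t = t `^ theta * `|log2 t| `^ gamma * tau `|log2 t|.
Hypothesis m0 : (0 < m)%N.
Notation H := (fun j : nat => (h (2 ^- (m * j)))^-1).

Lemma expVn_itv (N : nat) : 0 < (2 : R) ^- N <= 1.
Proof. by rewrite invr_gt0 exprn_gt0 //= invf_le1 ?exprn_gt0 // exprn_ege1 // ler1n. Qed.

Lemma count_gt0 j : 0 < H j.
Proof. by rewrite invr_gt0 h_pos // expVn_itv. Qed.

Lemma count_homo : {homo H : i j / (i <= j)%N >-> i <= j}.
Proof.
move=> i j ij; rewrite lef_pV2 ?posrE ?h_pos ?expVn_itv //.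
have /andP[a0 _] := expVn_itv (m * j); have /andP[_ a1] := expVn_itv (m * i).
apply: h_mono => //; rewrite lef_pV2 ?posrE ?exprn_gt0 //.
by apply: ler_weXn2l; rewrite ?ler1n // leq_mul2l ij orbT.
Qed.

(** At 2 ^ - (m j) the formula for [h] involves m j, which is replaced by m j + 1 at
    the cost of a bounded factor; the finitely many levels outside the neighbourhood
    of 0 are absorbed by the constant. *)
Lemma count_profile : bounded_on xpredT (fun j : nat => ln (H j) -
  (theta * (m%:R * ln 2) * lin j - gamma * ln (m * j).+1%:R - ln (tau (m * j).+1%:R))).
Proof.
set f := (f in bounded_on _ f).
have [d /= d0 hd] : \forall t \near 0, 0 < t ->
    h t = t `^ theta * `|log2 t| `^ gamma * tau `|log2 t| by exact: h_near0.
have l2 := @ln2_gt0 R.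
have [Ct _ hCt] := slowly_varying_near (ln 2) htau.
pose J0 := (Num.truncn d^-1).+1.
have large j : (J0 <= j)%N -> `|f j| <= `|gamma| * ln 2 + Ct.
  move=> Jj; have N0 : (0 < m * j)%N by rewrite muln_gt0 m0 (leq_trans _ Jj).
  rewrite /f; set N := (m * j)%N in N0 *; have jN : (j <= N)%N by rewrite leq_pmull.
  have /andP[t0 t1] := expVn_itv N.
  have td : 2 ^- N < d.
    rewrite invf_plt ?posrE ?exprn_gt0 //.
    have dV : 0 <= d^-1 by rewrite invr_ge0 ltW.
    have /andP[_ h1] := truncn_itv dV; apply: lt_le_trans h1 _.
    rewrite -natrX ler_nat; apply: leq_trans Jj _.
    by apply: leq_trans jN _; apply: ltnW; exact: ltn_expl.
  have hN := hd (2 ^- N); rewrite /ball_ /= sub0r normrN gtr0_norm // in hN.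
  have {}hN := hN td t0.
  have lt2 : ln (2 ^- N) = - (N%:R * ln 2) :> R.
    by rewrite lnV ?posrE ?exprn_gt0 // lnXn // mulr_natl.
  have L2 : `|log2 (2 ^- N)| = N%:R :> R.
    by rewrite /log2 lt2 mulNr mulfK ?gt_eqF // normrN ger0_norm.
  have tN : 0 < tau N%:R by case: htau => + _ _; apply; rewrite ltr0n.
  have Np : 0 < N%:R :> R by rewrite ltr0n.
  rewrite hN L2 lnV ?posrE ?mulr_gt0 ?powR_gt0 // !lnM ?posrE ?mulr_gt0 ?powR_gt0 //.
  rewrite !ln_powR lt2.
  have lnN : `|ln N%:R - ln N.+1%:R| <= ln 2 :> R.
    have e2 : expR (ln 2) = 2 :> R by rewrite lnK // posrE.
    have h1 : N%:R <= expR (ln 2) * N.+1%:R :> R.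
      by rewrite e2 -natrM ler_nat mul2n -addnn (leq_trans (leqnSn N)) // leq_addr.
    have h2 : N.+1%:R <= expR (ln 2) * N%:R :> R.
      by rewrite e2 -natrM ler_nat mul2n -addnn -addn1 leq_add2l.
    exact: ln_le_bound.
  have hT := hCt N%:R N.+1%:R; rewrite !ler1n in hT; have {}hT := hT N0 isT lnN.
  have -> : - (theta * - (N%:R * ln 2) + gamma * ln N%:R + ln (tau N%:R)) -
    (theta * (m%:R * ln 2) * lin j - gamma * ln N.+1%:R - ln (tau N.+1%:R)) =
     - (gamma * (ln N%:R - ln N.+1%:R)) - (ln (tau N%:R) - ln (tau N.+1%:R)).
    by rewrite /lin /N natrM; ring.
  apply: le_trans (ler_normB _ _) _; rewrite normrN normrM.
  by apply: lerD => //; exact: ler_wpM2l.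
exists (`|gamma| * ln 2 + `|Ct| + \sum_(j < J0) `|f j|) => j _.
have s0 : 0 <= \sum_(j < J0) `|f j| by exact: sumr_ge0.
have g0 : 0 <= `|gamma| * ln 2 by rewrite mulr_ge0 // ltW.
have [Jj|jJ] := leqP J0 j.
  by apply: le_trans (large j Jj) _; have := ler_norm Ct; lra.
rewrite -[leLHS]add0r; apply: lerD; first by have := normr_ge0 Ct; lra.
rewrite (bigD1 (Ordinal jJ)) //= lerDl; exact: sumr_ge0.
Qed.

Lemma reg_count : reg (theta * (m%:R * ln 2)) (- gamma) H.
Proof.
have [B hB] := count_profile.
have hr := rateM (rate_powR (- gamma) (rate_arith m0)) (rateV (rate_slowly_varying m0 htau)).
have -> : - gamma = - gamma * 1 + - 0 :> R by ring.
have tp j : 0 < tau (m * j).+1%:R by case: htau => + _ _; apply.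
apply: (rate_equiv hr) (_ : forall j, _ <= B) => [j|j].
  by rewrite mulr_gt0 ?count_gt0 ?expR_gt0.
have := hB j isT; rewrite !lnM ?posrE ?count_gt0 ?expR_gt0 ?powR_gt0 ?invr_gt0 // expRK.
rewrite ln_powR [ln (tau _)^-1]lnV ?posrE //.
by congr (`|_| <= _); ring.
Qed.

End Counting.

(** * The weights *)

Section Weights.
Context {R : realType} (q theta gamma : R) (tau : R -> R) (m : nat) (H : nat -> R).
Context (ku kw au aw : R) (ru rw : R -> R).
Notation lam := (m%:R * ln 2 : R).
Notation u := (weight_seq m ku au ru).
Notation w := (weight_seq m kw aw rw).
Hypotheses (q1 : 1 <= q) (theta0 : 0 < theta) (m0 : (0 < m)%N).
Hypotheses (htau : slowly_varying tau) (hru : slowly_varying ru) (hrw : slowly_varying rw).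
Hypotheses (H0 : forall j, 0 < H j) (HR : reg (theta * lam) (- gamma) H).
Hypothesis Hprofile : bounded_on xpredT (fun j : nat => ln (H j) -
  (theta * lam * lin j - gamma * ln (m * j).+1%:R - ln (tau (m * j).+1%:R))).

(** The power [nu] is 0 in the noncritical and 1 / q in the critical case. *)
Definition dual_weight nu (j : nat) : R := weight_seq m kw aw rw j * (m * j).+1%:R `^ nu.
Notation W := dual_weight.

Lemma lam_gt0 : 0 < lam. Proof. by rewrite mulr_gt0 ?ltr0n // ln2_gt0. Qed.
Let q0 : 0 < q. Proof. exact: lt_le_trans ltr01 q1. Qed.
Let u0 : forall j, 0 < u j. Proof. exact: reg_gt0 (reg_weight ku au m0 hru). Qed.
Let w0 : forall j, 0 < w j. Proof. exact: reg_gt0 (reg_weight kw aw m0 hrw). Qed.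

Lemma dual_weight0 : W 0 = w.
Proof. by apply/funext => j; rewrite /dual_weight powRr0 mulr1. Qed.

Lemma reg_dual nu : reg (- kw * lam) (- aw + nu) (W nu).
Proof.
have h := rate_powR nu (rate_arith m0).
by have := regM (reg_weight kw aw m0 hrw) (reg0 h); rewrite addr0 mulr1.
Qed.

Lemma dual_gt0 nu j : 0 < W nu j. Proof. exact: reg_gt0 (reg_dual nu) j. Qed.

Lemma reg_diag nu : reg (- (ku + kw) * lam) (- (au + aw - nu)) (fun j => u j * W nu j).
Proof.
have := regM (reg_weight ku au m0 hru) (reg_dual nu).
by congr reg; ring.
Qed.

Lemma reg_mass : reg ((theta - q * kw) * lam) (- (q * aw) - gamma) (fun l => w l `^ q * H l).
Proof.
have := regM (reg_powR q (reg_weight kw aw m0 hrw)) HR.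
by congr reg; ring.
Qed.

Lemma tail_noncritical : theta / q < kw -> exists2 C0, 0 < C0 &
  forall j M, \sum_(j <= l < M) w l `^ q * H l <= C0 * W 0 j `^ q * H j.
Proof.
move=> h; have e : (theta - q * kw) * lam < 0.
  by rewrite pmulr_llt0 ?lam_gt0 // subr_lt0 mulrC -ltr_pdivrMr.
have [C C_0 hC] := rate_sum_tail e (reg_lin reg_mass).
by exists C => // j M; rewrite dual_weight0 -mulrA.
Qed.

Lemma rate_mass_critical : kw = theta / q ->
  rate lg (- (q * aw) - gamma) (fun l => w l `^ q * H l).
Proof.
move=> h; apply: reg_lg reg_mass; rewrite h mulrC [q * _]mulrC divfK ?subrr ?mulr0 //.
by rewrite gt_eqF.
Qed.

Lemma dual_critical j : W q^-1 j `^ q = w j `^ q * (m * j).+1%:R.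
Proof.
rewrite /dual_weight powRM ?powR_ge0 ?(ltW (w0 _)) // -powRrM mulVf ?powRr1 //.
by rewrite gt_eqF.
Qed.

Lemma tail_critical : kw = theta / q -> (1 - gamma) / q < aw -> exists2 C0, 0 < C0 &
  forall j M, \sum_(j <= l < M) w l `^ q * H l <= C0 * W q^-1 j `^ q * H j.
Proof.
move=> h1 h2; have e : - (q * aw) - gamma < -1.
  move: h2; rewrite ltr_pdivrMr // mulrC => h2; lra.
have [C C_0 hC] := rate_poly_tail e (rate_mass_critical h1).
exists C => // j M; apply: le_trans (hC j M) _; rewrite dual_critical -!mulrA.
apply: ler_wpM2l; first exact: ltW.
rewrite mulrCA; apply: ler_wpM2l; first exact: powR_ge0.
apply: ler_wpM2r; first exact: ltW.
by rewrite ler_nat ltnS leq_pmull.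
Qed.

Lemma head_noncritical J : exists2 M, (J < M)%N &
  W 0 J `^ q * H J <= 1 * \sum_(J <= l < M) w l `^ q * H l.
Proof. by exists J.+1 => //; rewrite dual_weight0 mul1r big_nat1. Qed.

(** The tail of the sum is already reached on the first dyadic block. *)
Lemma head_critical : kw = theta / q -> exists2 C0, 0 < C0 &
  forall J, exists2 M, (J < M)%N &
  W q^-1 J `^ q * H J <= C0 * \sum_(J <= l < M) w l `^ q * H l.
Proof.
move=> h1; have [C C_0 hC] := rate_block 2 (rate_mass_critical h1).
exists (m%:R * C) => [|J]; first by rewrite mulr_gt0 ?ltr0n.
exists (2 * J.+1)%N; first by rewrite mul2n -addnn addSn ltnS leq_addr.
rewrite dual_critical mulrAC mulrC -mulrA.
apply: (@le_trans _ _ ((m%:R * J.+1%:R) * (w J `^ q * H J))).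
  apply: ler_wpM2r; first by rewrite mulr_ge0 ?powR_ge0 // ltW.
  by rewrite -natrM ler_nat mulnS -add1n leq_add2r.
rewrite -mulrA; apply: ler_wpM2l => //.
rewrite big_distrr /=.
have -> : J.+1%:R * (w J `^ q * H J) = \sum_(J <= l < 2 * J.+1 - 1) (w J `^ q * H J).
  rewrite sumr_const_nat -[RHS]mulr_natl; congr (_%:R * _); lia.
rewrite [leRHS](@big_cat_nat _ _ _ (2 * J.+1 - 1)); [|lia|lia].
rewrite -[leLHS]addr0; apply: lerD; last first.
  by apply: sumr_ge0 => l _; rewrite mulr_ge0 ?mulr_ge0 ?powR_ge0 // ltW.
apply: ler_sum_nat => l /andP[Jl lJ].
by have [|_ h] := hC J l Jl; [lia|].
Qed.

Section Near.
Context {T : Type} (P : T -> Prop) (J : T -> nat) (X : T -> R).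
Hypotheses (X1 : forall i, P i -> 1 <= X i).
Hypothesis JX : bounded_on P (fun i => ln (m * J i).+1%:R - ln (X i)).

Let near_sv s : slowly_varying s ->
  bounded_on P (fun i => ln (s (m * J i).+1%:R) - ln (s (X i))).
Proof. by move=> sv; apply: bounded_on_sv => // i _; rewrite ler1n. Qed.

Lemma diag_near nu : bounded_on P (fun i => ln (u (J i) * W nu (J i)) -
  (- ((ku + kw) * lam * lin (J i)) - (au + aw - nu) * ln (X i) + ln (ru (X i) * rw (X i)))).
Proof.
apply: bounded_on_eq (bounded_onD (bounded_onZ (- (au + aw - nu)) JX)
  (bounded_onD (near_sv hru) (near_sv hrw))) => i Pi.
have p (s : R -> R) z : slowly_varying s -> 1 <= z -> 0 < s z.
  by move=> [+ _ _] z1; apply; exact: lt_le_trans z1.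
have y1 : 1 <= (m * J i).+1%:R :> R by rewrite ler1n.
have Xi := X1 Pi.
rewrite /dual_weight /weight_seq; cbv zeta.
have p1 := p _ _ hru y1; have p2 := p _ _ hrw y1.
have p3 := p _ _ hru Xi; have p4 := p _ _ hrw Xi.
rewrite !lnM ?posrE ?mulr_gt0 ?powR_gt0 // !ln_powR.
by rewrite /lin natrM; ring.
Qed.

(** The number of the level is eliminated in favour of H. *)
Lemma level_near : bounded_on P (fun i => theta * lam * lin (J i) -
  (ln (H (J i)) + gamma * ln (X i) + ln (tau (X i)))).
Proof.
have [B hB] := Hprofile.
have b1 : bounded_on P (fun i => - 1 * (ln (H (J i)) -
  (theta * lam * lin (J i) - gamma * ln (m * J i).+1%:R - ln (tau (m * J i).+1%:R)))).
  by apply: bounded_onZ; exists B => i _; exact: hB.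
apply: bounded_on_eq (bounded_onD b1 (bounded_onD (bounded_onZ gamma JX) (near_sv htau))).
by move=> i Pi; ring.
Qed.

Lemma diag_count_near nu : bounded_on P (fun i => ln (u (J i) * W nu (J i)) -
  (- ((ku + kw) / theta) * (ln (H (J i)) + gamma * ln (X i) + ln (tau (X i)))
   - (au + aw - nu) * ln (X i) + ln (ru (X i) * rw (X i)))).
Proof.
apply: bounded_on_eq (bounded_onD (bounded_onZ (- ((ku + kw) / theta)) level_near)
  (diag_near nu)) => i Pi.
set lm := m%:R * ln 2.
have -> : (ku + kw) * lm * lin (J i) = (ku + kw) / theta * (theta * lm * lin (J i)).
  by field; rewrite gt_eqF.
ring.
Qed.

End Near.

End Weights.

(** * From levels to entropy numbers of large index *)

Lemma log2_ge1 (R : realType) (n : nat) : (2 <= n)%N -> 1 <= log2 (n%:R : R).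
Proof.
move=> n2; rewrite /log2 ler_pdivlMr ?ln2_gt0 // mul1r ler_ln ?posrE ?ltr0n ?(ltnW n2) //.
by rewrite ler_nat.
Qed.

Section Choice.
Context {R : realType} (kH : R) (H : nat -> R) (m : nat).
Hypotheses (kH0 : 0 < kH) (HR : rate lin kH H) (m0 : (0 < m)%N).
Hypothesis Hhomo : {homo H : i j / (i <= j)%N >-> i <= j}.

(** What is needed of the level J chosen for the index n. *)
Definition close (B : R) (i : nat * nat) : Prop :=
  [/\ (2 <= i.2)%N, `|ln (H i.1) - ln i.2%:R| <= B,
      `|ln (m * i.1).+1%:R - ln (log2 (i.2%:R : R))| <= B &
      `|ln i.1.+1%:R - ln (log2 (i.2%:R : R))| <= B].

Let H0 j : 0 < H j. Proof. exact: HR.1. Qed.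

Lemma exp_growth (X : nat -> R) : rate lin kH X -> exists2 K, 0 < K &
  forall j, K * expR (kH / 2 * j%:R) <= X j.
Proof.
move=> XR; have k2 : 0 < kH / 2 by rewrite divr_gt0.
have [C C_0 hC] := rate_le XR k2; have X0 := XR.1 0%N.
exists (X 0%N / C) => [|j]; first exact: divr_gt0.
have [_] := hC 0%N j (leq0n j).
have -> : - kH + kH / 2 = - (kH / 2) by field.
rewrite /lin subr0 mulNr expRN -mulrA [_^-1 * _]mulrC => h.
by rewrite -ler_pdivlMr ?expR_gt0 // ler_pdivrMr // mulrC.
Qed.

(** An exponential sequence overtakes the linear one. *)
Lemma level_large : exists J1, forall J, (J1 <= J)%N -> J.+1%:R <= H J.
Proof.
have sR : rate lg 1 (fun j => j.+1%:R : R).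
  by have := @rate_arith R 1 isT; congr rate; apply/funext => j; rewrite mul1n.
have qR := rateM HR (rateV (rate_lg_lin sR)).
rewrite oppr0 addr0 in qR.
have [K K0 hK] := exp_growth qR.
have k2 : 0 < K * (kH / 2) by rewrite mulr_gt0 // divr_gt0.
exists (Num.truncn (K * (kH / 2))^-1).+1 => J JJ.
have s0 : 0 < J.+1%:R :> R by rewrite ltr0n.
rewrite -[leLHS]mul1r -ler_pdivlMr //; apply: le_trans (hK J).
have V0 : 0 <= (K * (kH / 2))^-1 by rewrite invr_ge0 ltW.
have /andP[_ h] := truncn_itv V0.
have : (K * (kH / 2))^-1 <= J%:R by apply: le_trans (ltW h) _; rewrite ler_nat.
rewrite -[leLHS]mul1r ler_pdivrMr // => h1; apply: le_trans h1 _.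
have -> : J%:R * (K * (kH / 2)) = K * (kH / 2 * J%:R) by ring.
rewrite ler_pM2l //; apply: le_trans (expR_ge1Dx _).
by rewrite lerDr.
Qed.

(** Exponential growth of H; this makes room on a level of number O (k) for s groups
    of 4 ^ (k + 1) vertices as long as s <= 2 ^ (k + 1). *)
Lemma level_multiple (A : R) : 0 < A -> exists b : nat, forall k, (0 < k)%N ->
  A * 8 ^+ k.+1 <= H (b.+1 * k).
Proof.
move=> A0; have [K K0 hK] := exp_growth HR.
have l8 : 0 < ln 8 :> R by rewrite ln_gt0 // ltr1n.
pose L := `|ln (A / K)| + 2 * ln 8.
have L0 : 0 <= L by rewrite addr_ge0 // mulr_ge0 // ltW.
have k2 : 0 < kH / 2 by rewrite divr_gt0.
exists (Num.truncn (L / (kH / 2))) => k kp; set b := (Num.truncn _).+1.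
have bL : L <= kH / 2 * b%:R.
  have /andP[_ /ltW h] := truncn_itv (divr_ge0 L0 (ltW k2)).
  by move: h; rewrite -/b ler_pdivrMr // [b%:R * _]mulrC.
apply: le_trans (hK (b * k)%N).
rewrite -ler_pdivrMl // mulrA [K^-1 * A]mulrC.
have AK : 0 < A / K by exact: divr_gt0.
rewrite -[leLHS]lnK ?posrE ?mulr_gt0 ?invr_gt0 ?exprn_gt0 // ler_expR lnM ?posrE ?exprn_gt0 //.
rewrite lnXn // natrM mulrA.
have k1 : 1 <= k%:R :> R by rewrite ler1n.
apply: le_trans (_ : L * k%:R <= _); last exact: ler_wpM2r.
have h1 := ler_norm (ln (A / K)).
have h2 : `|ln (A / K)| <= `|ln (A / K)| * k%:R by rewrite ler_peMr.
have h3 : ln 8 *+ k.+1 <= 2 * ln 8 * k%:R :> R.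
  rewrite -[ln 8 *+ _]mulr_natr -[k.+1%:R]natr1; have h := ler_wpM2l (ltW l8) k1; lra.
by rewrite /L mulrDl; lra.
Qed.

Let close_of B B' n0 n J : (n0 <= n)%N -> (2 <= n)%N -> `|ln (H J) - ln n%:R| <= B ->
  [/\ 0 < ln n%:R :> R, `|ln (m * J).+1%:R - ln (log2 n%:R)| <= B' &
   `|ln J.+1%:R - ln (log2 n%:R)| <= B'] -> close (Num.max B B') (J, n).
Proof. by move=> nn n2 h1 [_ h2 h3]; split => //=; rewrite le_max ?h1 ?h2 ?h3 ?orbT. Qed.

Lemma choose_level_below (a : R) : 0 < a -> exists B, exists n0 : nat, forall n, (n0 <= n)%N ->
  exists J, [/\ a * H J <= n.-1%:R, J.+1%:R <= H J & close B (J, n)].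
Proof.
move=> a0; have [B [n1 hB]] := pick_upper kH0 HR a0.
have [B' [n2 hB']] := level_log kH0 HR B m0.
have [J1 hJ1] := level_large.
exists (Num.max B B'), (n1 + n2 + 2 + (Num.truncn (expR B * H J1)).+1)%N => n hn.
have nn1 : (n1 <= n)%N by lia.
have nn2 : (n2 <= n)%N by lia.
have n_2 : (2 <= n)%N by lia.
have nn3 : ((Num.truncn (expR B * H J1)).+1 <= n)%N by lia.
have [J [h1 h2]] := hB n nn1; exists J; split => //.
  apply: hJ1; rewrite leqNgt; apply/negP => /ltnW /Hhomo HJ.
  have /andP[_ h] := truncn_itv (mulr_ge0 (expR_ge0 B) (ltW (H0 J1))).
  have {}h : expR B * H J1 < n%:R by apply: lt_le_trans h _; rewrite ler_nat.
  have n0 : 0 < n%:R :> R by rewrite ltr0n; lia.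
  have : expR B * H J < n%:R by apply: le_lt_trans h; rewrite ler_pM2l ?expR_gt0.
  rewrite -ltr_ln ?posrE ?mulr_gt0 ?expR_gt0 // lnM ?posrE ?expR_gt0 // expRK.
  by move: h2; rewrite ler_norml => /andP[h2 _] h3; lra.
exact: close_of nn2 n_2 h2 (hB' J n nn2 h2).
Qed.

Lemma choose_level_above (a : R) : 0 < a -> exists B, exists n0 : nat, forall n, (n0 <= n)%N ->
  exists J, a * n%:R <= H J /\ close B (J, n).
Proof.
move=> a0; have [B [n1 hB]] := pick_lower kH0 HR a0.
have [B' [n2 hB']] := level_log kH0 HR B m0.
exists (Num.max B B'), (n1 + n2 + 2)%N => n hn.
have nn1 : (n1 <= n)%N by lia.
have nn2 : (n2 <= n)%N by lia.
have n_2 : (2 <= n)%N by lia.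
have [J [h1 h2]] := hB n nn1; exists J; split => //.
exact: close_of nn2 n_2 h2 (hB' J n nn2 h2).
Qed.

End Choice.

Section Transfer.
Context {R : realType} (c : R) (H : nat -> R) (p : \bar R) (q : R) (u w : nat -> R).
Notation en t n := (entropy_number (lp_norm p) (lp_norm q%:E) (level_op u w t) n).

Definition entropy_le (F : nat -> R) : Prop := exists2 C : R, 0 < C & exists n0 : nat,
  forall (V : choiceType) (t : leveled c H V) n, (n0 <= n)%N -> (en t n <= (C * F n)%:E)%E.

Definition entropy_ge (F : nat -> R) : Prop := exists2 C : R, 0 < C & exists n0 : nat,
  forall (V : choiceType) (t : leveled c H V) n, (n0 <= n)%N -> ((C * F n)%:E <= en t n)%E.

Context (P : nat * nat -> Prop) (T : nat * nat -> R) (F : nat -> R).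
Hypotheses (T0 : forall i, P i -> 0 < T i) (F0 : forall i, P i -> 0 < F i.2).
Hypothesis TF : bounded_on P (fun i => ln (T i) - ln (F i.2)).

Lemma entropy_le_intro (C : R) (n0 : nat) : 0 < C ->
  (forall n, (n0 <= n)%N -> exists J, P (J, n) /\
     forall (V : choiceType) (t : leveled c H V), (en t n <= (C * T (J, n))%:E)%E) ->
  entropy_le F.
Proof.
move=> C0 h; have [B hB] := TF.
exists (C * expR B); first by rewrite mulr_gt0 ?expR_gt0.
exists n0 => V t n nn; have [J [PJ hJ]] := h n nn; apply: le_trans (hJ V t) _.
rewrite lee_fin -mulrA ler_pM2l //.
rewrite -[leLHS](lnK (T0 PJ)) -[F n](lnK (F0 PJ)) -expRD ler_expR.
by have := hB _ PJ; rewrite ler_norml => /andP[_]; lra.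
Qed.

Lemma entropy_ge_intro (C : R) (n0 : nat) : 0 < C ->
  (forall n, (n0 <= n)%N -> exists J, P (J, n) /\
     forall (V : choiceType) (t : leveled c H V), ((C * T (J, n))%:E <= en t n)%E) ->
  entropy_ge F.
Proof.
move=> C0 h; have [B hB] := TF.
exists (C * expR (- B)); first by rewrite mulr_gt0 ?expR_gt0.
exists n0 => V t n nn; have [J [PJ hJ]] := h n nn; apply: le_trans (hJ V t).
rewrite lee_fin -mulrA ler_pM2l //.
rewrite -[leRHS](lnK (T0 PJ)) -[F n](lnK (F0 PJ)) -expRD ler_expR.
by have := hB _ PJ; rewrite ler_norml => /andP[]; lra.
Qed.

End Transfer.

(** The constants of both bounds depend on the tree only through [c] and [H], hence can
    be chosen before the tree. *)
Lemma entropy_asymp_intro (R : realType) (p : \bar R) (q : R) (h : R -> R) (m : nat) (c : R)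
  (u w F : nat -> R) :
  (exists n1, forall n, (n1 <= n)%N -> 0 <= F n) ->
  entropy_le c (fun j => (h (2 ^- (m * j)))^-1) p q u w F ->
  entropy_ge c (fun j => (h (2 ^- (m * j)))^-1) p q u w F ->
  entropy_asymp p q%:E h m c u w F.
Proof.
move=> [n1 F0] [C C_0 [n2 hU]] [D D_0 [n3 hL]].
exists (C + D^-1); first by rewrite addr_gt0 ?invr_gt0.
exists (n1 + n2 + n3)%N => V E root I eta u' w' reg hu hw n nn.
have [t [ht hS]] := regular_tree_leveled reg.
have -> : summation_op E root u' w' = level_op u w t.
  apply/funext => f; apply/funext => x; rewrite hS /level_op.
  have e (v : V -> R) (v' : nat -> R) : (forall j (i : I j), v (eta j i) = v' j) -> forall y, v y = v' (lev t y).
    by move=> hv y; have [i {1}->] := ht y; rewrite hv.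
  rewrite (e _ _ hw); congr (_ * _); apply: eq_bigr => j _.
  by rewrite (e _ _ hu) lev_anc // -ltnS.
have nn1 : (n1 <= n)%N by lia.
have nn2 : (n2 <= n)%N by lia.
have nn3 : (n3 <= n)%N by lia.
have Fn := F0 n nn1; apply/andP; split.
  apply: le_trans (hL V t n nn3); rewrite lee_fin; apply: ler_wpM2r => //.
  rewrite -[leRHS]invrK lef_pV2 ?posrE ?addr_gt0 ?invr_gt0 // lerDr; exact: ltW.
apply: le_trans (hU V t n nn2) _; rewrite lee_fin; apply: ler_wpM2r => //.
by rewrite lerDl invr_ge0 ltW.
Qed.

(** * Asymptotics when one level or one block of levels dominates *)

Section Cases.
Context {R : realType} (c q theta gamma : R) (tau : R -> R) (m : nat) (H : nat -> R).
Context (ku kw au aw : R) (ru rw : R -> R).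
Notation lam := (m%:R * ln 2 : R).
Notation u := (weight_seq m ku au ru).
Notation w := (weight_seq m kw aw rw).
Hypotheses (c1 : 1 <= c) (q1 : 1 <= q) (theta0 : 0 < theta) (m0 : (0 < m)%N).
Hypotheses (htau : slowly_varying tau) (hru : slowly_varying ru) (hrw : slowly_varying rw).
Hypotheses (H0 : forall j, 0 < H j) (HR : reg (theta * lam) (- gamma) H).
Hypothesis Hhomo : {homo H : i j / (i <= j)%N >-> i <= j}.
Hypothesis Hprofile : bounded_on xpredT (fun j : nat => ln (H j) -
  (theta * lam * lin j - gamma * ln (m * j).+1%:R - ln (tau (m * j).+1%:R))).
Notation W := (dual_weight m kw aw rw).
Notation ka := (ku + kw).
Notation al := (au + aw).

Let q0 : 0 < q. Proof. exact: lt_le_trans ltr01 q1. Qed.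
Let u0 : forall j, 0 < u j. Proof. exact: reg_gt0 (reg_weight ku au m0 hru). Qed.
Let w0 : forall j, 0 < w j. Proof. exact: reg_gt0 (reg_weight kw aw m0 hrw). Qed.
Let W0 nu : forall j, 0 < W nu j. Proof. exact: dual_gt0. Qed.
Let kH0 : 0 < theta * lam. Proof. by rewrite mulr_gt0 // lam_gt0. Qed.
Let HRl : rate lin (theta * lam) H. Proof. exact: reg_lin HR. Qed.

(** The common form of the asymptotics: power [s] of n beyond the one that comes from
    kappa, and power [a] of log n. *)
Definition profile (s a : R) (n : nat) : R :=
  n%:R `^ (- (ka / theta) + s) * log2 n%:R `^ a *
  (ru (log2 n%:R) * rw (log2 n%:R)) * tau (log2 n%:R) `^ (- (ka / theta)).

Let sv_gt0 (s : R -> R) z : slowly_varying s -> 1 <= z -> 0 < s z.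
Proof. by move=> [+ _ _] z1; apply; exact: lt_le_trans z1. Qed.

Lemma profile_gt0 s a n : (2 <= n)%N -> 0 < profile s a n.
Proof.
move=> n2; have l1 : 1 <= log2 n%:R :> R by exact: log2_ge1.
rewrite /profile !mulr_gt0 ?powR_gt0 ?ltr0n ?(ltnW n2) ?(lt_le_trans ltr01 l1) //; exact: sv_gt0.
Qed.

Lemma diag_gt0 nu s s' mu J n : (2 <= n)%N ->
  0 < u J * W nu J * H J `^ s * n%:R `^ s' * J.+1%:R `^ mu.
Proof.
move=> n2; apply: mulr_gt0; last by rewrite powR_gt0 // ltr0n.
apply: mulr_gt0; last by rewrite powR_gt0 // ltr0n ltnW.
apply: mulr_gt0; last by rewrite powR_gt0.
exact: mulr_gt0.
Qed.

(** The exponent of n is split between H_J (for upper bounds) and n itself (for lower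
    bounds). *)
Lemma profile_near B nu s s' mu a : a = - (al - nu) + mu - ka * gamma / theta ->
  bounded_on (close H m B) (fun i =>
    ln (u i.1 * W nu i.1 * H i.1 `^ s * i.2%:R `^ s' * i.1.+1%:R `^ mu) -
    ln (profile (s + s') a i.2)).
Proof.
move=> ->; pose X (i : nat * nat) : R := log2 i.2%:R.
have X1 i : close H m B i -> 1 <= X i by move=> [n2 _ _ _]; exact: log2_ge1.
have b1 : bounded_on (close H m B) (fun i => ln (m * i.1).+1%:R - ln (X i)).
  by exists B => i [].
have b2 : bounded_on (close H m B) (fun i => ln (H i.1) - ln i.2%:R).
  by exists B => i [].
have b3 : bounded_on (close H m B) (fun i => ln i.1.+1%:R - ln (X i)).
  by exists B => i [].
have b4 := diag_count_near ku kw au aw theta0 htau hru hrw Hprofile X1 b1 nu.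
apply: bounded_on_eq (bounded_onD b4 (bounded_onD (bounded_onZ (s - ka / theta) b2)
  (bounded_onZ mu b3))) => i Pi.
have Xi := X1 _ Pi; have Xp := lt_le_trans ltr01 Xi; have [n2 _ _ _] := Pi.
have t0 := sv_gt0 htau Xi; have r0 := sv_gt0 hru Xi; have r1 := sv_gt0 hrw Xi.
have np : 0 < i.2%:R :> R by rewrite ltr0n ltnW.
have rr : 0 < ru (X i) * rw (X i) by exact: mulr_gt0.
have D0 : 0 < u i.1 * W nu i.1 by exact: mulr_gt0.
rewrite /profile -/(X i).
rewrite [ln (u _ * W _ _ * _ * _ * _)]lnM ?posrE ?mulr_gt0 ?powR_gt0 //.
rewrite [ln (u _ * W _ _ * _ * _)]lnM ?posrE ?mulr_gt0 ?powR_gt0 //.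
rewrite [ln (u _ * W _ _ * _)]lnM ?posrE ?mulr_gt0 ?powR_gt0 //.
rewrite [ln (_ * _ * _ * _ `^ _)]lnM ?posrE ?mulr_gt0 ?powR_gt0 //.
rewrite [ln (_ * _ * (ru _ * _))]lnM ?posrE ?mulr_gt0 ?powR_gt0 //.
rewrite [ln (_ `^ _ * _ `^ _)]lnM ?posrE ?mulr_gt0 ?powR_gt0 //.
by rewrite !ln_powR; field; rewrite gt_eqF.
all: by apply: sv_gt0 => //; rewrite ler1n.
Qed.

Section Exponents.
Context (p : \bar R).
Hypothesis p1 : (1 < p)%E.
Notation ip := (fine p^-1%E).

Lemma size_level (V : choiceType) (t : leveled c H V) J (N : nat) :
  c * H 0%N * N%:R <= H J -> (N <= size (Lv t J))%N.
Proof.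
move=> h; have /andP[h1 _] := size_Lv t J; have c0 : 0 < c := lt_le_trans ltr01 c1.
rewrite -(ler_nat R); apply: le_trans h1.
by rewrite mulrC !ler_pdivlMr //; apply: le_trans h; apply: eqW; ring.
Qed.

Lemma upper_decaying_ge nu C0 : (q%:E <= p)%E -> 0 < C0 ->
  (forall j M, \sum_(j <= l < M) w l `^ q * H l <= C0 * W nu j `^ q * H j) ->
  theta * (q^-1 - ip) < ka ->
  entropy_le c H p q u w (profile (q^-1 - ip) (- (al - nu) - ka * gamma / theta)).
Proof.
move=> qp C00 hW hk.
have DR := reg_lin (regM (reg_diag ku kw au aw m0 hru hrw nu) (reg_powR (q^-1 - ip) HR)).
have kd : - ka * lam + (q^-1 - ip) * (theta * lam) < 0.
  have -> : - ka * lam + (q^-1 - ip) * (theta * lam) = (theta * (q^-1 - ip) - ka) * lam by ring.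
  by rewrite pmulr_llt0 ?lam_gt0 // subr_lt0.
have [C C_0 hC] := upper_ge_geometric c1 H0 q1 Hhomo u0 w0 (W0 nu) C00 hW p1 kH0 HRl DR qp kd.
have [B [n0 hB]] := choose_level_below kH0 HRl m0 Hhomo C_0.
have := @profile_near B nu (q^-1 - ip) 0 0 (- (al - nu) - ka * gamma / theta).
rewrite !addr0 => /(_ erefl) hP.
apply: (@entropy_le_intro _ _ _ _ _ _ _ _ _ _ _ _ hP C n0) => // [i Pi|i [n2 _ _ _]|n nn].
- by case: Pi => n2 _ _ _; exact: (@diag_gt0 nu (q^-1 - ip) 0 0 _ _ n2).
- exact: profile_gt0.
have [J [h1 h2 h3]] := hB n nn; exists J; split => // V t.
by rewrite /= !powRr0 !mulr1; exact: hC.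
Qed.

Lemma upper_decaying_lt nu C0 r : p = r%:E -> (r < q) -> 0 < C0 ->
  (forall j M, \sum_(j <= l < M) w l `^ q * H l <= C0 * W nu j `^ q * H j) ->
  0 < ka ->
  entropy_le c H p q u w (profile (q^-1 - ip) (- (al - nu) - ka * gamma / theta)).
Proof.
move=> pr rq C00 hW hk; have r1 : 1 < r by move: p1; rewrite pr lte_fin.
have DR := reg_lin (reg_diag ku kw au aw m0 hru hrw nu).
have kd : - ka * lam < 0 by rewrite mulNr oppr_lt0 mulr_gt0 // lam_gt0.
have [C C_0 hC] := upper_lt_geometric c1 H0 q1 Hhomo u0 w0 (W0 nu) C00 hW r1 rq kH0 HRl DR kd.
rewrite pr (fine_inv r1).
have [B [n0 hB]] := choose_level_below kH0 HRl m0 Hhomo C_0.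
have := @profile_near B nu (q^-1 - r^-1) 0 0 (- (al - nu) - ka * gamma / theta).
rewrite !addr0 => /(_ erefl) hP.
apply: (@entropy_le_intro _ _ _ _ _ _ _ _ _ _ _ _ hP C n0) => // [i Pi|i [n2 _ _ _]|n nn].
- by case: Pi => n2 _ _ _; exact: (@diag_gt0 nu (q^-1 - r^-1) 0 0 _ _ n2).
- exact: profile_gt0.
have [J [h1 h2 h3]] := hB n nn; exists J; split => // V t.
by rewrite /= !powRr0 !mulr1; exact: hC.
Qed.

Lemma lower_decaying nu C0 : 0 < C0 ->
  (forall J, exists2 M, (J < M)%N &
     W nu J `^ q * H J <= C0 * \sum_(J <= l < M) w l `^ q * H l) ->
  entropy_ge c H p q u w (profile (q^-1 - ip) (- (al - nu) - ka * gamma / theta)).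
Proof.
move=> C00 hW.
have [C C_0 hC] := lower_single c1 H0 q1 u0 w0 (W0 nu) p1 C00 hW.
have a0 : 0 < c * H 0%N * 16 by rewrite !mulr_gt0 // (lt_le_trans ltr01 c1).
have [B [n0 hB]] := choose_level_above kH0 HRl m0 a0.
have := @profile_near B nu 0 (q^-1 - ip) 0 (- (al - nu) - ka * gamma / theta).
rewrite !add0r !addr0 => /(_ erefl) hP.
apply: (@entropy_ge_intro _ _ _ _ _ _ _ _ _ _ _ _ hP C n0) => // [i Pi|i [n2 _ _ _]|n nn].
- by case: Pi => n2 _ _ _; exact: (@diag_gt0 nu 0 (q^-1 - ip) 0 _ _ n2).
- exact: profile_gt0.
have [J [h1 h2]] := hB n nn; exists J; split => // V t.
have np : (0 < n)%N by case: h2 => n2 _ _ _; exact: ltnW.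
rewrite /= !powRr0 !mulr1; apply: (hC V t J n 1%N n) => //; first by rewrite mul1n.
by apply: size_level; apply: le_trans h1; apply: eqW; rewrite natrM natrX; ring.
Qed.

Lemma upper_balanced nu mu C0 Cb : (q%:E <= p)%E -> 0 < C0 ->
  (forall j M, \sum_(j <= l < M) w l `^ q * H l <= C0 * W nu j `^ q * H j) ->
  ka = theta * (q^-1 - ip) -> 0 <= mu -> - (al - nu) + mu - ka * gamma / theta < 0 ->
  0 < Cb ->
  (forall (V : choiceType) (t : leveled c H V) e a b M, in_ball t p e -> (b <= 2 * a.+1)%N ->
    lsum t M (fun x => psum u w t (block a b) e x `^ q) <=
    (Cb * (u a * W nu a * H a `^ (q^-1 - ip) * a.+1%:R `^ mu)) `^ q) ->
  entropy_le c H p q u w (profile (q^-1 - ip) (- (al - nu) + mu - ka * gamma / theta)).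
Proof.
move=> qp C00 hW hk mu0 k0 Cb0 hb.
have DR := regM (reg_diag ku kw au aw m0 hru hrw nu) (reg_powR (q^-1 - ip) HR).
have e0 : - ka * lam + (q^-1 - ip) * (theta * lam) = 0 by rewrite hk; ring.
have sR : rate lg 1 (fun j => j.+1%:R : R).
  by have := @rate_arith R 1 isT; congr rate; apply/funext => j; rewrite mul1n.
have DmR := rateM (reg_lg e0 DR) (rate_powR mu sR).
have ek : - (al - nu) + (q^-1 - ip) * - gamma + mu * 1 = - (al - nu) + mu - ka * gamma / theta.
  by rewrite hk; field; rewrite !gt_eqF.
rewrite -ek in k0.
have dd j : u j * W nu j * H j `^ (q^-1 - ip) <=
    1 * (u j * W nu j * H j `^ (q^-1 - ip) * j.+1%:R `^ mu).
  rewrite mul1r ler_peMr //; first by rewrite mulr_ge0 ?powR_ge0 ?(ltW (mulr_gt0 (u0 _) (W0 _ _))).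
  have e1 : 1 `^ mu = 1 :> R by rewrite powR1.
  by rewrite -[leLHS]e1; apply: ler_powr; rewrite ?ler1n.
have [C C_0 hC] := upper_ge_dyadic c1 H0 q1 Hhomo u0 w0 (W0 nu) C00 hW p1 kH0 HRl
   (reg_lin DR) qp k0 DmR Cb0 hb dd.
have [B [n0 hB]] := choose_level_below kH0 HRl m0 Hhomo C_0.
have := @profile_near B nu (q^-1 - ip) 0 mu (- (al - nu) + mu - ka * gamma / theta).
rewrite !addr0 => /(_ erefl) hP.
apply: (@entropy_le_intro _ _ _ _ _ _ _ _ _ _ _ _ hP C n0) => // [i Pi|i [n2 _ _ _]|n nn].
- by case: Pi => n2 _ _ _; exact: (@diag_gt0 nu (q^-1 - ip) 0 mu _ _ n2).
- exact: profile_gt0.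
have [J [h1 h2 h3]] := hB n nn; exists J; split => // V t.
by rewrite /= powRr0 mulr1; exact: hC.
Qed.

Lemma lower_balanced mu C0 : 0 < C0 ->
  (forall J, (u J * w J * H J `^ (q^-1 - ip) * J.+1%:R `^ mu) `^ q <=
    C0 * \sum_(J <= l < 2 * J.+1) H l * (w l * \sum_(J <= j < l.+1) u j * H j `^ (- ip)) `^ q) ->
  entropy_ge c H p q u w (profile (q^-1 - ip) (- al + (mu - ip) - ka * gamma / theta)).
Proof.
move=> C00 hPsi.
have P0 J : 0 < u J * w J * H J `^ (q^-1 - ip) * J.+1%:R `^ mu.
  apply: mulr_gt0; last by rewrite powR_gt0.
  by apply: mulr_gt0; [exact: mulr_gt0|rewrite powR_gt0].
have [C C_0 hC] := lower_spread c1 H0 q1 u0 w0 p1 C00 P0 hPsi.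
have a0 : 0 < c * H 0%N * 16 by rewrite !mulr_gt0 // (lt_le_trans ltr01 c1).
have [B [n0 hB]] := choose_level_above kH0 HRl m0 a0.
have := @profile_near B 0 0 (q^-1 - ip) (mu - ip) (- al + (mu - ip) - ka * gamma / theta).
rewrite subr0 add0r dual_weight0 => /(_ erefl) hP.
apply: (@entropy_ge_intro _ _ _ _ _ _ _ _ _ _ _ _ hP C n0) => // [i Pi|i [n2 _ _ _]|n nn].
- by case: Pi => n2 _ _ _; rewrite -(dual_weight0 m kw aw rw); exact: (@diag_gt0 0 0 (q^-1 - ip) (mu - ip) _ _ n2).
- exact: profile_gt0.
have [J [h1 h2]] := hB n nn; exists J; split => // V t.
have np : (0 < n)%N by case: h2 => n2 _ _ _; exact: ltnW.
rewrite /= powRr0 mulr1.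
have <- : u J * w J * H J `^ (q^-1 - ip) * J.+1%:R `^ mu * J.+1%:R `^ (- ip) *
    (n%:R / H J) `^ (q^-1 - ip) = u J * w J * n%:R `^ (q^-1 - ip) * J.+1%:R `^ (mu - ip).
  rewrite powRD; last by apply/implyP => _; rewrite pnatr_eq0.
  have hV : (H J)^-1 = H J `^ (- 1) by rewrite powR_inv1 // ltW.
  rewrite powRM ?invr_ge0 ?(ltW (H0 _)) // hV -powRrM mulN1r.
  have h : H J `^ (q^-1 - ip) * H J `^ (- (q^-1 - ip)) = 1.
    by rewrite powRN divff // gt_eqF // powR_gt0.
  by rewrite -[RHS]mulr1 -h; ring.
apply: hC => //.
by apply: size_level; apply: le_trans h1; apply: eqW; rewrite natrM; ring.
Qed.

End Exponents.

End Cases.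

(** * Asymptotics for p < q at the critical decay *)

Lemma ceil_mul n k : (k <= n)%N -> ((n %/ k).+1 * (2 * k) <= 4 * n)%N.
Proof.
move=> kn; have := leq_trunc_div n k; set d := (n %/ k)%N => h.
by rewrite mulnCA mulSn; lia.
Qed.

Section Log.
Context {R : realType}.

Lemma trunc_log_log2 (n : nat) : (2 <= n)%N ->
  (trunc_log 2 n)%:R <= log2 (n%:R : R) <= (trunc_log 2 n).+1%:R.
Proof.
move=> n2; have n0 : (0 < n)%N by exact: ltnW.
have /andP[h1 h2] := trunc_log_bounds (isT : (1 < 2)%N) n0.
have l2 := @ln2_gt0 R.
have e k : k%:R * ln 2 = ln ((2 ^ k)%:R) :> R by rewrite natrX lnXn // mulr_natl.
rewrite /log2 ler_pdivlMr // ler_pdivrMr // !e.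
by rewrite !ler_ln ?posrE ?ltr0n ?expn_gt0 // !ler_nat h1 ltnW.
Qed.

End Log.

Section CasesLt.
Context {R : realType} (c q theta gamma : R) (tau : R -> R) (m : nat) (H : nat -> R).
Context (ku kw au aw : R) (ru rw : R -> R).
Notation lam := (m%:R * ln 2 : R).
Notation u := (weight_seq m ku au ru).
Notation w := (weight_seq m kw aw rw).
Hypotheses (c1 : 1 <= c) (q1 : 1 <= q) (theta0 : 0 < theta) (m0 : (0 < m)%N).
Hypotheses (htau : slowly_varying tau) (hru : slowly_varying ru) (hrw : slowly_varying rw).
Hypotheses (H0 : forall j, 0 < H j) (HR : reg (theta * lam) (- gamma) H).
Hypothesis Hhomo : {homo H : i j / (i <= j)%N >-> i <= j}.
Hypothesis Hprofile : bounded_on xpredT (fun j : nat => ln (H j) -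
  (theta * lam * lin j - gamma * ln (m * j).+1%:R - ln (tau (m * j).+1%:R))).
Notation W := (dual_weight m kw aw rw).
Notation ka := (ku + kw).
Notation al := (au + aw).

Let q0 : 0 < q. Proof. exact: lt_le_trans ltr01 q1. Qed.
Let u0 : forall j, 0 < u j. Proof. exact: reg_gt0 (reg_weight ku au m0 hru). Qed.
Let w0 : forall j, 0 < w j. Proof. exact: reg_gt0 (reg_weight kw aw m0 hrw). Qed.
Let W0 nu : forall j, 0 < W nu j. Proof. exact: dual_gt0. Qed.
Let kH0 : 0 < theta * lam. Proof. by rewrite mulr_gt0 // lam_gt0. Qed.
Let HRl : rate lin (theta * lam) H. Proof. exact: reg_lin HR. Qed.

Let sv_gt0 (s : R -> R) z : slowly_varying s -> 1 <= z -> 0 < s z.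
Proof. by move=> [+ _ _] z1; apply; exact: lt_le_trans z1. Qed.

Notation prof := (profile theta tau ku kw ru rw).

Context (r nu C0 C1 Cb : R).
Hypotheses (r1 : 1 < r) (rq : r < q) (ka0 : ka = 0).
Hypotheses (C00 : 0 < C0) (C10 : 0 < C1) (Cb0 : 0 < Cb).
Hypothesis hW : forall j M, \sum_(j <= l < M) w l `^ q * H l <= C0 * W nu j `^ q * H j.
Hypothesis hW1 : forall J, exists2 M, (J < M)%N &
  W nu J `^ q * H J <= C1 * \sum_(J <= l < M) w l `^ q * H l.
Hypothesis hb : forall (V : choiceType) (t : leveled c H V) e a b M delta,
  in_ball t r%:E e -> (b <= 2 * a.+1)%N -> 0 < delta ->
  (forall x, block a b (lev t x) -> `|e x| <= delta) ->
  lsum t M (fun x => psum u w t (block a b) e x `^ q) <=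
  (Cb * (u a * W nu a * delta `^ (1 - r / q))) `^ q.
Notation beta := (r^-1 - q^-1).

Let dR : rate lg (- (al - nu)) (fun j => u j * W nu j).
Proof. by apply: reg_lg (reg_diag ku kw au aw m0 hru hrw nu); rewrite ka0 oppr0 mul0r. Qed.

Let D0 j : 0 < u j * W nu j. Proof. exact: mulr_gt0. Qed.

Lemma upper_head : - (al - nu) + beta < 0 ->
  entropy_le c H r%:E q u w (prof (- beta) (- (al - nu) + beta - ka * gamma / theta)).
Proof.
move=> hk.
have [C C_0 hC] := upper_lt_dyadic_head c1 H0 q1 Hhomo u0 w0 (W0 nu) C00 hW r1 rq kH0 HRl dR
  Cb0 hb hk.
have [B [n0 hB]] := choose_level_below kH0 HRl m0 Hhomo C_0.
have := @profile_near _ theta gamma tau m H ku kw au aw ru rw theta0 m0 htau hru hrw H0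
  Hprofile B nu (- beta) 0 beta (- (al - nu) + beta - ka * gamma / theta).
rewrite !addr0 => /(_ erefl) hP.
apply: (@entropy_le_intro _ _ _ _ _ _ _ _ _ _ _ _ hP C n0) => // [i Pi|i [n2 _ _ _]|n nn].
- by case: Pi => n2 _ _ _; exact: (@diag_gt0 _ m H ku kw au aw ru rw m0 hru hrw H0 nu _ 0 beta _ _ n2).
- exact: profile_gt0.
have [J [h1 h2 h3]] := hB n nn; exists J; split => // V t.
by rewrite /= powRr0 mulr1; exact: hC.
Qed.

(** Here k is about log n and s about n / k.  Level (b + 1) k has at least s 4 ^ (k + 1)
    vertices for a suitable b, while its number is still comparable with log n. *)
Lemma lower_head :
  entropy_ge c H r%:E q u w (prof (- beta) (- (al - nu) + beta - ka * gamma / theta)).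
Proof.
have p1 : (1 < r%:E)%E by rewrite lte_fin.
have [C C_0 hC] := lower_single c1 H0 q1 u0 w0 (W0 nu) p1 C10 hW1.
rewrite (fine_inv r1) in hC.
have a0 : 0 < c * H 0%N by rewrite mulr_gt0 // (lt_le_trans ltr01 c1).
have [b hbl] := level_multiple kH0 HRl a0.
pose L (n : nat) : R := log2 n%:R.
pose T (i : nat * nat) := u i.1 * W nu i.1 * (i.2%:R / L i.2) `^ (- beta).
pose P (i : nat * nat) := (2 <= i.2)%N /\ i.1 = (b.+1 * trunc_log 2 i.2)%N.
have L1 n : (2 <= n)%N -> 1 <= L n by exact: log2_ge1.
have k1 n : (2 <= n)%N -> (0 < trunc_log 2 n)%N by move=> n2; rewrite trunc_log_gt0.
have hP : bounded_on P (fun i => ln (m * i.1).+1%:R - ln (L i.2)).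
  exists (ln (m * b.+1 + 2)%:R) => i [n2 ->]; set k := trunc_log 2 i.2.
  have kp : (0 < k)%N by exact: k1.
  have /andP[h1 h2] := @trunc_log_log2 R _ n2; rewrite -/(L _) -/k in h1 h2.
  have Lp := lt_le_trans ltr01 (L1 _ n2).
  have e : expR (ln (m * b.+1 + 2)%:R) = (m * b.+1 + 2)%:R :> R.
    by rewrite lnK // posrE ltr0n addn2.
  apply: ln_le_bound; rewrite ?e //.
    apply: (@le_trans _ _ ((m * b.+1 + 2) * k)%:R).
      by rewrite ler_nat mulnA mulnDl -addn1 leq_add2l mul2n -addnn addn_gt0 kp.
    by rewrite natrM; apply: ler_wpM2l.
  apply: le_trans h2 _; rewrite -natrM ler_nat.
  apply: leq_trans (leq_pmull _ _); last by rewrite addn2.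
  by rewrite ltnS mulnA leq_pmull // muln_gt0 m0.
have X1 i : P i -> 1 <= L i.2 by move=> [n2 _]; exact: L1.
have dn := diag_near ku kw au aw hru hrw X1 hP nu.
apply: (@entropy_ge_intro _ _ _ _ _ _ _ P T _ _ _ _ (C * 4 `^ (- beta)) 2).
- by move=> i [n2 _]; rewrite mulr_gt0 ?powR_gt0 // divr_gt0 ?ltr0n ?(ltnW n2) // (lt_le_trans ltr01 (L1 _ n2)).
- by move=> i [n2 _]; exact: profile_gt0.
- apply: bounded_on_eq dn => i Pi; have [n2 _] := Pi.
  have Xi := X1 _ Pi; have Xp := lt_le_trans ltr01 Xi.
  have t0 := sv_gt0 htau Xi; have r0 := sv_gt0 hru Xi; have r2 := sv_gt0 hrw Xi.
  have np : 0 < i.2%:R :> R by rewrite ltr0n ltnW.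
  have rr : 0 < ru (L i.2) * rw (L i.2) by exact: mulr_gt0.
  rewrite /T /profile -/(L _) ka0.
  have V0 : 0 < (L i.2)^-1 by rewrite invr_gt0.
  rewrite [ln (u _ * W _ _ * _)]lnM ?posrE ?D0 ?powR_gt0 ?mulr_gt0 // ln_powR.
  rewrite [ln (_ / _)]lnM ?posrE // [ln (L _)^-1]lnV ?posrE //.
  rewrite [ln (_ * _ * _ * _ `^ _)]lnM ?posrE ?mulr_gt0 ?powR_gt0 //.
  rewrite [ln (_ * _ * (ru _ * _))]lnM ?posrE ?mulr_gt0 ?powR_gt0 //.
  rewrite [ln (_ `^ _ * _ `^ _)]lnM ?posrE ?mulr_gt0 ?powR_gt0 //.
  by rewrite !ln_powR !mul0r oppr0; ring.
- by rewrite mulr_gt0 ?powR_gt0.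
move=> n n2; set k := trunc_log 2 n; have kp : (0 < k)%N by exact: k1.
have n0 : (0 < n)%N by exact: ltnW.
exists (b.+1 * k)%N; split => // V t.
set s := (n %/ k).+1.
have hs := hC V t (b.+1 * k)%N s k n isT.
have ns : (n <= k * s)%N by rewrite mulnC ltnW // ltn_ceil.
have /andP[h1 h2] := trunc_log_bounds (isT : (1 < 2)%N) n0; rewrite -/k in h1 h2.
have kn : (k <= n)%N by apply: leq_trans h1; exact/ltnW/ltn_expl.
have hsz : (s * 4 ^ k.+1 <= size (Lv t (b.+1 * k)))%N.
  apply: (@leq_trans (8 ^ k.+1)).
    rewrite -[8%N]/(2 * 4)%N expnMn leq_mul2r; apply/orP; right.
    by apply: leq_trans h2; rewrite ltnS leq_div.
  by apply: size_level => //; rewrite natrX; exact: hbl.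
apply: le_trans (hs ns n0 hsz); rewrite lee_fin /T /= -/k.
have Lp := lt_le_trans ltr01 (L1 _ n2).
have sL : s%:R <= 4 * (n%:R / L n).
  rewrite mulrA ler_pdivlMr //.
  have /andP[_ h3] := @trunc_log_log2 R _ n2; rewrite -/k -/(L n) in h3.
  apply: (@le_trans _ _ (s%:R * (2 * k)%:R)).
    apply: ler_wpM2l => //; apply: le_trans h3 _.
    by rewrite ler_nat mul2n -addnn -addn1 leq_add2l.
  by rewrite -!natrM ler_nat ceil_mul.
have b0 : 0 < beta by rewrite subr_gt0 ltf_pV2 ?posrE // (lt_trans ltr01 r1).
have e : q^-1 - r^-1 = - beta by rewrite opprB.
rewrite e mulrACA.
have -> : C * (u (b.+1 * k)%N * W nu (b.+1 * k)%N) * (4 `^ (- beta) * (n%:R / L n) `^ (- beta)) =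
  C * (u (b.+1 * k)%N * W nu (b.+1 * k)%N * (4 * (n%:R / L n)) `^ (- beta)).
  have x0 : 0 <= n%:R / L n by rewrite divr_ge0 // ltW.
  by rewrite [in RHS](powRM _ _ x0) // !mulrA.
apply: ler_wpM2l; first exact: ltW.
apply: ler_wpM2l; first exact: ltW.
rewrite !powRN lef_pV2 ?posrE ?powR_gt0 ?mulr_gt0 ?invr_gt0 ?ltr0n //.
by apply: ler_powr => //; exact: ltW.
Qed.

(** Unlike [profile], the slowly varying factor is taken at n itself. *)
Definition tail_profile (n : nat) : R := n%:R `^ (- (al - nu)) * (ru n%:R * rw n%:R).

Lemma tail_profile_gt0 n : (0 < n)%N -> 0 < tail_profile n.
Proof.
move=> n0; have n1 : 1 <= n%:R :> R by rewrite ler1n.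
rewrite /tail_profile mulr_gt0 ?powR_gt0 ?ltr0n // mulr_gt0 //; exact: sv_gt0.
Qed.

Lemma tail_near (P : nat * nat -> Prop) (J : nat * nat -> nat) :
  (forall i, P i -> (0 < i.2)%N) ->
  bounded_on P (fun i => ln (m * J i).+1%:R - ln i.2%:R : R) ->
  bounded_on P (fun i => ln (u (J i) * W nu (J i)) - ln (tail_profile i.2)).
Proof.
move=> P1 hP; have X1 i : P i -> 1 <= i.2%:R :> R by move=> /P1; rewrite ler1n.
apply: bounded_on_eq (diag_near ku kw au aw hru hrw X1 hP nu) => i Pi.
have Xi := X1 _ Pi; have np : 0 < i.2%:R :> R := lt_le_trans ltr01 Xi.
have r0 := sv_gt0 hru Xi; have r2 := sv_gt0 hrw Xi.
have rr : 0 < ru i.2%:R * rw i.2%:R by exact: mulr_gt0.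
rewrite /tail_profile [in RHS](@lnM _ (_ `^ _)) ?posrE ?powR_gt0 // ln_powR ka0.
by rewrite !mul0r oppr0; ring.
Qed.

Lemma upper_tail : - (al - nu) < 0 -> 0 < - (al - nu) + beta ->
  entropy_le c H r%:E q u w tail_profile.
Proof.
move=> k0 hk.
have [C C_0 hC] := upper_lt_dyadic_tail c1 H0 q1 Hhomo u0 w0 (W0 nu) C00 hW r1 rq kH0 HRl dR
  Cb0 hb hk k0.
have [B [n0 hB]] := choose_level_below kH0 HRl m0 Hhomo C_0.
pose P (i : nat * nat) := (2 <= i.2)%N /\ (1 <= H i.1 /\ `|ln (H i.1) - ln i.2%:R| <= B).
pose J (i : nat * nat) := Num.truncn (H i.1).
have hP : bounded_on P (fun i => ln (m * J i).+1%:R - ln i.2%:R : R).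
  have b1 : bounded_on P (fun i => ln (H i.1) - ln i.2%:R) by exists B => i [_ []].
  have b2 : bounded_on P (fun i => ln (m * J i).+1%:R - ln (H i.1)).
    exists (ln (m + 1)%:R) => i [_ [H1 _]].
    have /andP[h1 h2] := truncn_itv (ltW (H0 i.1)); rewrite -/(J i) in h1 h2.
    have e : expR (ln (m + 1)%:R) = (m + 1)%:R :> R by rewrite lnK // posrE ltr0n addn1.
    apply: ln_le_bound; rewrite ?e //.
      rewrite -natr1 natrM natrD mulrDl mul1r; apply: lerD => //.
      by apply: ler_wpM2l.
    apply: le_trans (ltW h2) _; apply: (@le_trans _ _ (m * J i).+1%:R).
      by rewrite ler_nat ltnS leq_pmull.
    by rewrite ler_peMl // ler1n addn1.
  by apply: bounded_on_eq (bounded_onD b2 b1) => i Pi; ring.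
have P0 i : P i -> (0 < i.2)%N by move=> [/ltnW].
have dn := tail_near P0 hP.
apply: (@entropy_le_intro _ _ _ _ _ _ _ P (fun i => u (J i) * W nu (J i)) _ _ _ dn C n0) => //.
  by move=> i [n2 _]; apply: tail_profile_gt0; exact: ltnW.
move=> n nn; have [j [h1 h2 [h3 h4 _ _]]] := hB n nn; exists j; split => [|V t].
  by split => //; split => //; apply: le_trans h2; rewrite ler1n.
exact: hC.
Qed.

(** A single vertex, s = 1, selected among 4 ^ (n + 1) vertices of a level whose number
    is comparable with n. *)
Lemma lower_tail : entropy_ge c H r%:E q u w tail_profile.
Proof.
have p1 : (1 < r%:E)%E by rewrite lte_fin.
have [C C_0 hC] := lower_single c1 H0 q1 u0 w0 (W0 nu) p1 C10 hW1.
have a0 : 0 < c * H 0%N by rewrite mulr_gt0 // (lt_le_trans ltr01 c1).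
have [b hbl] := level_multiple kH0 HRl a0.
pose P (i : nat * nat) := (0 < i.2)%N /\ i.1 = (b.+1 * i.2)%N.
have hP : bounded_on P (fun i => ln (m * i.1).+1%:R - ln i.2%:R : R).
  exists (ln (m * b.+1 + 1)%:R) => i [n2 ->].
  have e : expR (ln (m * b.+1 + 1)%:R) = (m * b.+1 + 1)%:R :> R.
    by rewrite lnK // posrE ltr0n addn1.
  apply: ln_le_bound; rewrite ?e ?ltr0n //; rewrite -natrM ler_nat.
    by rewrite mulnA mulnDl -addn1 leq_add2l mul1n.
  apply: leq_trans (leq_pmull _ _); last by rewrite addn1.
  by apply: leqW; rewrite mulnA leq_pmull // muln_gt0 m0.
have P0 i : P i -> (0 < i.2)%N by case.
have dn := tail_near P0 hP.
apply: (@entropy_ge_intro _ _ _ _ _ _ _ P (fun i => u i.1 * W nu i.1) _ _ _ dn C 1) => //.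
  by move=> i [n2 _]; exact: tail_profile_gt0.
move=> n n0; exists (b.+1 * n)%N; split => // V t.
have := hC V t (b.+1 * n)%N 1%N n n isT; rewrite muln1 powR1 mulr1; apply => //.
apply: (@leq_trans (8 ^ n.+1)); first by rewrite mul1n leq_exp2r.
by apply: size_level => //; rewrite natrX; exact: hbl.
Qed.

End CasesLt.

(** * The entropy numbers *)

Section Exponent.
Context {R : realType} (p : \bar R) (q : R).
Hypotheses (p1 : (1 < p)%E) (q1 : 1 <= q).
Notation ip := (fine p^-1%E).
Let q0 : 0 < q. Proof. exact: lt_le_trans ltr01 q1. Qed.

Lemma inv_exponent_le : (q%:E <= p)%E -> ip <= q^-1.
Proof.
move: p1; case: p => [r| |] // r1 qp; last by rewrite invey /= invr_ge0 ltW.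
rewrite lte_fin in r1; rewrite lee_fin in qp; have r0 : 0 < r by exact: lt_trans ltr01 r1.
by rewrite (fine_inv r1) lef_pV2 ?posrE.
Qed.

Lemma exponent_finite : (p < q%:E)%E -> exists2 r, p = r%:E & 1 < r /\ r < q.
Proof. by move: p1; case: p => [r| |] //; rewrite !lte_fin => r1 rq; exists r. Qed.

Lemma inv_exponent_le1 : ip <= 1.
Proof.
move: p1; case: p => [r| |] // r1.
rewrite lte_fin in r1; have r0 : 0 < r by exact: lt_trans ltr01 r1.
by rewrite (fine_inv r1) invf_le1 // ltW.
Qed.

Lemma max_exponent_ge : (q%:E <= p)%E -> Num.max (q^-1 - ip) 0 = q^-1 - ip.
Proof. by move=> /inv_exponent_le h; apply/max_idPl; rewrite subr_ge0. Qed.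

Lemma max_exponent_lt : (p < q%:E)%E -> Num.max (q^-1 - ip) 0 = 0.
Proof.
move=> /exponent_finite[r -> [r1 rq]]; apply/max_idPr; rewrite (fine_inv r1) subr_le0.
by rewrite lef_pV2 ?posrE ?(lt_trans ltr01 r1) // ltW.
Qed.

End Exponent.

Theorem theorem6 (R : realType) (p : \bar R) (q : R)
    (hp : (1 < p)%E) (hq : 1 <= q)
    (theta gamma : R) (tau h : R -> R) (htheta : 0 < theta)
    (htau : slowly_varying tau)
    (h_pos : forall t, 0 < t <= 1 -> 0 < h t)
    (h_mono : forall s t, 0 < s -> s <= t -> t <= 1 -> h s <= h t)
    (h_near0 : \forall t \near 0^'+,
       h t = t `^ theta * `|log2 t| `^ gamma * tau `|log2 t|)
    (m : nat) (hm : (0 < m)%N) (c : R) (hc : 1 <= c)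
    (kappa_u kappa_w alpha_u alpha_w : R) (rho_u rho_w : R -> R)
    (hrho_u : slowly_varying rho_u) (hrho_w : slowly_varying rho_w)
    (hw : theta / q < kappa_w \/
          kappa_w = theta / q /\ (1 - gamma) / q < alpha_w) :
  let kappa := kappa_u + kappa_w in
  let alpha := alpha_u + alpha_w in
  let rho := fun y : R => rho_u y * rho_w y in
  (* q^{-1} and p^{-1}, with 1/oo = 0 *)
  let iq : R := q^-1 in
  let ip : R := fine p^-1%E in
  let e_n_asymp := entropy_asymp p q%:E h m c
    (weight_seq m kappa_u alpha_u rho_u) (weight_seq m kappa_w alpha_w rho_w) in
  [/\ (* 1 *)
      theta * Num.max (iq - ip) 0 < kappa ->
      let alpha0 := if theta / q < kappa_w then alpha else alpha - iq in
      e_n_asymp (fun n : nat =>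
        n%:R `^ (- (kappa / theta) + iq - ip) *
        log2 n%:R `^ (- alpha0 - kappa * gamma / theta) *
        rho (log2 n%:R) * tau (log2 n%:R) `^ (- (kappa / theta))),
      (* 2(a) *)
      kappa = theta * Num.max (iq - ip) 0 -> (q%:E <= p)%E ->
      let alpha0 := if theta / q < kappa_w
                    then alpha - (1 - gamma) * (iq - ip)
                    else alpha - 1 - (1 - gamma) * (iq - ip) in
      0 < alpha0 ->
      e_n_asymp (fun n : nat =>
        log2 n%:R `^ (- alpha0) *
        rho (log2 n%:R) * tau (log2 n%:R) `^ (- iq + ip))
    & (* 2(b) *)
      kappa = theta * Num.max (iq - ip) 0 -> (p < q%:E)%E ->
      let alpha0 := if theta / q < kappa_w then alpha else alpha - iq in
      0 < alpha0 -> alpha0 != ip - iq ->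
      (ip - iq < alpha0 ->
       e_n_asymp (fun n : nat =>
         n%:R `^ (iq - ip) *
         log2 n%:R `^ (- alpha0 - iq + ip) * rho (log2 n%:R))) /\
      (alpha0 < ip - iq ->
       e_n_asymp (fun n : nat => n%:R `^ (- alpha0) * rho n%:R))].
Proof.
move=> kappa alpha rho iq ip e_n_asymp.
set H := fun j : nat => (h (2 ^- (m * j)))^-1.
pose u := weight_seq m kappa_u alpha_u rho_u; pose w := weight_seq m kappa_w alpha_w rho_w.
have H0 : forall j, 0 < H j by exact: count_gt0 h_pos.
have Hhomo : {homo H : i j / (i <= j)%N >-> i <= j} by exact: count_homo h_pos h_mono.
have HP := count_profile htau h_near0 hm.
have HR : reg (theta * (m%:R * ln 2)) (- gamma) H by exact: reg_count htau h_pos h_near0 hm.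
have q0 : 0 < q by exact: lt_le_trans ltr01 hq.
(* the correction of w in the critical case *)
pose nu := if theta / q < kappa_w then 0 else q^-1.
pose W := dual_weight m kappa_w alpha_w rho_w nu.
have u0 : forall j, 0 < u j := reg_gt0 (reg_weight kappa_u alpha_u hm hrho_u).
have w0 : forall j, 0 < w j := reg_gt0 (reg_weight kappa_w alpha_w hm hrho_w).
have W0 : forall j, 0 < W j by exact: dual_gt0.
have [C0 C00 hW] : exists2 C0, 0 < C0 &
    forall j M, \sum_(j <= l < M) w l `^ q * H l <= C0 * W j `^ q * H j.
  rewrite /W /nu; case: hw => [kw|[kw aw]]; first by rewrite kw; exact: tail_noncritical HR kw.
  by rewrite kw ltxx -kw; exact: tail_critical HR kw aw.
have [C1 C10 hW1] : exists2 C1, 0 < C1 & forall J, exists2 M, (J < M)%N &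
    W J `^ q * H J <= C1 * \sum_(J <= l < M) w l `^ q * H l.
  rewrite /W /nu; case: hw => [kw|[kw aw]].
    by rewrite kw; exists 1 => // J; exact: head_noncritical.
  by rewrite kw ltxx -kw; exact: head_critical HR kw.
have a0E : (if theta / q < kappa_w then alpha else alpha - iq) = alpha - nu.
  by rewrite /nu; case: ifP => // _; rewrite subr0.
have massR : rate lin ((theta - q * kappa_w) * (m%:R * ln 2)) (fun l => w l `^ q * H l).
  exact: reg_lin (reg_mass q kappa_w alpha_w hm hrho_w HR).
have neg : theta / q < kappa_w -> (theta - q * kappa_w) * (m%:R * ln 2) < 0.
  by move=> kw; rewrite pmulr_llt0 ?lam_gt0 // subr_lt0 mulrC -ltr_pdivrMr.
have Fpos s a : exists n1, forall n, (n1 <= n)%N ->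
    0 <= profile theta tau kappa_u kappa_w rho_u rho_w s a n.
  by exists 2%N => n n2; apply/ltW/profile_gt0.
split.
- move=> hk; cbv zeta; rewrite a0E; set F := (X in e_n_asymp X).
  have -> : F = profile theta tau kappa_u kappa_w rho_u rho_w (iq - ip)
      (- (alpha - nu) - kappa * gamma / theta).
    by apply/funext => n; rewrite /F /profile addrA.
  apply: entropy_asymp_intro (Fpos _ _) _ _; last first.
    exact: (lower_decaying kappa_u alpha_u hc hq htheta hm htau hrho_u hrho_w H0 HR HP hp C10 hW1).
  have [qp|pq] := leP q%:E p.
    rewrite (max_exponent_ge hp hq qp) in hk.
    exact: (upper_decaying_ge alpha_u hc hq htheta hm htau hrho_u hrho_w H0 HR Hhomo HP hp qp C00 hW hk).
  rewrite (max_exponent_lt hp hq pq) mulr0 in hk; have [r pr [r1 rq]] := exponent_finite hp pq.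
  exact: (upper_decaying_lt alpha_u hc hq htheta hm htau hrho_u hrho_w H0 HR Hhomo HP hp pr rq C00 hW hk).
- move=> hk qp; rewrite (max_exponent_ge hp hq qp) -/iq -/ip in hk.
  have hip : 0 <= 1 - q * ip.
    by rewrite subr_ge0 -(@mulfV _ q) ?gt_eqF // ler_pM2l // inv_exponent_le.
  have kt : kappa / theta = iq - ip by rewrite hk mulrC mulKf // gt_eqF.
  have FE (mu al0 : R) : - (alpha - nu) + mu - kappa * gamma / theta = - al0 ->
      (fun n : nat => log2 n%:R `^ (- al0) * rho (log2 n%:R) * tau (log2 n%:R) `^ (- iq + ip)) =
      profile theta tau kappa_u kappa_w rho_u rho_w (iq - ip)
        (- (alpha - nu) + mu - kappa * gamma / theta).
    move=> e; apply/funext => n; rewrite /profile e -/kappa kt addNr powRr0 mul1r.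
    by have -> : - iq + ip = - (iq - ip) by rewrite opprB addrC.
  case: hw => [kw|[kw aw]].
    rewrite kw; cbv zeta => al0.
    have nu0 : nu = 0 by rewrite /nu kw.
    rewrite (FE (iq - ip)); last by rewrite nu0 mulrAC kt; ring.
    have WE : W = w by rewrite /W nu0 dual_weight0.
    have dR : rate lg (- (alpha - 0) + (iq - ip) * - gamma)
        (fun j => u j * w j * H j `^ (iq - ip)).
      rewrite -[w](dual_weight0 m kappa_w alpha_w rho_w).
      apply: reg_lg (regM (reg_diag kappa_u kappa_w alpha_u alpha_w hm hrho_u hrho_w 0)
        (reg_powR (iq - ip) HR)).
      by rewrite -/kappa hk; ring.
    apply: entropy_asymp_intro (Fpos _ _) _ _; last first.
      have [C2 C20 hP] := spread_noncritical H0 hq u0 w0 dR.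
      have := lower_balanced hc hq htheta hm htau hrho_u hrho_w H0 HR HP hp C20 hP.
      by rewrite nu0 subr0.
    have [Cb Cb0 hb] := block_ge_noncritical hc H0 hq u0 w0 qp (neg kw) massR dR hip.
    have {}hb : forall (V : choiceType) (t : leveled c H V) e a b M, in_ball t p e ->
      (b <= 2 * a.+1)%N -> lsum t M (fun x => psum u w t (block a b) e x `^ q) <=
      (Cb * (u a * W a * H a `^ (iq - ip) * a.+1%:R `^ (iq - ip))) `^ q by rewrite WE.
    apply: (upper_balanced hc hq htheta hm htau hrho_u hrho_w H0 HR Hhomo HP hp qp C00 hW hk _ _ Cb0 hb).
      by rewrite subr_ge0 inv_exponent_le.
    by rewrite nu0 mulrAC -/kappa kt; move: al0; rewrite -/alpha; lra.
  rewrite kw ltxx; cbv zeta => al0.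
  have nuq : nu = iq by rewrite /nu kw ltxx.
  rewrite (FE (1 - ip)); last by rewrite nuq mulrAC kt; ring.
  have dR : rate lg (- alpha_u + - ip * - gamma) (fun j => u j * H j `^ (- ip)).
    apply: reg_lg (regM (reg_weight kappa_u alpha_u hm hrho_u) (reg_powR (- ip) HR)).
    have -> : kappa_u = kappa - kappa_w by rewrite /kappa addrK.
    by rewrite hk kw /iq; ring.
  apply: entropy_asymp_intro (Fpos _ _) _ _; last first.
    have [C2 C20 hP] := spread_critical H0 hq w0 dR (rate_mass_critical alpha_w hq hm hrho_w HR kw).
    have := lower_balanced hc hq htheta hm htau hrho_u hrho_w H0 HR HP hp C20 hP.
    rewrite -/ip nuq; congr (entropy_ge _ _ _ _ _ _ (profile _ _ _ _ _ _ _ _)).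
    by rewrite -/alpha -/kappa -/iq; ring.
  have [Cb Cb0 hb] := block_ge_critical hc H0 hq u0 w0 qp C00 W0 hW dR hip.
  apply: (upper_balanced hc hq htheta hm htau hrho_u hrho_w H0 HR Hhomo HP hp qp C00 hW hk _ _ Cb0 hb).
    by rewrite subr_ge0 inv_exponent_le1.
  by rewrite nuq mulrAC -/kappa kt; move: al0; rewrite -/alpha -/ip; lra.
- move=> hk pq; cbv zeta; rewrite a0E => al0 alne.
  rewrite (max_exponent_lt hp hq pq) mulr0 in hk; have [r pr [r1 rq]] := exponent_finite hp pq.
  have ipr : ip = r^-1 by rewrite /ip pr (fine_inv r1).
  have hb : exists2 Cb, 0 < Cb & forall (V : choiceType) (t : leveled c H V) e a b M delta,
    in_ball t r%:E e -> (b <= 2 * a.+1)%N -> 0 < delta ->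
    (forall x, block a b (lev t x) -> `|e x| <= delta) ->
    lsum t M (fun x => psum u w t (block a b) e x `^ q) <=
    (Cb * (u a * W a * delta `^ (1 - r / q))) `^ q.
    case: hw => [kw|[kw aw]].
      have WE : W = w by rewrite /W /nu kw dual_weight0.
      have dR : rate lg (- (alpha - 0)) (fun j => u j * w j).
        rewrite -[w](dual_weight0 m kappa_w alpha_w rho_w).
        apply: reg_lg (reg_diag kappa_u kappa_w alpha_u alpha_w hm hrho_u hrho_w 0).
        by rewrite -/kappa hk oppr0 mul0r.
      by rewrite WE; have := block_lt_noncritical hc H0 hq u0 w0 r1 rq (neg kw) massR dR.
    have dR : rate lg (- alpha_u + - q^-1 * - gamma) (fun j => u j * H j `^ (- q^-1)).
      apply: reg_lg (regM (reg_weight kappa_u alpha_u hm hrho_u) (reg_powR (- q^-1) HR)).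
      have -> : kappa_u = kappa - kappa_w by rewrite /kappa addrK.
      by rewrite hk kw; ring.
    have kH0 : 0 < theta * (m%:R * ln 2) by rewrite mulr_gt0 // lam_gt0.
    by have := block_lt_critical hc H0 hq u0 w0 r1 rq kH0 (reg_lin HR) C00 W0 hW dR.
  have [Cb Cb0 hb'] := hb.
  split => hlt.
    set F := (X in e_n_asymp X).
    have -> : F = profile theta tau kappa_u kappa_w rho_u rho_w (- (r^-1 - q^-1))
       (- (alpha - nu) + (r^-1 - q^-1) - kappa * gamma / theta).
      apply/funext => n; rewrite /F /profile -/kappa hk !mul0r oppr0 add0r addr0 powRr0 mulr1 ipr.
      have -> : - (r^-1 - q^-1) = q^-1 - r^-1 by rewrite opprB.
      by have -> : - (alpha - nu) + (r^-1 - q^-1) = - (alpha - nu) - iq + r^-1 by rewrite /iq; ring.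
    rewrite /e_n_asymp pr; apply: entropy_asymp_intro (Fpos _ _) _ _.
      apply: (upper_head hc hq htheta hm htau hrho_u hrho_w H0 HR Hhomo HP r1 rq hk C00 Cb0 hW hb').
      by move: hlt; rewrite ipr -/alpha /iq; lra.
    exact: (lower_head alpha_u hc hq htheta hm htau hrho_u hrho_w H0 HR r1 rq hk C10 hW1).
  rewrite /e_n_asymp pr; apply: entropy_asymp_intro.
  - by exists 1%N => n n1; apply/ltW; exact: (tail_profile_gt0 alpha_u alpha_w hrho_u hrho_w nu n1).
  - apply: (upper_tail hc hq htheta hm hrho_u hrho_w H0 HR Hhomo r1 rq hk C00 Cb0 hW hb').
      by rewrite oppr_lt0.
    by move: hlt; rewrite ipr -/alpha /iq; lra.
  - exact: (lower_tail alpha_u hc hq htheta hm hrho_u hrho_w H0 HR r1 hk C10 hW1).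
Qed.
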